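(* Let $\mathbf{F}/\mathbb{F}_2$ be an algebraic function field of genus $g\geq 3$ with full constant field $\mathbb{F}_2$ and class number $h$, and assume $B_1(\mathbf{F}/\mathbb{F}_2)\geq 3$. Then $A_{g-k}<h$ for every integer $k\geq 2$. Consequently, for every integer $k\geq 2$ there exists a divisor of degree $g-k$ and dimension zero.
   Context: $B_1(\mathbf{F}/\mathbb{F}_2)$ is the number of degree-one places. $A_n$ is the number of effective rational divisors of degree $n$. $h$ is the order of the group of degree-$0$ divisor classes. $\dim(D)$ is the $\mathbb{F}_2$-dimension of $\mathcal{L}(D)=\{x\in\mathbf{F}:(x)\geq -D\}\cup\{0\}$. *)

(* Defs.v *)
From HB Require Import structures.
From mathcomp Require Import all_boot all_order all_algebra.
From Stdlib Require List.
Set Implicit Arguments. Unset Strict Implicit. Unset Printing Implicit Defensive.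
Import Order.TTheory GRing.Theory Num.Theory.
Local Open Scope ring_scope.

Section FunctionField.
Variable F : fieldType.

Definition F2c (c : F) : Prop := c = 0 \/ c = 1.
Definition F2poly (p : {poly F}) : Prop := forall i : nat, F2c p`_i.
Definition transcendental_F2 (x : F) : Prop :=
  forall p : {poly F}, F2poly p -> p != 0 -> p.[x] != 0.
Definition in_F2x (x y : F) : Prop :=
  exists p q : {poly F}, [/\ F2poly p, F2poly q, q.[x] != 0 & y = p.[x] / q.[x]].
Definition finite_over_F2x (x : F) : Prop :=
  exists s : seq F, forall y : F, exists c : seq F,
    [/\ size c = size s, forall i : nat, in_F2x x c`_i
      & y = \sum_(i < size s) c`_i * s`_i].
Definition full_constant_field_F2 : Prop :=
  forall y : F, (exists p : {poly F}, [/\ F2poly p, p != 0 & root p y]) -> F2c y.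

Definition is_function_field_F2 : Prop :=
  [/\ (2%:R : F) = 0,
      exists x : F, transcendental_F2 x /\ finite_over_F2x x
    & full_constant_field_F2].

(* (the value at 0 is fixed to the junk value 0, standing for +infinity) *)
Definition is_dval (v : F -> int) : Prop :=
  [/\ v 0 = 0,
      forall x y, x != 0 -> y != 0 -> v (x * y) = v x + v y,
      forall x y, x != 0 -> y != 0 -> x + y != 0 -> Num.min (v x) (v y) <= v (x + y)
    & exists t, t != 0 /\ v t = 1].

Definition place : Type := {v : F -> int | is_dval v}.
Definition ord (P : place) (x : F) : int := sval P x.

Definition inO (P : place) (x : F) : Prop := x = 0 \/ 0 <= ord P x.
Definition inP (P : place) (x : F) : Prop := x = 0 \/ 0 < ord P x.

(* F_2-linear independence modulo P: over F_2 linear combinations are subset sums *)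
Definition indep_modP (P : place) (s : seq F) : Prop :=
  forall m : bitseq, size m = size s -> has id m -> ~ inP P (\sum_(x <- mask m s) x).

Definition place_deg (P : place) (d : nat) : Prop :=
  (exists s : seq F, [/\ size s = d, forall x, List.In x s -> inO P x & indep_modP P s])
  /\ (forall s : seq F, (forall x, List.In x s -> inO P x) -> indep_modP P s -> (size s <= d)%N).

Definition divisor : Type :=
  {D : place -> int | exists s : seq place, forall P, D P <> 0 -> List.In P s}.
Definition dv (D : divisor) (P : place) : int := sval D P.

Definition effective (D : divisor) : Prop := forall P, 0 <= dv D P.

Definition div_deg (D : divisor) (n : int) : Prop :=
  exists (s : seq place) (ds : seq nat),
    [/\ List.NoDup s, forall P, dv D P <> 0 -> List.In P s, List.Forall2 place_deg s ds
      & n = foldr (fun pd acc => dv D pd.1 * (pd.2)%:Z + acc) 0 (zip s ds)].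

Definition inL (D : divisor) (x : F) : Prop := x = 0 \/ forall P, - dv D P <= ord P x.

Definition F2indep (s : seq F) : Prop :=
  forall m : bitseq, size m = size s -> has id m -> \sum_(x <- mask m s) x != 0.

Definition ldim (D : divisor) (n : nat) : Prop :=
  (exists s : seq F, [/\ size s = n, forall x, List.In x s -> inL D x & F2indep s])
  /\ (forall s : seq F, (forall x, List.In x s -> inL D x) -> F2indep s -> (size s <= n)%N).

Definition is_genus (g : nat) : Prop :=
  (forall (A : divisor) (d : int) (l : nat), div_deg A d -> ldim A l -> d - l%:Z + 1 <= g%:Z)
  /\ (exists (A : divisor) (d : int) (l : nat), [/\ div_deg A d, ldim A l & d - l%:Z + 1 = g%:Z]).

Definition lin_equiv (D1 D2 : divisor) : Prop :=
  exists x : F, x != 0 /\ forall P, dv D1 P = dv D2 P + ord P x.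

Definition class_number (h : nat) : Prop :=
  exists s : seq divisor,
    [/\ size s = h, forall D, List.In D s -> div_deg D 0,
        forall i j : nat, (i < h)%N -> (j < h)%N -> i <> j ->
          forall Di Dj, List.nth_error s i = Some Di -> List.nth_error s j = Some Dj -> ~ lin_equiv Di Dj
      & forall D, div_deg D 0 -> exists D', List.In D' s /\ lin_equiv D D'].

End FunctionField.

Definition card_is (T : Type) (A : T -> Prop) (n : nat) : Prop :=
  exists s : seq T, [/\ List.NoDup s, forall x, A x <-> List.In x s & size s = n].

(* Main.v *)
Require Import Defs.
From HB Require Import structures.
From mathcomp Require Import all_boot all_order all_algebra.
From mathcomp Require Import boolp functions.
From mathcomp Require Import zify ring lra.
Set Implicit Arguments. Unset Strict Implicit. Unset Printing Implicit Defensive.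
Import Order.TTheory GRing.Theory Num.Theory.
Local Open Scope ring_scope.

(** Write A_n for the number of effective divisors of degree n and N_n for the number of points over
    the field with 2^n elements.  Summing 2^l over the h divisor classes of a given degree,
    Riemann-Roch gives A_(g-1+j) = 2^j A_(g-1-j) + h (2^j - 1), and inclusion-exclusion over three
    rational places gives A_n - 3 A_(n-1) + 3 A_(n-2) - A_(n-3) >= 0.  Put M_n = A_n - 2 A_(n-1), which
    equals h for large n.  By Newton's identity n A_n = sum_k N_k A_(n-k), the power series
    M(t) / (1 - rho t)^c has logarithmic derivative with coefficients N_n - 2^n + c rho^n; these are
    nonnegative for rho > sqrt 2 and c large because N_n >= 2^n - C 2^(n/2).  Hence M(t) >= 0 for
    0 < t < 1/rho, and for t = 7/10 this contradicts A_(g-2) >= h together with the inclusion-exclusion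
    inequalities at n = g and n = g + 1.

    The lower bound on N_n comes from Stepanov's method: x^q + x (q = 2^n) has few multiple zeros, its
    zeros at which y^q = y are points over the field with q elements, and the others are zeros of an
    auxiliary function of small degree.  Riemann-Roch is obtained by Weil's duality with the additive
    maps from F to the field with two elements. *)

(** * Vector spaces over the field with two elements *)

(** The series [M] is $L(t)/(1-t)$ with $L$ the numerator of the zeta function, and the only part of
    the Riemann hypothesis that enters is $L(7/10) \ge 0$, the point being just below $1/\sqrt 2$. A
    series with nonnegative coefficients cannot have a negative sum, so a one-sided estimate of the
    $N_n$ gives this. All convergence is geometric with explicit constants, which lets the analysis
    take place over the rationals.

    The definitions supply bare valuations and a genus that is attained; finiteness of residue
    degrees and of supports, and degree 0 of principal divisors, are all derived by comparing
    dimensions over the field with two elements. One rational place [P0] is fixed throughout: its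
    multiples are divisors of every degree, the functions regular outside [P0] act as a coordinate
    ring, and the pole order at [P0] acts as the degree of a polynomial. *)

Definition is_sub (V : zmodType) (U : V -> Prop) : Prop :=
  U 0 /\ forall x y, U x -> U y -> U (x + y).

Definition zsub (V : zmodType) : V -> Prop := fun x => x = 0.

(** The scalars are 0 and 1, so adjoining [x] adds just one translate of the span. *)
Fixpoint gen (V : zmodType) (U : V -> Prop) (s : seq V) : V -> Prop :=
  if s is x :: s' then fun y => gen U s' y \/ gen U s' (y + x) else U.

Fixpoint free (V : zmodType) (U : V -> Prop) (s : seq V) : Prop :=
  if s is x :: s' then ~ gen U s' x /\ free U s' else True.

Fixpoint sums (V : zmodType) (s : seq V) : seq V :=
  if s is x :: s' then sums s' ++ [seq y + x | y <- sums s'] else [:: 0].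

(* [W] is [U] plus the span of [n] vectors independent modulo [U], so that [U] has index [2 ^ n] in [W]. *)
Definition reldim (V : zmodType) (U W : V -> Prop) (n : nat) : Prop :=
  exists s : seq V, [/\ size s = n, free U s & W = gen U s].

Lemma prop_eq (V : Type) (A B : V -> Prop) : (forall x, A x <-> B x) -> A = B.
Proof. by move=> AB; apply/funext => x; apply/propext. Qed.

Section Char2Space.
Variable V : zmodType.
Hypothesis addvv : forall x : V, x + x = 0.
Implicit Types (U W X : V -> Prop) (s t : seq V).

Lemma addKv (x y : V) : x + y + y = x. Proof. by rewrite -addrA addvv addr0. Qed.
Lemma addvv_eq0 (x y : V) : x + y = 0 -> x = y.
Proof. by move=> h; rewrite -[LHS](addKv _ y) h add0r. Qed.

Lemma zsub_sub : is_sub (@zsub V).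
Proof. by split=> // x y -> ->; rewrite /zsub addr0. Qed.

Lemma gen_sub U s : is_sub U -> is_sub (gen U s).
Proof.
move=> hU; elim: s => //= a s [h0 hD]; split; first by left.
move=> x y [hx|hx] [hy|hy].
- by left; apply: hD.
- by right; rewrite -addrA; apply: hD.
- by right; rewrite addrAC; apply: hD.
- by left; rewrite (_ : x + y = (x + a) + (y + a)); [exact: hD | rewrite addrACA addvv addr0].
Qed.

Lemma gen_incl U s y : U y -> gen U s y.
Proof. by move=> Uy; elim: s => //= a s IH; left. Qed.

Lemma gen_mem U s y : is_sub U -> y \in s -> gen U s y.
Proof.
move=> hU; elim: s => //= a s IH; rewrite inE => /orP[/eqP->|/IH]; last by left.
by right; rewrite addvv; case: (gen_sub s hU).
Qed.

Lemma gen_min U W s : is_sub W -> (forall y, U y -> W y) -> (forall y, y \in s -> W y) ->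
  forall y, gen U s y -> W y.
Proof.
move=> [W0 WD] UW; elim: s => //= a s IH sW y [h|h].
  by apply: IH h => z zs; apply: sW; rewrite inE zs orbT.
rewrite -(addKv y a); apply: WD; last by apply: sW; rewrite inE eqxx.
by apply: IH h => z zs; apply: sW; rewrite inE zs orbT.
Qed.

Lemma gen_cat U s t : gen U (s ++ t) = gen (gen U t) s.
Proof. by elim: s => //= a s ->. Qed.

Lemma free_cat U s t : free U (s ++ t) <-> free (gen U t) s /\ free U t.
Proof.
elim: s => [|a s IH] /=; first by split=> [|[]].
rewrite gen_cat; split; first by move=> [h1 /IH[h2 h3]].
by move=> [[h1 h2] h3]; split=> //; apply/IH.
Qed.

Lemma free_mono U W s : (forall y, U y -> W y) -> free W s -> free U s.
Proof.
move=> UW.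
have gUW t y : gen U t y -> gen W t y.
  by elim: t y => [|a t IH] y /=; [exact: UW | move=> [/IH|/IH]; [left | right]].
by elim: s => //= a s IH [h1 /IH h2]; split=> // /gUW.
Qed.

Lemma size_sums s : size (sums s) = (2 ^ size s)%N.
Proof. by elim: s => //= a s IH; rewrite size_cat size_map IH expnS mul2n addnn. Qed.

Lemma gen_sums U s y : gen U s y <-> exists2 z, z \in sums s & U (y + z).
Proof.
elim: s y => [|a s IH] y /=.
  by split=> [Uy|[z]]; [exists 0; rewrite ?inE ?addr0 | rewrite inE => /eqP ->; rewrite addr0].
split.
  move=> [/IH[z zs h]|/IH[z zs h]].
    by exists z => //; rewrite mem_cat zs.
  exists (z + a); last by rewrite addrA addrAC.
  by rewrite mem_cat (map_f (fun y => y + a)) ?orbT.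
move=> [z]; rewrite mem_cat => /orP[zs h|/mapP[w ws ->] h].
  by left; apply/IH; exists z.
by right; apply/IH; exists w => //; rewrite addrAC -addrA.
Qed.

Lemma sums_gen s z : z \in sums s <-> gen (@zsub V) s z.
Proof.
rewrite gen_sums; split=> [zs|[w ws h]]; first by exists z => //; exact: addvv.
by rewrite (addvv_eq0 h).
Qed.

Lemma free_pairwise U s : is_sub U -> free U s ->
  pairwise (fun a b => ~~ `[< U (a + b) >]) (sums s).
Proof.
move=> hU; elim: s => //= a s IH [ha /IH hs].
rewrite pairwise_cat hs /=; apply/andP; split.
  apply/allrelP => x y xs /mapP[z zs ->]; apply/negP => /asboolP h; apply: ha.
  have h' : gen U s (x + z).
    case: (gen_sub s hU) => _ hD; apply: hD.
      by apply/gen_sums; exists x => //; rewrite addvv; case: hU.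
    by apply/gen_sums; exists z => //; rewrite addvv; case: hU.
  rewrite (_ : a = (x + (z + a)) + (x + z)); last first.
    by rewrite [x + (z + a)]addrA [x + z + a]addrC addKv.
  case: (gen_sub s hU) => _ hD; apply: hD => //; exact: gen_incl.
rewrite pairwise_map; apply: sub_pairwise hs => x y /=.
by rewrite addrACA addvv addr0.
Qed.

(** Counting replaces the exchange argument: the subset sums of [t] lie in distinct cosets of [U],
    and each of these cosets contains a subset sum of [s], so $2^{|t|} \le 2^{|s|}$. *)
Lemma free_size U s t : is_sub U -> free U t -> (forall y, y \in t -> gen U s y) ->
  (size t <= size s)%N.
Proof.
move=> hU ft ts.
have h1 y : y \in sums t -> exists z, z \in sums s /\ U (y + z).
  move=> /sums_gen yt; have : gen U s y.
    by apply: (gen_min (gen_sub s hU) _ ts yt) => z ->; case: (gen_sub s hU).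
  by move/gen_sums => [z zs h]; exists z.
have /choice[g hg] : forall y, exists z, y \in sums t -> z \in sums s /\ U (y + z).
  move=> y; have [/h1[z hz]|_] := boolP (y \in sums t); first by exists z.
  by exists 0.
have : uniq [seq g y | y <- sums t].
  rewrite uniq_pairwise pairwise_map.
  apply: (@sub_in_pairwise _ (mem (sums t)) _ _ _ _ _ (free_pairwise hU ft)); last exact/allP.
  move=> x y xt yt /=; have [_ hx] := hg x xt; have [_ hy] := hg y yt; apply: contra => /eqP e; apply/asboolP.
  rewrite e in hx; case: hU => _ hD.
  by rewrite -(addKv x (g y)) -addrA [g y + y]addrC; apply: hD.
move=> ug; rewrite -(leq_exp2l _ _ (ltnSn 1)) -!size_sums -(size_map g).
apply: uniq_leq_size ug _.
by move=> z /mapP[y yt ->]; have [] := hg y yt.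
Qed.

Lemma reldim_uniq U W n m : is_sub U -> reldim U W n -> reldim U W m -> n = m.
Proof.
move=> hU [s [<- fs ->]] [t [<- ft e]]; apply/eqP; rewrite eqn_leq; apply/andP; split.
  by apply: free_size fs _ => // y ys; rewrite -e; apply: gen_mem.
by apply: free_size ft _ => // y ys; rewrite e; apply: gen_mem.
Qed.

Lemma reldim_refl U : reldim U U 0.
Proof. by exists [::]. Qed.

Lemma reldim_trans U W X n m : reldim U W n -> reldim W X m -> reldim U X (n + m).
Proof.
move=> [s [<- fs ->]] [t [<- ft ->]]; exists (t ++ s).
by rewrite size_cat addnC gen_cat; split=> //; apply/free_cat.
Qed.

Lemma reldim_sub1 U W n : reldim U W n -> forall x, U x -> W x.
Proof. by move=> [s [_ _ ->]] x; apply: gen_incl. Qed.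

Lemma reldim_is_sub U W n : is_sub U -> reldim U W n -> is_sub W.
Proof. by move=> hU [s [_ _ ->]]; apply: gen_sub. Qed.

(** A free family of maximal size in [W] generates it, and [N] makes the maximum exist. *)
Lemma reldim_bound U W N : is_sub U -> is_sub W -> (forall x, U x -> W x) ->
  (forall s, (forall x, x \in s -> W x) -> free U s -> (size s <= N)%N) ->
  exists2 n, (n <= N)%N & reldim U W n.
Proof.
move=> hU hW UW hb.
pose Q n := `[< exists s, [/\ size s = n, free U s & forall x, x \in s -> W x] >].
have exQ : exists n, Q n by exists 0%N; apply/asboolP; exists [::].
have bQ n : Q n -> (n <= N)%N by move=> /asboolP[s [<- fs sW]]; apply: hb.
case: (ex_maxnP exQ bQ) => n Qn mx; exists n; first exact: bQ.
move/asboolP: Qn => [s [sn fs sW]]; exists s; split=> //; apply/prop_eq => x; split.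
  move=> Wx; apply: contrapT => ngx; have: Q n.+1.
    apply/asboolP; exists (x :: s); split=> //=; first by rewrite sn.
    by move=> y; rewrite inE => /orP[/eqP->|/sW].
  by move/mx; rewrite ltnn.
exact: gen_min.
Qed.

Lemma reldim_size U W n s : is_sub U -> reldim U W n -> (forall x, x \in s -> W x) ->
  free U s -> (size s <= n)%N.
Proof. by move=> hU [t [<- ft ->]] sW fs; apply: free_size fs _. Qed.

Lemma reldim_mid U W X n : is_sub U -> is_sub W -> reldim U X n ->
  (forall x, U x -> W x) -> (forall x, W x -> X x) ->
  exists a b, [/\ reldim U W a, reldim W X b & n = (a + b)%N].
Proof.
move=> hU hW hn UW WX.
have [|a _ ha] := @reldim_bound U W n hU hW UW.
  by move=> s sW; apply: (reldim_size hU hn) => x /sW /WX.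
have [|b _ hb] := @reldim_bound W X n hW (reldim_is_sub hU hn) WX.
  by move=> s sX /(free_mono UW); apply: (reldim_size hU hn).
exists a, b; split=> //; apply: reldim_uniq hU hn _; exact: reldim_trans ha hb.
Qed.

Lemma reldim_le U W X n m : is_sub U -> reldim U W n -> reldim U X m ->
  (forall x, W x -> X x) -> (n <= m)%N.
Proof.
move=> hU hn hm WX.
have [a [b [ha _ ->]]] := reldim_mid hU (reldim_is_sub hU hn) hm (reldim_sub1 hn) WX.
by rewrite (reldim_uniq hU hn ha) leq_addr.
Qed.

Lemma reldim_eq U W X n : is_sub U -> reldim U W n -> reldim U X n ->
  (forall x, W x -> X x) -> W = X.
Proof.
move=> hU hn hm WX.
have [a [b [ha hb e]]] := reldim_mid hU (reldim_is_sub hU hn) hm (reldim_sub1 hn) WX.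
move: e hb; rewrite (reldim_uniq hU hn ha) => e.
have -> : b = 0%N by lia.
by case=> -[|x s] [] // _ _ ->.
Qed.

Lemma sums_uniq s : free (@zsub V) s -> uniq (sums s).
Proof.
move=> fs; rewrite uniq_pairwise; apply: sub_pairwise (free_pairwise zsub_sub fs) => x y.
by apply: contra => /eqP ->; apply/asboolP; exact: addvv.
Qed.

Lemma reldim_list W n : reldim (@zsub V) W n ->
  exists s, [/\ uniq s, size s = (2 ^ n)%N & forall x, x \in s <-> W x].
Proof.
move=> [s [<- fs ->]]; exists (sums s); split; [exact: sums_uniq | exact: size_sums |].
by move=> x; apply: sums_gen.
Qed.

End Char2Space.

(** * Index under an additive map *)

Section Morphism.
Variables V V' : zmodType.
Hypothesis addvv : forall x : V, x + x = 0.
Hypothesis addvv' : forall x : V', x + x = 0.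
Variable f : V -> V'.
Hypothesis fD : forall x y, f (x + y) = f x + f y.
Variables (U W : V -> Prop) (U' W' : V' -> Prop).
Hypotheses (hU : is_sub U) (hW : is_sub W) (UW : forall x, U x -> W x).
Hypotheses (hU' : is_sub U') (fW : forall x, W x -> W' (f x)).
Hypothesis fU : forall x, W x -> U x <-> U' (f x).

Lemma gen_map s x : (forall y, y \in s -> W y) -> W x ->
  gen U' [seq f y | y <- s] (f x) <-> gen U s x.
Proof.
elim: s x => [|a s IH] x sW Wx /=; first by split=> /(fU Wx).
have sW' y : y \in s -> W y by move=> ys; apply: sW; rewrite inE ys orbT.
have Wxa : W (x + a) by case: hW => _; apply=> //; apply: sW; rewrite inE eqxx.
by rewrite -fD; split=> -[/IH|/IH] h; [left|right|left|right]; apply: h.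
Qed.

Lemma free_map s : (forall y, y \in s -> W y) -> free U s -> free U' [seq f y | y <- s].
Proof.
elim: s => //= a s IH sW [h1 h2].
have sW' y : y \in s -> W y by move=> ys; apply: sW; rewrite inE ys orbT.
have Wa : W a by apply: sW; rewrite inE eqxx.
by split=> [/(gen_map sW' Wa)|]; [|apply: IH].
Qed.

(** By [fU], [U] is the preimage of [U'] in [W], so [f] embeds [W / U] into [W' / U']. *)
Lemma reldim_inj n : reldim U' W' n -> exists2 a, (a <= n)%N & reldim U W a.
Proof.
move=> h; apply: reldim_bound => // s sW fs.
rewrite -(size_map f); apply: (reldim_size addvv' hU' h); last exact: free_map.
by move=> y /mapP[z /sW /fW Wz ->].
Qed.

Lemma reldim_iso n : (forall y, W' y -> exists2 x, W x & U' (y + f x)) ->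
  reldim U' W' n -> reldim U W n.
Proof.
move=> sur h; have [a _ ha] := reldim_inj h.
suff -> : n = a by [].
apply: (reldim_uniq addvv' hU' h); case: (ha) => s [<- fs We].
have sW y : y \in s -> W y by rewrite We; apply: gen_mem.
exists [seq f y | y <- s]; split; [by rewrite size_map | exact: free_map |].
have hW' : is_sub W' by apply: reldim_is_sub h.
have U'W' := reldim_sub1 h.
apply/prop_eq => y; split.
  move=> /sur[x Wx Uyx].
  have : gen U' [seq f y | y <- s] (f x) by apply/gen_map => //; rewrite -We.
  move=> gx; rewrite -(addKv addvv' y (f x)).
  by case: (gen_sub addvv' [seq f y | y <- s] hU') => _; apply=> //; apply: gen_incl.
by apply: gen_min => // z /mapP[w /sW /fW ? ->].
Qed.

End Morphism.

(** [W / I] embeds in [X / U], and equal indices make the embedding onto. Approximation by functions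
    is deduced from equal dimensions in this way. *)
Lemma reldim_cover (V : zmodType) (addvv : forall x : V, x + x = 0) (I U W X : V -> Prop) e :
  is_sub I -> is_sub U -> is_sub W -> (forall x, W x -> X x) ->
  (forall x, W x -> I x <-> U x) -> (forall x, I x -> W x) ->
  reldim I W e -> reldim U X e -> forall x, X x -> exists2 w, W w & U (x + w).
Proof.
move=> hI hU hW WX IU IW [s [se fs We]] hX x Xx.
have sW y : y \in s -> W y by rewrite We; apply: gen_mem.
have fs' : free U s.
  have := @free_map V V id (fun _ _ => erefl) I W U hW IU s sW fs.
  by rewrite map_id.
have sX := reldim_is_sub addvv hU hX.
have gX y : gen U s y -> X y.
  by apply: (gen_min addvv sX (reldim_sub1 hX)) => z /sW/WX.
have e1 : reldim U (gen U s) e by exists s.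
have := reldim_eq addvv hU e1 hX gX => e2; rewrite -e2 in Xx.
move/gen_sums: Xx => [z zs h]; exists z => //.
have := sums_gen addvv s z => -[/(_ zs) gz _].
by apply: (gen_min addvv hW _ sW gz) => y ->; case: hW.
Qed.

(** The source of all auxiliary functions and algebraic relations below: more unknowns than
    conditions. *)
Lemma reldim_kernel (V V' : zmodType) (addvv : forall x : V, x + x = 0)
    (addvv' : forall x : V', x + x = 0) (f : V -> V') (W : V -> Prop) (W' : V' -> Prop) n m :
  {morph f : x y / x + y} -> (forall x, W x -> W' (f x)) ->
  reldim (@zsub V) W n -> reldim (@zsub V') W' m -> (m < n)%N ->
  exists x, [/\ W x, x <> 0 & f x = 0].
Proof.
move=> fD fW hn hm mn; apply: contrapT => nex.
have f0 : f 0 = 0 by rewrite -[RHS](addvv' (f 0)) -fD addr0.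
have hW : is_sub W := reldim_is_sub addvv (zsub_sub V) hn.
have [||a an ha] := @reldim_inj _ _ addvv addvv' f fD (@zsub V) W (@zsub V') W'
  (zsub_sub V) hW _ (zsub_sub V') fW _ m hm.
- by move=> x ->; case: hW.
- move=> x Wx; split=> [->|e]; first exact: f0.
  by apply: contrapT => x0; apply: nex; exists x.
by rewrite (reldim_uniq addvv (zsub_sub V) hn ha) ltnNge an in mn.
Qed.

Lemma reldim_image (V V' : zmodType) (addvv : forall x : V, x + x = 0)
    (addvv' : forall x : V', x + x = 0) (f : V -> V') (W : V -> Prop) n :
  {morph f : x y / x + y} -> reldim (@zsub V) W n ->
  exists2 a, (a <= n)%N & reldim (@zsub V') (fun y => exists2 x, W x & y = f x) a.
Proof.
move=> fD [s [<- fs ->]].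
have f0 : f 0 = 0 by rewrite -[RHS](addvv' (f 0)) -fD addr0.
have e t y : gen (@zsub V') [seq f x | x <- t] y <-> exists2 x, gen (@zsub V) t x & y = f x.
  elim: t y => [|a t IH] y /=.
    by split=> [->|[x -> ->]]; [exists 0 | exact: f0].
  split=> [[/IH[x h ->]|/IH[x h e]]|[x [h|h] ->]].
  - by exists x => //; left.
  - by exists (x + a); [right; rewrite addKv | rewrite fD -e addKv].
  - by left; apply/IH; exists x.
  - by right; apply/IH; exists (x + a); rewrite ?fD.
rewrite -(size_map f s); have -> : (fun y => exists2 x, gen (@zsub V) s x & y = f x) =
  gen (@zsub V') [seq f x | x <- s] by apply/prop_eq => y; rewrite e.
apply: (reldim_bound addvv' (zsub_sub V') (gen_sub addvv' _ (zsub_sub V'))).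
  by move=> y; apply: gen_incl.
by move=> t tW ft; apply: (free_size addvv' (zsub_sub V') ft).
Qed.

Section PolyDim.
Variable R : nzRingType.
Hypothesis addff : forall x : R, x + x = 0.

Lemma addpp (p : {poly R}) : p + p = 0.
Proof. by apply/polyP => i; rewrite coefD addff coef0. Qed.

(** Polynomials are used as tuples here, so that [reldim_kernel] can be applied to several unknown
    functions at once. *)
Lemma reldim_poly (S : nat -> R -> Prop) (n : nat -> nat) r :
  (forall i, reldim (@zsub R) (S i) (n i)) ->
  reldim (@zsub {poly R}) (fun p => (size p <= r)%N /\ forall i, (i < r)%N -> S i p`_i)
    (\sum_(i < r) n i).
Proof.
move=> hS; have hs i : is_sub (S i) := reldim_is_sub addff (zsub_sub R) (hS i).
have hP k : is_sub (fun p : {poly R} => (size p <= k)%N /\ forall i, (i < k)%N -> S i p`_i).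
  split; first by rewrite size_poly0; split=> // i _; rewrite coef0; case: (hs i).
  move=> p q [p1 p2] [q1 q2]; split.
    by apply: leq_trans (size_polyD _ _) _; rewrite geq_max p1.
  by move=> i ik; rewrite coefD; case: (hs i) => _; apply; [apply: p2 | apply: q2].
elim: r => [|r IH].
  rewrite big_ord0; suff -> : (fun p : {poly R} => (size p <= 0)%N /\
      forall i, (i < 0)%N -> S i p`_i) = @zsub _ by apply: reldim_refl.
  apply/prop_eq => p; rewrite leqn0 size_poly_eq0 /zsub; split=> [[/eqP]|->] //.
rewrite big_ord_recr /=; apply: reldim_trans IH _.
apply: (@reldim_iso _ _ addpp addff (fun p : {poly R} => p`_r) _ _ _ (@zsub R) (S r)) => //.
- by move=> x y; rewrite coefD.
- move=> p [p1 p2]; split=> [|i]; first exact: leq_trans p1 _.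
  rewrite ltnS leq_eqVlt => /orP[/eqP->|/p2 //].
  by rewrite nth_default //; case: (hs r).
- exact: zsub_sub.
- by move=> p [p1 p2]; apply: p2.
- move=> p [p1 p2]; split=> [[q1 q2]|e]; first by rewrite /zsub nth_default.
  split=> [|i ir]; last by apply: p2; rewrite ltnS ltnW.
  apply/leq_sizeP => j; rewrite leq_eqVlt => /orP[/eqP <- //|rj].
  by rewrite nth_default //; apply: leq_trans p1 _.
- move=> y Sy; exists (y *: 'X^r); last by rewrite coefZ coefXn eqxx mulr1; exact: addff.
  split=> [|i]; first by apply: leq_trans (size_scale_leq _ _) _; rewrite size_polyXn.
  move=> _; rewrite coefZ coefXn; case: eqP => [->|]; first by rewrite mulr1.
  by rewrite mulr0; case: (hs i).
Qed.

End PolyDim.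

(** * Places and divisors *)

Lemma InP (T : eqType) (x : T) s : List.In x s <-> x \in s.
Proof.
elim: s => //= a s IH; rewrite inE; split=> [[->|/IH->]|/orP[/eqP->|/IH]]; rewrite ?eqxx ?orbT //.
  by left.
by right.
Qed.

Lemma NoDupP (T : eqType) (s : seq T) : List.NoDup s <-> uniq s.
Proof.
elim: s => [|a s IH] /=; first by split=> // _; constructor.
split=> [h|/andP[as_ /IH us]].
  by inversion h; apply/andP; split; [apply/negP => /InP | apply/IH].
by constructor=> // /InP; apply/negP.
Qed.

Section Masks.
Variable V : zmodType.
Hypothesis addvv : forall x : V, x + x = 0.

Lemma gen_mask (U : V -> Prop) s y :
  gen U s y <-> exists m, size m = size s /\ U (y + \sum_(x <- mask m s) x).
Proof.
elim: s y => [|a s IH] y /=.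
  split=> [Uy|[m [/size0nil -> ]]]; last by rewrite big_nil addr0.
  by exists [::]; rewrite big_nil addr0.
split=> [[/IH[m [sm h]]|/IH[m [sm h]]]|[[|b m] [] //= [sm] h]].
- by exists (false :: m); rewrite /= sm.
- by exists (true :: m); rewrite /= sm big_cons addrA.
case: b h => h; [right|left]; apply/IH; exists m; split=> //.
by rewrite big_cons addrA in h.
Qed.

(** Links [free] with the independence by bit masks of the definitions. *)
Lemma free_mask (U : V -> Prop) s :
  free U s <-> forall m, size m = size s -> has id m -> ~ U (\sum_(x <- mask m s) x).
Proof.
elim: s => [|a s IH]; first by split=> // _ [].
split=> [/= [h1 /IH h2] [|[] m] //= [sm]|h /=].
- by move=> _; rewrite big_cons => h; apply: h1; apply/gen_mask; exists m.
- exact: h2.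
split; first by move=> /gen_mask[m [sm hm]]; apply: (h (true :: m)); rewrite /= ?sm ?big_cons.
by apply/IH => m sm hm; apply: (h (false :: m)); rewrite /= ?sm.
Qed.

Lemma reldim_max (U W : V -> Prop) n : is_sub U -> is_sub W -> (forall x, U x -> W x) ->
  reldim U W n <->
  (exists s, [/\ size s = n, forall x, List.In x s -> W x & free U s]) /\
  (forall s, (forall x, List.In x s -> W x) -> free U s -> (size s <= n)%N).
Proof.
move=> hU hW UW; split.
  move=> h; split; last by move=> s sW; apply: (reldim_size addvv hU h) => x /InP/sW.
  by case: h => s [? ? ->]; exists s; split=> // x /InP; apply: gen_mem.
move=> [[s [sn sW fs]] hb].
have [|a an ha] := @reldim_bound _ addvv U W n hU hW UW.
  by move=> t tW; apply: hb => x /InP/tW.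
have na : (n <= a)%N.
  by rewrite -sn; apply: (reldim_size addvv hU ha) fs => x /InP/sW.
by rewrite (_ : n = a) //; apply/eqP; rewrite eqn_leq na.
Qed.
End Masks.

(** Equality is decided classically, so that supports can be handled as duplicate-free lists. *)
HB.instance Definition _ (F : fieldType) := gen_eqMixin (place F).
HB.instance Definition _ (F : fieldType) := gen_choiceMixin (place F).
HB.instance Definition _ (F : fieldType) := gen_eqMixin (divisor F).
HB.instance Definition _ (F : fieldType) := gen_choiceMixin (divisor F).

Section Valuations.
Variable F : fieldType.
Hypothesis char2 : (2%:R : F) = 0.
Implicit Types (P Q : place F) (x y z : F).

Lemma addff x : x + x = 0.
Proof. by rewrite -mulr2n -mulr_natr char2 mulr0. Qed.

Lemma oppx x : - x = x.
Proof. by apply/eqP; rewrite eq_sym -addr_eq0 addff. Qed.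

Lemma sqrD x y : (x + y) ^+ 2 = x ^+ 2 + y ^+ 2.
Proof. by rewrite sqrrD -mulr_natr char2 mulr0 addr0. Qed.

Lemma exp2kD k x y : (x + y) ^+ (2 ^ k) = x ^+ (2 ^ k) + y ^+ (2 ^ k).
Proof. by elim: k => [|k IH]; rewrite ?expr1 // expnSr !exprM IH sqrD. Qed.

Lemma ord0 P : ord P 0 = 0. Proof. by case: P => v []. Qed.
Lemma ordM P x y : x != 0 -> y != 0 -> ord P (x * y) = ord P x + ord P y.
Proof. by case: P => v [] /= _ h _ _; apply: h. Qed.
Lemma ordD P x y : x != 0 -> y != 0 -> x + y != 0 ->
  Num.min (ord P x) (ord P y) <= ord P (x + y).
Proof. by case: P => v [] /= _ _ h _; apply: h. Qed.
Lemma ord_unif P : exists2 t, t != 0 & ord P t = 1.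
Proof. by case: P => v [] /= _ _ _ [t []]; exists t. Qed.

Lemma ord1 P : ord P 1 = 0.
Proof. by have := @ordM P 1 1 (oner_neq0 _) (oner_neq0 _); rewrite mulr1; lia. Qed.
Lemma ordV P x : ord P x^-1 = - ord P x.
Proof.
have [->|x0] := eqVneq x 0; first by rewrite invr0 ord0 oppr0.
have := @ordM P x x^-1 x0; rewrite invr_eq0 mulfV // ord1 => /(_ x0); lia.
Qed.
Lemma ordX P x n : ord P (x ^+ n) = ord P x *+ n.
Proof.
have [->|x0] := eqVneq x 0.
  by rewrite ord0 mul0rn expr0n; case: n => [|n] /=; rewrite ?ord1 ?ord0.
elim: n => [|n IH]; first by rewrite expr0 ord1 mulr0n.
by rewrite exprS ordM ?expf_neq0 // IH mulrS.
Qed.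

(** The disjunction absorbs the junk value [ord P 0 = 0]; with it these sets are subgroups. *)
Definition vge P (n : int) x : Prop := x = 0 \/ n <= ord P x.

Lemma vge0 P n : vge P n 0. Proof. by left. Qed.
Lemma vgeD P n x y : vge P n x -> vge P n y -> vge P n (x + y).
Proof.
move=> [->|hx]; first by rewrite add0r.
move=> [->|hy]; first by rewrite addr0; right.
have [->|xy0] := eqVneq (x + y) 0; first by left.
have [x0|x0] := eqVneq x 0; first by rewrite x0 add0r; right.
have [y0|y0] := eqVneq y 0; first by rewrite y0 addr0; right.
by right; apply: le_trans (ordD P x0 y0 xy0); rewrite le_min hx.
Qed.
Lemma vge_sub P n : is_sub (vge P n).
Proof. by split; [exact: vge0 | exact: vgeD]. Qed.
Lemma vgeM P m n x y : vge P m x -> vge P n y -> vge P (m + n) (x * y).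
Proof.
move=> [->|hx]; first by rewrite mul0r; left.
move=> [->|hy]; first by rewrite mulr0; left.
have [x0|x0] := eqVneq x 0; first by rewrite x0 mul0r; left.
have [y0|y0] := eqVneq y 0; first by rewrite y0 mulr0; left.
by right; rewrite ordM // lerD.
Qed.
Lemma vgeW P m n x : m <= n -> vge P n x -> vge P m x.
Proof. by move=> mn [->|h]; [left | right; apply: le_trans h]. Qed.
Lemma vge1 P : vge P 0 1. Proof. by right; rewrite ord1. Qed.
Lemma vgeM0 P x y : vge P 0 x -> vge P 0 y -> vge P 0 (x * y).
Proof. by move=> hx hy; rewrite -[0]addr0; apply: vgeM. Qed.
Lemma vgeX0 P x n : vge P 0 x -> vge P 0 (x ^+ n).
Proof. by move=> hx; elim: n => [|n IH]; rewrite ?expr0 ?exprS; [exact: vge1 | exact: vgeM0]. Qed.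
Lemma vge_sum P n I (r : seq I) (Pr : pred I) (E : I -> F) :
  (forall i, Pr i -> vge P n (E i)) -> vge P n (\sum_(i <- r | Pr i) E i).
Proof. by move=> h; elim/big_ind: _ => //; [exact: vge0 | exact: vgeD]. Qed.
Lemma vgeP P n x : x != 0 -> vge P n x <-> n <= ord P x.
Proof. by move=> x0; split=> [[x00|//]|h]; [rewrite x00 eqxx in x0 | right]. Qed.
Lemma vge_mulP P n x y : x != 0 -> vge P n (x * y) <-> vge P (n - ord P x) y.
Proof.
move=> x0; have [->|y0] := eqVneq y 0; first by rewrite mulr0; split=> _; left.
by rewrite !vgeP ?mulf_neq0 // ordM //; split; lia.
Qed.
Lemma vge_cancel P x y : x != 0 -> ord P x = 0 -> vge P 1 (x * y) -> vge P 1 y.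
Proof. by move=> x0 e /(vge_mulP P 1 y x0); rewrite e subr0. Qed.

Lemma inPE P : inP P = vge P 1.
Proof. by apply/prop_eq => x; split=> [] [->|h]; [left|right|left|right]; rewrite ?gtz0_ge1 // -gtz0_ge1. Qed.

(** A summand of strictly larger order does not change the order: the triangle inequality is also
    applied to $x = (x+y)+y$. *)
Lemma vge_ordD P x y : x != 0 -> vge P (ord P x + 1) y -> x + y != 0 /\ ord P (x + y) = ord P x.
Proof.
move=> x0 [->|h]; first by rewrite addr0.
have [y0|y0] := eqVneq y 0; first by rewrite y0 addr0.
have xy0 : x + y != 0.
  by apply/eqP => /eqP; rewrite addr_eq0 oppx => /eqP e; rewrite e in h; lia.
split=> //; apply/eqP; rewrite eq_le; apply/andP; split; last first.
  by apply: le_trans (ordD P x0 y0 xy0); rewrite le_min lexx; lia.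
have := @ordD P (x + y) y xy0 y0; rewrite (addKv addff) => /(_ x0).
by rewrite ge_min => /orP[//|]; lia.
Qed.

Lemma place_degP P d : place_deg P d <-> reldim (vge P 1) (vge P 0) d.
Proof.
rewrite (reldim_max addff); [|exact: vge_sub|exact: vge_sub|by move=> x; apply: vgeW].
rewrite /place_deg /indep_modP inPE; split=> -[[s [h1 h2 h3]] h4]; split.
- by exists s; split=> //; apply/free_mask.
- by move=> t t1 /free_mask; apply: h4.
- by exists s; split=> //; apply/free_mask.
- by move=> t t1 t2; apply: h4 => //; apply/free_mask.
Qed.

Definition Ls (D : place F -> int) : F -> Prop := fun x => forall P, vge P (- D P) x.

Lemma Ls_sub D : is_sub (Ls D).
Proof. by split=> [P|x y hx hy P]; [exact: vge0 | apply: vgeD]. Qed.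

Lemma inLE (D : divisor F) : inL D = Ls (dv D).
Proof.
apply/prop_eq => x; split=> [[-> P|h P]|h]; [exact: vge0 | by right |].
have [->|x0] := eqVneq x 0; first by left.
by right=> P; have := h P; rewrite vgeP.
Qed.

Lemma ldimP (D : divisor F) n : ldim D n <-> reldim (@zsub F) (Ls (dv D)) n.
Proof.
rewrite (reldim_max addff); [|exact: zsub_sub|exact: Ls_sub|by move=> x ->; case: (Ls_sub (dv D))].
rewrite /ldim /F2indep inLE; split=> -[[s [h1 h2 h3]] h4]; split.
- by exists s; split=> //; apply/free_mask => m sm hm /eqP; apply/negP/h3.
- by move=> t t1 /free_mask t2; apply: h4 => // m sm hm; apply/eqP/t2.
- by exists s; split=> // m sm hm; apply/eqP; move/free_mask: h3; apply.
- by move=> t t1 t2; apply: h4 => //; apply/free_mask => m sm hm /eqP; apply/negP/t2.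
Qed.

End Valuations.

(** * Degrees of divisors and Riemann-Roch spaces *)

Section Divisors.
Variable F : fieldType.
Hypothesis char2 : (2%:R : F) = 0.
Implicit Types (P Q : place F) (D E G : place F -> int).

Definition pt Q : place F -> int := fun P => (P == Q)%:Z.

Lemma dD D E P : (D + E) P = D P + E P. Proof. by []. Qed.
Lemma dN D P : (- D) P = - D P. Proof. by []. Qed.
Lemma d0 P : (0 : place F -> int) P = 0. Proof. by []. Qed.
Lemma dMn D n P : (D *+ n) P = D P *+ n.
Proof. by elim: n => [|n IH]; rewrite ?mulr0n // !mulrS dD IH. Qed.
Lemma ptE Q P : pt Q P = (P == Q)%:Z. Proof. by []. Qed.
Definition dE := (dD, dN, d0, dMn, ptE).

Definition finsupp D := exists s : seq (place F), forall P, D P != 0 -> P \in s.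
Definition okp P := exists d, place_deg P d.
Definition degp P : nat :=
  if pselect (okp P) is left e then projT1 (cid e) else 0%N.
(** Total, with default 0, so that divisors can be added as plain functions and finiteness of the
    support becomes a side condition. *)
Definition deg D : int :=
  if pselect (finsupp D) is left e
  then \sum_(P <- undup (projT1 (cid e))) D P * (degp P)%:Z else 0.
(** The second clause is a separate condition only until [all_ok] shows that every residue degree is
    finite. *)
Definition good D := finsupp D /\ forall P, D P != 0 -> okp P.
Definition eff D := forall P, 0 <= D P.

Lemma degpP P : okp P -> place_deg P (degp P).
Proof. by rewrite /degp; case: pselect => // e _; case: cid. Qed.

Lemma sum_supp (D f : place F -> int) (s t : seq (place F)) : uniq s -> uniq t ->
  (forall P, D P != 0 -> P \in s) -> (forall P, D P != 0 -> P \in t) ->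
  \sum_(P <- s) D P * f P = \sum_(P <- t) D P * f P.
Proof.
move=> us ut hs ht.
have h r : \sum_(P <- r) D P * f P = \sum_(P <- r | D P != 0) D P * f P.
  rewrite [LHS](bigID (fun P => D P != 0)) /= [X in _ + X]big1 ?addr0 // => P.
  by rewrite negbK => /eqP ->; rewrite mul0r.
rewrite h [RHS]h -big_filter -[RHS]big_filter; apply: perm_big.
apply: uniq_perm; rewrite ?filter_uniq // => P; rewrite !mem_filter.
by case e : (D P != 0) => //=; rewrite hs ?ht.
Qed.

Lemma deg_sum D s : uniq s -> (forall P, D P != 0 -> P \in s) ->
  deg D = \sum_(P <- s) D P * (degp P)%:Z.
Proof.
move=> us hs; rewrite /deg; case: pselect => [e|[]]; last by exists s.
case: cid => t /= ht; apply: sum_supp => //; first exact: undup_uniq.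
by move=> P /ht; rewrite mem_undup.
Qed.

Lemma finsuppP D : finsupp D -> exists s, uniq s /\ forall P, D P != 0 -> P \in s.
Proof.
move=> [s hs]; exists (undup s); rewrite undup_uniq; split=> // P.
by rewrite mem_undup; apply: hs.
Qed.

Lemma finsupp2 D E : finsupp D -> finsupp E ->
  exists s, [/\ uniq s, forall P, D P != 0 -> P \in s & forall P, E P != 0 -> P \in s].
Proof.
move=> [s hs] [t ht]; exists (undup (s ++ t)).
by split; rewrite ?undup_uniq // => P h; rewrite mem_undup mem_cat ?(hs P h) ?(ht P h) ?orbT.
Qed.

Lemma finsuppD D E : finsupp D -> finsupp E -> finsupp (D + E).
Proof.
move=> hD hE; have [s [_ h1 h2]] := finsupp2 hD hE; exists s => P; rewrite dD.
by have [/eqP|] := boolP (D P == 0); [move=> ->; rewrite add0r; apply: h2 | move=> + _; apply: h1].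
Qed.
Lemma finsuppN D : finsupp D -> finsupp (- D).
Proof. by move=> [s h]; exists s => P; rewrite dN oppr_eq0; apply: h. Qed.
Lemma finsupp0 : finsupp 0. Proof. by exists [::]. Qed.
Lemma finsupp_pt Q : finsupp (pt Q).
Proof. by exists [:: Q] => P; rewrite ptE inE; case: (P == Q). Qed.
Lemma finsuppMn D n : finsupp D -> finsupp (D *+ n).
Proof. by move=> h; elim: n => [|n IH]; rewrite ?mulr0n ?mulrS; [exact: finsupp0 | exact: finsuppD]. Qed.
Lemma finsupp_le D E : finsupp E -> (forall P, D P != 0 -> E P != 0) -> finsupp D.
Proof. by move=> [s h] DE; exists s => P /DE; apply: h. Qed.

Lemma degD D E : finsupp D -> finsupp E -> deg (D + E) = deg D + deg E.
Proof.
move=> hD hE; have [s [us h1 h2]] := finsupp2 hD hE.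
rewrite !(@deg_sum _ s) // -?big_split /=.
  by apply: eq_bigr => P _; rewrite dD mulrDl.
by move=> P; have [/eqP|] := boolP (D P == 0); rewrite dD;
  [move=> ->; rewrite add0r; apply: h2 | move=> + _; apply: h1].
Qed.
Lemma degN D : finsupp D -> deg (- D) = - deg D.
Proof.
move=> hD; have [s [us h]] := finsuppP hD; rewrite !(@deg_sum _ s) //.
  by rewrite -sumrN; apply: eq_bigr => P _; rewrite dN mulNr.
by move=> P; rewrite dN oppr_eq0; apply: h.
Qed.
Lemma degB D E : finsupp D -> finsupp E -> deg (D - E) = deg D - deg E.
Proof. by move=> hD hE; rewrite degD ?degN //; apply: finsuppN. Qed.
Lemma deg0 : deg 0 = 0.
Proof. by rewrite (@deg_sum 0 [::]) ?big_nil. Qed.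
Lemma deg_pt Q : deg (pt Q) = (degp Q)%:Z.
Proof.
rewrite (@deg_sum _ [:: Q]) //; first by rewrite big_seq1 ptE eqxx mul1r.
by move=> P; rewrite ptE inE; case: (P == Q).
Qed.
Lemma degMn D n : finsupp D -> deg (D *+ n) = deg D *+ n.
Proof.
move=> h; elim: n => [|n IH]; first by rewrite !mulr0n deg0.
by rewrite !mulrS degD ?IH //; apply: finsuppMn.
Qed.

Lemma goodD D E : good D -> good E -> good (D + E).
Proof.
move=> [h1 h2] [h3 h4]; split; first exact: finsuppD.
move=> P; rewrite dD; have [/eqP ->|] := boolP (D P == 0); first by rewrite add0r; apply: h4.
by move=> h _; apply: h2.
Qed.
Lemma goodN D : good D -> good (- D).
Proof. by move=> [h1 h2]; split=> [|P]; [exact: finsuppN | rewrite dN oppr_eq0; apply: h2]. Qed.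
Lemma good0 : good 0. Proof. by split=> //; exact: finsupp0. Qed.
Lemma good_pt Q : okp Q -> good (pt Q).
Proof. by move=> h; split=> [|P]; [exact: finsupp_pt | rewrite ptE; case: (P =P Q) => [->|_ /eqP]]. Qed.
Lemma goodMn D n : good D -> good (D *+ n).
Proof. by move=> h; elim: n => [|n IH]; rewrite ?mulr0n ?mulrS; [exact: good0 | exact: goodD]. Qed.

Lemma eff_ind (K : (place F -> int) -> Prop) :
  K 0 -> (forall G Q, finsupp G -> eff G -> K G -> K (G + pt Q)) ->
  forall G, finsupp G -> eff G -> K G.
Proof.
move=> K0 KS G [s hs]; elim: s G hs => [|Q s IH] G hs eG.
  by have -> : G = 0 by apply/funext => P; apply/eqP; apply: contraT => /hs.
pose G' : place F -> int := fun P => if P == Q then 0 else G P.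
have eG' : eff G' by move=> P; rewrite /G'; case: (P =P Q).
have h' P : G' P != 0 -> P \in s.
  rewrite /G'; case: (eqVneq P Q) => [_ /eqP//|PQ /hs]; by rewrite inE (negPf PQ).
have fG' : finsupp G' by exists s.
have -> : G = G' + pt Q *+ `|G Q|%N.
  apply/funext => P; rewrite !dE /G'; case: (P =P Q) => [->|_]; last by rewrite mul0rn addr0.
  by have := eG Q; rewrite add0r; lia.
elim: `|G Q|%N => [|n IHn]; first by rewrite mulr0n addr0; apply: IH.
rewrite mulrS addrCA addrC; apply: KS => //; first exact/finsuppD/finsuppMn/finsupp_pt.
by move=> P; rewrite !dE; have := eG' P; case: (P == Q); lia.
Qed.

Lemma degp_uniq P d : place_deg P d -> d = degp P.
Proof.
move=> hd; have oP : okp P by exists d.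
move/(place_degP char2): hd => h1; have /(place_degP char2) h2 := degpP oP.
exact: (reldim_uniq (addff char2) (vge_sub P 1) h1 h2).
Qed.

Lemma div_degP (D : divisor F) n :
  div_deg D n <-> good (dv D) /\ deg (dv D) = n.
Proof.
split=> [[s [ds [/NoDupP us hs hd ->]]]|[[[s0 hs0] hok] <-]].
  have hs' P : dv D P != 0 -> P \in s by move=> /eqP/hs/InP.
  have [h1 h2] : (forall P, P \in s -> okp P) /\
      foldr (fun pd acc => dv D pd.1 * (pd.2)%:Z + acc) 0 (zip s ds) =
      \sum_(P <- s) dv D P * (degp P)%:Z.
    elim: hd {us hs hs'} => [|P d {}s {}ds hd _ [IH1 IH2]]; first by rewrite big_nil.
    split=> [Q|]; first by rewrite inE => /orP[/eqP ->|/IH1 //]; exists d.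
    by rewrite big_cons /= IH2 (degp_uniq hd).
  by rewrite (deg_sum us hs') h2; split=> //; split=> [|P /hs' /h1 //]; exists s.
pose s := undup [seq P <- s0 | dv D P != 0].
have us : uniq s by apply: undup_uniq.
have hs P : dv D P != 0 -> P \in s by move=> h; rewrite mem_undup mem_filter h hs0.
have sok P : P \in s -> okp P by rewrite mem_undup mem_filter => /andP[/hok].
exists s, (map degp s); split; [exact/NoDupP | by move=> P /eqP/hs/InP | |].
  elim: s sok {us hs} => [|P s IH] sok /=; constructor.
    by apply/degpP/sok; rewrite inE eqxx.
  by apply: IH => Q Qs; apply: sok; rewrite inE Qs orbT.
by rewrite (deg_sum us hs); elim: s {us hs sok} => [|P s IH]; rewrite ?big_nil // big_cons /= IH.
Qed.

Lemma ord_surj P (k : int) : exists2 t, t != 0 & ord P t = k.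
Proof.
have [t t0 ht] := ord_unif P.
case: k => n; first by exists (t ^+ n); rewrite ?expf_neq0 // ordX ht; lia.
by exists (t ^+ n.+1)^-1; rewrite ?invr_eq0 ?expf_neq0 // ordV // ordX ht; lia.
Qed.

Lemma Ls_mono D E : (forall P, D P <= E P) -> forall x, Ls D x -> Ls E x.
Proof. by move=> DE x h P; apply: vgeW (h P); rewrite lerN2. Qed.

Lemma Ls_mul D E x y : Ls D x -> Ls E y -> Ls (D + E) (x * y).
Proof. by move=> hx hy P; rewrite dD opprD; apply: vgeM. Qed.

Lemma Ls_pt D Q x : Ls (D + pt Q) x -> Ls D x <-> vge Q (- D Q) x.
Proof.
move=> h; split=> [//|hQ P]; have [->//|PQ] := eqVneq P Q.
by have := h P; rewrite !dE (negPf PQ) addr0.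
Qed.

(** Multiplication by a function of order [D Q + 1] at [Q] embeds $L(D+Q)/L(D)$ into the residue
    field of [Q]. *)
Lemma Ls_step D Q : okp Q -> exists2 e, (e <= degp Q)%N & reldim (Ls D) (Ls (D + pt Q)) e.
Proof.
move=> /degpP/(place_degP char2) hd.
have [t t0 ht] := ord_surj Q (D Q + 1).
apply: (reldim_inj (addff char2) (addff char2) (f := *%R t) _ _ _ _ _ _ _ hd).
- by move=> x y; rewrite mulrDr.
- exact: Ls_sub.
- exact: Ls_sub.
- by apply: Ls_mono => P; rewrite !dE; case: (P == Q); lia.
- exact: vge_sub.
- move=> x /(_ Q); rewrite vge_mulP // ht !dE eqxx => h; apply: vgeW h; lia.
- move=> x h; rewrite (Ls_pt h) vge_mulP // ht; rewrite (_ : 1 - _ = - D Q) //; lia.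
Qed.

Lemma Ls_ext D E : good (E - D) -> (forall P, D P <= E P) ->
  exists2 e, (e%:Z <= deg (E - D)) & reldim (Ls D) (Ls E) e.
Proof.
move=> gED DE; suff H G : finsupp G -> eff G -> good G ->
    exists2 e, (e%:Z <= deg G) & reldim (Ls D) (Ls (D + G)) e.
  have [|] := H (E - D) gED.1 _ gED; first by move=> P; rewrite !dE subr_ge0.
  by move=> e he; rewrite addrC subrK; exists e.
move: G; apply: eff_ind.
  by move=> _; exists 0%N; rewrite ?deg0 // addr0; apply: reldim_refl.
move=> G Q fG eG IH [fGQ okGQ].
have okQ : okp Q.
  by apply: okGQ; rewrite !dE eqxx; have := eG Q; lia.
have [|e he h1] := IH.
  split=> // P GP; apply: okGQ; rewrite !dE; have := eG P; move: GP; case: (P == Q); lia.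
have [e' he' h2] := Ls_step (D + G) okQ.
exists (e + e')%N; last by rewrite addrA; apply: reldim_trans h1 h2.
by rewrite degD ?deg_pt //; [lia | exact: finsupp_pt].
Qed.
End Divisors.

(** * Riemann's inequality *)

Section ConstPoly.
Variable F : fieldType.
Hypothesis char2 : (2%:R : F) = 0.

Lemma F2c_dim : reldim (@zsub F) (@F2c F) 1.
Proof.
exists [:: 1]; split=> //=; first by split=> // /eqP; rewrite oner_eq0.
apply/prop_eq => x; rewrite /F2c /= /zsub; split=> -[e|e]; [by left|right|by left|right].
  by rewrite e addff.
by rewrite -(addKv (addff char2) x 1) e add0r.
Qed.

Lemma F2c_sub : is_sub (@F2c F).
Proof. exact (reldim_is_sub (addff char2) (zsub_sub F) F2c_dim). Qed.

Lemma F2cM (x y : F) : F2c x -> F2c y -> F2c (x * y).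
Proof. by move=> [->|->] h; rewrite ?mul0r ?mul1r //; left. Qed.

Lemma F2polyM (p q : {poly F}) : F2poly p -> F2poly q -> F2poly (p * q).
Proof.
move=> hp hq i; rewrite coefM; elim/big_ind: _ => [|x y|j _]; first by left.
  by case: F2c_sub => _; apply.
exact: F2cM.
Qed.

Lemma F2poly1 : @F2poly F 1.
Proof. by move=> i; rewrite coef1; case: (i == 0)%N; [right | left]. Qed.

Definition polyF2 N (p : {poly F}) : Prop := (size p <= N)%N /\ forall i, (i < N)%N -> F2c p`_i.

Lemma polyF2P N p : polyF2 N p -> F2poly p.
Proof.
move=> [h1 h2] i; have [iN|Ni] := ltnP i N; first exact: h2.
by rewrite nth_default ?(leq_trans h1) //; left.
Qed.

Lemma polyF2_dim N : reldim (@zsub {poly F}) (polyF2 N) N.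
Proof.
have := @reldim_poly F (addff char2) (fun _ => @F2c F) (fun _ => 1%N) N (fun _ => F2c_dim).
by rewrite sum1_card card_ord.
Qed.

Lemma polyF2_mono N M p : (N <= M)%N -> polyF2 N p -> polyF2 M p.
Proof. by move=> NM h; split=> [|i _]; [case: h => h _; apply: leq_trans h NM | apply: polyF2P h i]. Qed.

Lemma polyF2M N M p q : polyF2 N p -> polyF2 M q -> polyF2 (N + M) (p * q).
Proof.
move=> hp hq; split=> [|i _]; last by apply: F2polyM; [apply: polyF2P hp | apply: polyF2P hq].
case: hp hq => h1 _ [h2 _]; apply: leq_trans (size_polyMleq _ _) _.
by apply: leq_trans (leq_pred _) _; apply: leq_add.
Qed.

Lemma F2c_horner (p : {poly F}) (U : F -> Prop) x : is_sub U -> F2poly p ->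
  (forall i, U (x ^+ i)) -> U p.[x].
Proof.
move=> [U0 UD] hp hx; rewrite horner_coef; elim/big_ind: _ => // i _.
by case: (hp i) => ->; rewrite ?mul0r ?mul1r.
Qed.

(** In a space of dimension [n] the first $n+1$ powers of [x] are dependent, so [x] is algebraic
    over the constants. *)
Lemma powers_algebraic (W : F -> Prop) n x : full_constant_field_F2 F ->
  reldim (@zsub F) W n -> (forall i, W (x ^+ i)) -> F2c x.
Proof.
move=> fcf hW hx; have sW := reldim_is_sub (addff char2) (zsub_sub F) hW.
have fD : {morph (fun p : {poly F} => p.[x]) : p q / p + q} by move=> p q; rewrite hornerD.
have fW p : polyF2 n.+1 p -> W p.[x] by move=> /polyF2P hp; apply: F2c_horner.
have [p [hp p0 e]] := reldim_kernel (addpp (addff char2)) (addff char2) fD fW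
  (polyF2_dim n.+1) hW (ltnSn n).
by apply: fcf; exists p; split; [exact: polyF2P hp | exact/eqP | exact/eqP].
Qed.
End ConstPoly.

Section Riemann.
Variable F : fieldType.
Hypothesis char2 : (2%:R : F) = 0.
Hypothesis fcf : full_constant_field_F2 F.
Variable g : nat.
Hypothesis hg : is_genus F g.
Variable P0 : place F.
Hypothesis hP0 : place_deg P0 1.
Implicit Types (P Q : place F) (D E G : place F -> int).

Lemma genus_div : exists A l, [/\ good A, reldim (@zsub F) (Ls A) l & deg A - l%:Z + 1 = g%:Z].
Proof.
case: hg => _ [A [d [l [/(div_degP char2)[gA <-] /(ldimP char2) h e]]]].
by exists (dv A), l.
Qed.

Lemma good_le D E : good E -> (forall P, D P != 0 -> E P != 0) -> good D.
Proof. by move=> [h1 h2] DE; split=> [|P /DE]; [exact: finsupp_le h1 DE | exact: h2]. Qed.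

(** The divisor [A] that attains the genus has a dimension by definition. [L(D)] lies in [L(E)] for
    some [E] above both [A] and [D], and [L(E)] exceeds [L(A)] by at most a degree. *)
Lemma Ls_fin D : good D -> exists n, reldim (@zsub F) (Ls D) n.
Proof.
move=> gD; have [A [l [gA hl _]]] := genus_div.
pose E : place F -> int := (fun P => `|A P|) + (fun P => `|D P|).
have gE : good E.
  by apply: goodD; [apply: good_le gA _ | apply: good_le gD _] => P; rewrite normr_eq0.
have AE P : A P <= E P by rewrite /E dD; lia.
have [e _ he] := Ls_ext char2 (goodD gE (goodN gA)) AE.
have [||a [b [ha _ _]]] := reldim_mid (addff char2) (zsub_sub F) (Ls_sub D)
    (reldim_trans hl he).
- by move=> x ->; case: (Ls_sub D).
- by apply: Ls_mono => P; rewrite /E dD; lia.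
by exists a.
Qed.

Definition ell D : nat :=
  if pselect (exists n, reldim (@zsub F) (Ls D) n) is left e then projT1 (cid e) else 0%N.

Lemma ellP D : good D -> reldim (@zsub F) (Ls D) (ell D).
Proof. by move=> /Ls_fin h; rewrite /ell; case: pselect => // e; case: cid. Qed.

Lemma ell_uniq D n : reldim (@zsub F) (Ls D) n -> ell D = n.
Proof.
move=> h; rewrite /ell; case: pselect => [e|[]]; last by exists n.
by case: cid => m /= hm; apply: (reldim_uniq (addff char2) (zsub_sub F) hm h).
Qed.

Lemma ell_rel D E n : good D -> reldim (Ls D) (Ls E) n -> ell E = (ell D + n)%N.
Proof. by move=> gD h; apply/ell_uniq/reldim_trans/h/ellP. Qed.

Lemma ell_ext D E : good D -> good E -> (forall P, D P <= E P) ->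
  exists e, [/\ reldim (Ls D) (Ls E) e, ell E = (ell D + e)%N & e%:Z <= deg E - deg D].
Proof.
move=> gD gE DE; have [e he h] := Ls_ext char2 (goodD gE (goodN gD)) DE.
exists e; split=> //; first exact: ell_rel h.
by rewrite -degB //; [case: gE | case: gD].
Qed.

Lemma riemann_ge D : good D -> deg D + 1 - g%:Z <= (ell D)%:Z.
Proof.
move=> gD; have sD P : D P <> 0 -> List.In P (projT1 (cid gD.1)).
  by case: cid => s /= hs /eqP/hs/InP.
pose D' : divisor F := exist _ D (ex_intro _ _ sD).
have h1 : div_deg D' (deg D) by apply/(div_degP char2).
have h2 : ldim D' (ell D) by apply/(ldimP char2)/ellP.
by case: hg => /(_ _ _ _ h1 h2) + _; lia.
Qed.

Lemma Ls0_const (x : F) : Ls 0 x -> F2c x.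
Proof.
move=> h; have [n hn] := Ls_fin (good0 F).
apply: (powers_algebraic char2 fcf hn) => i P; rewrite d0 oppr0; apply: vgeX0.
by have := h P; rewrite d0 oppr0.
Qed.

Lemma Ls0E : @Ls F 0 = @F2c F.
Proof.
apply/prop_eq => x; split; first exact: Ls0_const.
by move=> [->|->] P; rewrite d0 oppr0; [exact: vge0 | exact: vge1].
Qed.

Lemma ell0 : ell 0 = 1%N.
Proof. by apply: ell_uniq; rewrite Ls0E; apply: F2c_dim. Qed.

Lemma degP0 : degp P0 = 1%N. Proof. by rewrite -(degp_uniq char2 hP0). Qed.

End Riemann.

(** * Algebraic dependence of two functions *)

Section AlgebraicDependence.
Variable F : fieldType.
Hypothesis char2 : (2%:R : F) = 0.
Hypothesis hff : exists x : F, transcendental_F2 x /\ finite_over_F2x x.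

Lemma addff2 (p : {poly {poly F}}) : p + p = 0.
Proof. exact (addpp (addpp (addff char2)) p). Qed.

(** Combinations of [s] with coefficients in $\mathbb F_2[x_0]$ of degree below [a]:
    finite-dimensional stages of the module generated by [s]. *)
Definition lattice (x0 : F) (s : seq F) (a : nat) : F -> Prop := fun y =>
  exists2 c : {poly {poly F}}, (size c <= size s)%N /\ (forall i, (i < size s)%N -> polyF2 a c`_i)
  & y = \sum_(k < size s) (c`_k).[x0] * s`_k.

Section Lattice.
Variables (x0 : F) (s : seq F).
Let V := lattice x0 s.

Lemma lattice_dim a : exists2 n, (n <= size s * a)%N & reldim (@zsub F) (V a) n.
Proof.
have := @reldim_poly {poly F} (addpp (addff char2)) (fun _ => polyF2 a) (fun _ => a) (size s)
  (fun _ => polyF2_dim char2 a).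
rewrite sum_nat_const card_ord => h.
have fD : {morph (fun c : {poly {poly F}} => \sum_(k < size s) (c`_k).[x0] * s`_k) : p q / p + q}.
  by move=> p q; rewrite -big_split; apply: eq_bigr => i _; rewrite coefD hornerD mulrDl.
exact (reldim_image addff2 (addff char2) fD h).
Qed.

Lemma lattice_sub a : is_sub (V a).
Proof. by have [n _ h] := lattice_dim a; exact (reldim_is_sub (addff char2) (zsub_sub F) h). Qed.

Lemma lattice_mono a b y : (a <= b)%N -> V a y -> V b y.
Proof.
move=> ab [c [c1 c2] ->]; exists c => //; split=> // i ic.
by apply: (polyF2_mono ab (c2 i ic)).
Qed.

Lemma lattice_poly e a p y : polyF2 e p -> V a y -> V (e + a) (p.[x0] * y).
Proof.
move=> hp [c [c1 c2] ->]; exists (\poly_(i < size s) (p * c`_i)).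
  split; first exact: size_poly.
  by move=> i ir; rewrite coef_poly ir; apply: (polyF2M char2) => //; apply: c2.
by rewrite mulr_sumr; apply: eq_bigr => i _; rewrite coef_poly ltn_ord hornerM mulrA.
Qed.

Lemma polyF2_size (p : {poly F}) : F2poly p -> polyF2 (size p) p.
Proof. by move=> h; split. Qed.

Hypothesis spans : forall y : F, exists c : seq F,
    [/\ size c = size s, forall i : nat, in_F2x x0 c`_i
      & y = \sum_(i < size s) c`_i * s`_i].

Let den y := exists d a, [/\ F2poly d, d.[x0] != 0 & V a (d.[x0] * y)].

Lemma lattice_den1 y : den y.
Proof.
have den0 : den 0.
  exists 1, 0%N; rewrite hornerC oner_neq0 mulr0; split=> //; first exact: F2poly1.
  by case: (lattice_sub 0).
have denD y1 y2 : den y1 -> den y2 -> den (y1 + y2).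
  move=> [d1 [a1 [f1 n1 v1]]] [d2 [a2 [f2 n2 v2]]].
  exists (d1 * d2), (size d2 + a1 + (size d1 + a2))%N.
  rewrite hornerM mulf_neq0 //; split=> //; first exact: F2polyM.
  rewrite mulrDr; case: (lattice_sub (size d2 + a1 + (size d1 + a2))) => _; apply.
    have -> : d1.[x0] * d2.[x0] * y1 = d2.[x0] * (d1.[x0] * y1) by ring.
    apply: (@lattice_mono (size d2 + a1)); first exact: leq_addr.
    exact: (lattice_poly (polyF2_size f2)).
  apply: (@lattice_mono (size d1 + a2)); first exact: leq_addl.
  by rewrite -mulrA; apply: (lattice_poly (polyF2_size f1)).
have [c [_ hc ->]] := spans y; elim/big_ind: _ => // i _.
have [p [q [hp hq q0 ->]]] := hc i; exists q, (size p); split=> //.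
rewrite mulrA mulrCA mulfV // mulr1.
exists (p *: 'X^i).
  split; first by apply: leq_trans (size_scale_leq _ _) _; rewrite size_polyXn.
  move=> j _; rewrite coefZ coefXn; case: eqP => _; rewrite ?mulr1 ?mulr0.
    exact: polyF2_size.
  by split=> [|k _]; rewrite ?size_poly0 // coef0; left.
rewrite (bigD1 i) //= coefZ coefXn eqxx mulr1 big1 ?addr0 // => j ji.
by rewrite coefZ coefXn (_ : (j == i :> nat) = false) ?mulr0 ?hornerC ?mul0r //; apply: negPf ji.
Qed.

Lemma lattice_den (ys : seq F) : exists d a, [/\ F2poly d, d.[x0] != 0 &
  forall y, y \in ys -> V a (d.[x0] * y)].
Proof.
elim: ys => [|y ys [d [a [hd d0 IH]]]].
  by exists 1, 0%N; rewrite hornerC oner_neq0; split=> //; exact: F2poly1.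
have [d' [a' [hd' d0' h]]] := lattice_den1 y.
exists (d' * d), (size d' + a + (size d + a'))%N; rewrite hornerM mulf_neq0 //.
split=> //; first exact: F2polyM.
move=> z; rewrite inE => /orP[/eqP->|/IH hz].
  apply: (@lattice_mono (size d + a')); first exact: leq_addl.
  have -> : d'.[x0] * d.[x0] * y = d.[x0] * (d'.[x0] * y) by ring.
  exact: (lattice_poly (polyF2_size hd)).
apply: (@lattice_mono (size d' + a)); first exact: leq_addr.
by rewrite -mulrA; apply: (lattice_poly (polyF2_size hd')).
Qed.

Lemma lattice_mul d C y : (forall k, (k < size s)%N -> V C (d * (y * s`_k))) ->
  forall a u, V a u -> V (C + a) (d * y * u).
Proof.
move=> h a u [c [c1 c2] ->]; rewrite mulr_sumr.
elim/big_ind: _ => [|u1 u2|k _]; first by case: (lattice_sub (C + a)).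
  by case: (lattice_sub (C + a)) => _; apply.
rewrite mulrCA -mulrA addnC; apply: lattice_poly; first exact: c2.
exact: h.
Qed.
End Lattice.

(** The transcendence degree is one, by counting: after multiplication by a common denominator, the
    $N^2$ products $x^i w^j$ lie in a lattice whose dimension grows only linearly in [N]. *)
Lemma alg_dep (x w : F) : transcendental_F2 x -> exists q : {poly F},
  [/\ q != 0, forall i, exists2 p : {poly F}, F2poly p & q`_i = p.[x] & q.[w] = 0].
Proof.
case: hff => x0 [_ [s spans]] trx; pose V := lattice x0 s.
have [d [a [hd d0 hda]]] := lattice_den spans
  (1 :: [seq x * u | u <- s] ++ [seq w * u | u <- s]).
pose C := (size d + a)%N; pose dl := d.[x0].
have V1 : V C (dl * 1).
  by apply: (@lattice_mono _ _ a); [exact: leq_addl | apply: hda; rewrite inE eqxx].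
have Vd b u : V b u -> V (C + b)%N (dl * u).
  move=> h; apply: (@lattice_mono _ _ (size d + b)); first by rewrite leq_add2r leq_addr.
  by apply: lattice_poly => //; apply: polyF2_size.
have Vx b u : V b u -> V (C + b)%N (dl * x * u).
  apply: lattice_mul => k ks; apply: (@lattice_mono _ _ a); first exact: leq_addl.
  by apply: hda; rewrite inE mem_cat (map_f (fun u => x * u)) ?orbT // mem_nth.
have Vw b u : V b u -> V (C + b)%N (dl * w * u).
  apply: lattice_mul => k ks; apply: (@lattice_mono _ _ a); first exact: leq_addl.
  by apply: hda; rewrite inE mem_cat (map_f (fun u => w * u)) ?orbT // mem_nth.
have Vij i j : V (C * (i + j + 1))%N (dl ^+ (i + j + 1) * (x ^+ i * w ^+ j)).
  elim: i => [|i IH].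
    rewrite add0n expr0 mul1r; elim: j => [|j IH]; first by rewrite expr0 expr1 muln1.
    rewrite addSn mulnS exprS exprS (_ : _ * _ = dl * w * (dl ^+ (j + 1) * w ^+ j)); first exact: Vw.
    by rewrite -!mulrA; congr (_ * _); rewrite mulrCA.
  rewrite !addSn mulnS exprS exprS (_ : _ * _ = dl * x * (dl ^+ (i + j + 1) * (x ^+ i * w ^+ j))).
    exact: Vx.
  by rewrite -!mulrA; congr (_ * _); rewrite mulrCA.
(* Chosen so that $N^2 > rC(2N+1)$, the right side being a bound for the dimension of the lattice
   that contains all $dl^M x^i w^j$. *)
pose r := size s; pose N := (2 * r * C + 2)%N; pose M := (2 * N + 1)%N.
have VM i j : (i < N)%N -> (j < N)%N -> V (C * M)%N (dl ^+ M * (x ^+ i * w ^+ j)).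
  move=> iN jN; have [k ->] : exists k, M = (k + (i + j + 1))%N.
    by exists (M - (i + j + 1))%N; rewrite subnK // /M; lia.
  elim: k => [|k IH]; first by rewrite add0n.
  by rewrite addSn mulnS exprS -mulrA; apply: Vd.
have [n hn hV] := lattice_dim x0 s (C * M).
have sV := lattice_sub x0 s (C * M).
have hS := @reldim_poly {poly F} (addpp (addff char2)) (fun _ => polyF2 N) (fun _ => N) N
  (fun _ => polyF2_dim char2 N).
pose f (p : {poly {poly F}}) := dl ^+ M * \sum_(j < N) (p`_j).[x] * w ^+ j.
have fD : {morph f : p q / p + q}.
  move=> p q; rewrite /f -mulrDr -big_split; congr (_ * _).
  by apply: eq_bigr => i _; rewrite coefD hornerD mulrDl.
have fW (p : {poly {poly F}}) : (size p <= N)%N /\ (forall i, (i < N)%N -> polyF2 N p`_i) ->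
    V (C * M)%N (f p).
  move=> [_ hp]; rewrite /f mulr_sumr; elim/big_ind: _ => [|u v|j _]; first by case: sV.
    by case: sV => _; apply.
  have [sp cp] := hp j (ltn_ord j); rewrite (horner_coef_wide _ sp) mulr_suml mulr_sumr.
  elim/big_ind: _ => [|u v|i _]; first by case: sV.
    by case: sV => _; apply.
  by case: (cp i (ltn_ord i)) => ->; rewrite ?mul0r ?mulr0 ?mul1r; [case: sV | apply: VM].
rewrite sum_nat_const card_ord in hS.
have [|p [[sp hp] p0 e]] := reldim_kernel addff2 (addff char2) fD fW hS hV.
  apply: leq_ltn_trans hn _; rewrite -/r /M /N; nia.
exists (\poly_(j < N) (p`_j).[x]); split.
(* Transcendence of [x] keeps a nonzero coefficient nonzero after evaluation at [x]. *)
- apply/eqP => /polyP q0; apply: p0; apply/polyP => j; rewrite coef0.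
  have [jN|Nj] := ltnP j N; last by rewrite nth_default // (leq_trans sp).
  apply/eqP; apply: contraT => pj0; have := q0 j; rewrite coef_poly jN coef0 => /eqP.
  by rewrite (negPf (trx _ (polyF2P (hp j jN)) pj0)).
- move=> j; rewrite coef_poly; case: ltnP => jN; first by exists p`_j => //; apply: polyF2P (hp j jN).
  by exists 0; [move=> i; rewrite coef0; left | rewrite hornerC].
have /eqP := e; rewrite /f mulf_eq0 expf_eq0 (negPf d0) andbF /= => /eqP e'.
by rewrite horner_poly.
Qed.

End AlgebraicDependence.

(** * Degrees of places and of principal divisors *)

Definition pointed_curve (F : fieldType) (g : nat) (P0 : place F) : Prop :=
  [/\ (2%:R : F) = 0, exists x : F, transcendental_F2 x /\ finite_over_F2x x,
      full_constant_field_F2 F, is_genus F g & place_deg P0 1].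

Section Structure.
Variables (F : fieldType) (g : nat) (P0 : place F).
Hypothesis hcurve : pointed_curve g P0.
Let char2 : (2%:R : F) = 0. Proof. by case: hcurve. Qed.
Let hff : exists x : F, transcendental_F2 x /\ finite_over_F2x x. Proof. by case: hcurve. Qed.
Let fcf : full_constant_field_F2 F. Proof. by case: hcurve. Qed.
Let hg : is_genus F g. Proof. by case: hcurve. Qed.
Let hP0 : place_deg P0 1. Proof. by case: hcurve. Qed.
Implicit Types (P Q : place F) (D E G : place F -> int).

Lemma mulrn_int (a : int) n : a *+ n = n%:Z * a.
Proof. by rewrite -mulr_natl natz. Qed.
Lemma ptMnE Q n P : (pt Q *+ n) P = if P == Q then n%:Z else 0.
Proof. by rewrite !dE mulrn_int; case: (P == Q); rewrite ?mulr0 ?mulr1. Qed.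
Lemma ordXz P x n : ord P (x ^+ n) = n%:Z * ord P x.
Proof. by rewrite ordX mulrn_int. Qed.

(** The coordinate ring of the affine curve left when [P0] is removed. *)
Definition reg (z : F) : Prop := forall Q, Q != P0 -> vge Q 0 z.

Lemma regD x y : reg x -> reg y -> reg (x + y).
Proof. by move=> hx hy Q QP; apply: vgeD; [apply: hx | apply: hy]. Qed.
Lemma regM x y : reg x -> reg y -> reg (x * y).
Proof. by move=> hx hy Q QP; apply: vgeM0; [apply: hx | apply: hy]. Qed.
Lemma regX x n : reg x -> reg (x ^+ n).
Proof. by move=> hx Q QP; apply: vgeX0; apply: hx. Qed.
Lemma reg_horner (p : {poly F}) x : F2poly p -> reg x -> reg p.[x].
Proof.
move=> hp hx Q QP; apply: F2c_horner => //; first exact: vge_sub.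
by move=> i; apply: vgeX0; apply: hx.
Qed.
Lemma reg_Ls n z : Ls (pt P0 *+ n) z -> reg z.
Proof. by move=> h Q QP; have := h Q; rewrite ptMnE (negPf QP) oppr0. Qed.
Lemma LsP0 n z : Ls (pt P0 *+ n) z <-> reg z /\ vge P0 (- n%:Z) z.
Proof.
split=> [h|[h1 h2] Q].
  by split; [exact: reg_Ls h | have := h P0; rewrite ptMnE eqxx].
have [->|QP] := eqVneq Q P0; first by rewrite ptMnE eqxx.
by rewrite ptMnE (negPf QP) oppr0; apply: h1.
Qed.
Lemma LsP0_mono n m z : (n <= m)%N -> Ls (pt P0 *+ n) z -> Ls (pt P0 *+ m) z.
Proof.
by move=> nm /LsP0[h1 h2]; apply/LsP0; split=> //; apply: vgeW h2; lia.
Qed.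
Lemma LsP0_mul n m x y : Ls (pt P0 *+ n) x -> Ls (pt P0 *+ m) y -> Ls (pt P0 *+ (n + m)) (x * y).
Proof. by move=> hx hy; rewrite mulrnDr; apply: Ls_mul. Qed.
Lemma reg_pole z : reg z -> exists n, Ls (pt P0 *+ n) z.
Proof.
move=> h; exists `|ord P0 z|%N; apply/LsP0; split=> //; right; lia.
Qed.
Lemma good_P0 n : good (pt P0 *+ n).
Proof. by apply/goodMn/good_pt; exists 1%N. Qed.
Lemma deg_P0 n : deg (pt P0 *+ n) = n%:Z.
Proof.
rewrite degMn ?deg_pt ?(degP0 char2 hP0) ?mulrn_int ?mulr1 //.
exact: finsupp_pt.
Qed.
Lemma ell_P0_le n : (ell (pt P0 *+ n) <= n.+1)%N.
Proof.
have [|e [_ -> he]] := ell_ext char2 hg (good0 F) (good_P0 n).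
  by move=> P; rewrite ptMnE; case: (P == P0).
by rewrite (ell0 char2 fcf hg) deg_P0 deg0 in he *; lia.
Qed.
Lemma ell_P0_ge n : (n + 1 <= ell (pt P0 *+ n) + g)%N.
Proof. by have := riemann_ge char2 hg (good_P0 n); rewrite deg_P0; lia. Qed.

Lemma transcendentalP (x : F) : ~ F2c x -> transcendental_F2 x.
Proof.
move=> hx p hp p0; apply/eqP => e; apply: hx; apply: fcf.
by exists p; split=> //; apply/eqP.
Qed.

Lemma exists_x : exists x : F, reg x /\ transcendental_F2 x.
Proof.
have hd := ellP char2 hg (good_P0 g.+1); have hl := ell_P0_ge g.+1.
apply: contrapT => nx.
suff h x : Ls (pt P0 *+ g.+1) x -> F2c x.
  by have := reldim_le (addff char2) (zsub_sub F) hd (F2c_dim char2) h; lia.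
move=> hx; apply: contrapT => nc; apply: nx; exists x; split; first exact: reg_Ls hx.
exact: transcendentalP.
Qed.

(** [F] is the field of fractions of the regular functions. If [a] is the leading coefficient of an
    equation of [w] over $\mathbb F_2[x]$ with [x] regular, then $aw$ satisfies a monic equation
    with regular coefficients and has no pole outside [P0]. *)
Lemma reg_fraction (w : F) : exists a, [/\ a != 0, reg a & reg (a * w)].
Proof.
have [x [rx trx]] := exists_x.
have [q [q0 hq e]] := alg_dep char2 hff w trx.
have rq i : reg q`_i by have [p hp ->] := hq i; apply: reg_horner.
pose a := lead_coef q; have a0 : a != 0 by rewrite lead_coef_eq0.
have ra : reg a by apply: rq.
exists a; split=> // Q QP; apply: contrapT => nv.
have w0 : w != 0 by apply/eqP => w0; apply: nv; rewrite w0 mulr0; left.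
have aw0 : a * w != 0 by rewrite mulf_neq0.
have neg : ord Q (a * w) < 0 by rewrite ltNge; apply/negP => h; apply: nv; right.
pose n := (size q).-1; pose u := a * w.
have sq : size q = n.+1 by rewrite /n prednK // lt0n size_poly_eq0.
have n0 : (0 < n)%N.
  rewrite lt0n; apply/eqP => n0; move: e; rewrite (size1_polyC (_ : (size q <= 1)%N)) ?sq ?n0 //.
  by rewrite hornerC => c0; move: a0; rewrite /a lead_coefE -/n n0 c0 eqxx.
have eu : u ^+ n = \sum_(i < n) (q`_i * a ^+ (n.-1 - i)) * u ^+ i.
  have e2 : a ^+ n.-1 * q.[w] = 0 by rewrite e mulr0.
  move: e2; rewrite horner_coef sq big_ord_recr /= -/n mulrDr => /eqP.
  rewrite addrC addr_eq0 (oppx char2) mulr_sumr => /eqP e2.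
  rewrite (_ : u ^+ n = a ^+ n.-1 * (q`_n * w ^+ n)); last first.
    by rewrite (_ : q`_n = a) // mulrA -exprSr prednK // exprMn.
  rewrite e2; apply: eq_bigr => i _; rewrite exprMn.
  rewrite mulrCA -!mulrA; congr (_ * _); rewrite !mulrA; congr (_ * _).
  by rewrite -exprD subnK // -ltnS prednK.
have h1 : vge Q (n.-1%:Z * ord Q u) (u ^+ n).
  rewrite eu; apply: vge_sum => i _; rewrite -[X in vge _ X]add0r.
  apply: vgeM; first by apply: vgeM0; [apply: rq | apply: vgeX0; apply: ra].
  right; rewrite ordXz; have := ltn_ord i; move: neg; rewrite -/u => h1 h2; nia.
by move: h1; rewrite vgeP ?expf_neq0 // ordXz; move: neg; rewrite -/u => h1; nia.
Qed.

(* [s] stays independent over [F_2[z]], which bounds its size by the pole order of [z]. *)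
Lemma indep_pole_bound (O J : F -> Prop) z n s :
  is_sub O -> is_sub J -> (forall u, J u -> O u) -> (forall u, O u -> J (z * u)) ->
  z != 0 -> Ls (pt P0 *+ n) z -> (forall u, u \in s -> O u) -> free J s -> (size s <= n)%N.
Proof.
move=> sO sJ JO zOJ z0 hz hs fs.
have zM : {morph *%R z : x y / x + y} by move=> x y; rewrite mulrDr.
have [a [a0 [C [ha haC]]]] : exists a, a != 0 /\ exists C, Ls (pt P0 *+ C) a /\
    forall u, u \in s -> Ls (pt P0 *+ C) (a * u).
  elim: s {hs fs} => [|u s [a [a0 [C [ha IH]]]]].
    exists 1; rewrite oner_neq0; split=> //; exists 0%N; split=> // P.
    by rewrite mulr0n d0 oppr0; exact: vge1.
  have [b [b0 rb rbu]] := reg_fraction u.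
  have [n1 h1] := reg_pole rbu; have [n2 h2] := reg_pole rb.
  exists (b * a); rewrite mulf_neq0 //; split=> //.
  exists (n1 + n2 + C)%N; split.
    by apply: (@LsP0_mono (n2 + C)); [lia | exact: LsP0_mul].
  move=> v; rewrite inE => /orP[/eqP->|/IH h3].
    rewrite (_ : b * a * u = (b * u) * a); last by ring.
    by apply: (@LsP0_mono (n1 + C)); [lia | exact: LsP0_mul].
  by rewrite -mulrA; apply: (@LsP0_mono (n2 + C)); [lia | exact: LsP0_mul].
(* [T k] lists the $z^i u$ with $i < k$ and [u] in [s]. These $k|s|$ independent elements,
   multiplied by [a], have pole order at most $C + nk$, which forces $|s| \le n$ once $k > C+1$. *)
pose T k := iter k (fun t => s ++ [seq z * u | u <- t]) [::].
have sT k : size (T k) = (k * size s)%N.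
  by elim: k => //= k IH; rewrite size_cat size_map IH mulSn.
have TO k u : u \in T k -> O u.
  elim: k u => //= k IH u; rewrite mem_cat => /orP[/hs //|/mapP[v /IH Ov ->]].
  exact/JO/zOJ.
have fT k : free (@zsub F) (T k).
  elim: k => //= k IH; apply/free_cat; split.
    apply: free_mono fs; apply: (gen_min (addff char2)) => //; first by move=> y ->; case: sJ.
    by move=> y /mapP[v /TO Ov ->]; apply: zOJ.
  apply: (@free_map _ _ (fun x => z * x) zM (@zsub F) (fun _ => True)) => //.
  by move=> x _; rewrite /zsub; split=> [->|/eqP]; rewrite ?mulr0 // mulf_eq0 (negPf z0) => /eqP.
have lT k u : u \in T k -> Ls (pt P0 *+ (C + n * k)) (a * u).
  elim: k u => //= k IH u; rewrite mem_cat => /orP[/haC|/mapP[v /IH h ->]].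
    by apply: LsP0_mono; lia.
  rewrite mulrCA mulnS addnCA; exact: LsP0_mul.
have bound k : (k * size s <= (C + n * k).+1)%N.
  rewrite -sT -(size_map (fun u => a * u)).
  apply: leq_trans _ (ell_P0_le _).
  apply: (reldim_size (addff char2) (zsub_sub F) (ellP char2 hg (good_P0 _))).
    by move=> x /mapP[u /lT h ->].
  have aM : {morph *%R a : x y / x + y} by move=> x y; rewrite mulrDr.
  apply: (@free_map _ _ (fun x => a * x) aM (@zsub F) (fun _ => True)) => //.
  by move=> x _; rewrite /zsub; split=> [->|/eqP]; rewrite ?mulr0 // mulf_eq0 (negPf a0) => /eqP.
by have := bound C.+2; nia.
Qed.

Lemma exists_zero Q : Q != P0 -> exists z, [/\ z != 0, reg z & vge Q 1 z].
Proof.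
move=> QP; have [t t0 ht] := ord_unif Q.
have [a [a0 ra rat]] := reg_fraction t.
exists (a * t); rewrite mulf_neq0 //; split=> //.
rewrite -[X in vge Q X _]add0r; apply: vgeM; first exact: ra.
by right; rewrite ht.
Qed.

(** A regular function vanishing at [Q] has a finite pole order at [P0], and this bounds the degree
    of [Q]. *)
Lemma all_ok Q : okp Q.
Proof.
have [->|QP] := eqVneq Q P0; first by exists 1%N.
have [z [z0 rz vz]] := exists_zero QP; have [n hn] := reg_pole rz.
have [||d _ hd] := @reldim_bound _ (addff char2) (vge Q 1) (vge Q 0) n (vge_sub Q 1) (vge_sub Q 0).
- by move=> x; apply: vgeW.
- move=> s hs fs; apply: (@indep_pole_bound (vge Q 0) (vge Q 1) z) => //; try exact: vge_sub.
    by move=> x; apply: vgeW.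
  by move=> u hu; rewrite -[X in vge Q X _]addr0; apply: vgeM.
by exists d; apply/(place_degP char2).
Qed.

Lemma place_dim Q : reldim (vge Q 1) (vge Q 0) (degp Q).
Proof. exact/(place_degP char2)/degpP/all_ok. Qed.

Lemma degp_gt0 Q : (0 < degp Q)%N.
Proof.
rewrite lt0n; apply/eqP => e; have := place_dim Q; rewrite e => -[[|x s] [//= _ _ e2]].
have : vge Q 0 1 by exact: vge1.
by rewrite e2 vgeP ?oner_neq0 // ord1.
Qed.

Lemma goodE D : finsupp D -> good D.
Proof. by move=> h; split=> // P _; apply: all_ok. Qed.

(** If the valuation ring of [P] lay in that of [Q], units at [P] would be units at [Q] and [ord Q]
    would be a multiple of [ord P]; both being normalised, the places would coincide. *)
Lemma place_neq P Q : P != Q -> exists x, [/\ x != 0, 0 <= ord P x & ord Q x < 0].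
Proof.
move=> PQ; apply: contrapT => nx; move/eqP: PQ; apply.
have h1 x : x != 0 -> 0 <= ord P x -> 0 <= ord Q x.
  by move=> x0 hx; rewrite leNgt; apply/negP => h; apply: nx; exists x.
have h2 x : x != 0 -> ord P x = 0 -> ord Q x = 0.
  move=> x0 e; apply/eqP; rewrite eq_le h1 ?e // andbT.
  by have := h1 x^-1; rewrite invr_eq0 !ordV e oppr0 oppr_ge0; apply.
have [t t0 ht] := ord_unif P.
have e x : x != 0 -> ord Q x = ord P x * ord Q t.
  move=> x0; have [y y0 hy] : exists2 y, y != 0 & ord P y = ord P x /\ ord Q y = ord P x * ord Q t.
    case: (ord P x) => n.
      by exists (t ^+ n); rewrite ?expf_neq0 // !ordXz ht mulr1.
    exists (t ^+ n.+1)^-1; rewrite ?invr_eq0 ?expf_neq0 // !ordV !ordXz ht mulr1 NegzE mulNr //.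
  have y0' : y^-1 != 0 by rewrite invr_eq0.
  have := h2 (x / y) (mulf_neq0 x0 y0'); rewrite !ordM // !ordV hy.1 subrr => /(_ erefl) /eqP.
  by rewrite subr_eq0 => /eqP ->; rewrite hy.2.
have et : ord Q t = 1.
  have := h1 t t0; rewrite ht => /(_ isT) t_ge0.
  have [u u0 hu] := ord_unif Q; have := e u u0; rewrite hu.
  set a := ord P u; set b := ord Q t in t_ge0 *; move=> eab.
  have : (b %| 1)%Z by apply/dvdzP; exists a.
  by rewrite dvdz1; move: t_ge0; lia.
have {}e x : x != 0 -> ord Q x = ord P x by move=> /e ->; rewrite et mulr1.
move: e; clear; case: P Q => v hv [w hw] e.
have vw : v = w.
  apply/funext => x; have [->|x0] := eqVneq x 0; last by have := e x x0.
  by have [-> _ _ _] := hv; have [-> _ _ _] := hw.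
by clear e; move: hw; rewrite -vw => hw; congr exist; apply: Prop_irrelevance.
Qed.

Lemma place_sep P Q : P != Q -> exists x, [/\ x != 0, 0 < ord P x & ord Q x < 0].
Proof.
move=> PQ; have [x [x0 h1 h2]] := place_neq PQ.
rewrite eq_sym in PQ; have [y [y0 h3 h4]] := place_neq PQ.
exists (x / y); rewrite mulf_neq0 ?invr_eq0 // !ordM ?invr_eq0 // !ordV; split=> //; lia.
Qed.

Lemma place_sep_seq P (s : seq (place F)) : P \notin s ->
  exists x, [/\ x != 0, 0 < ord P x & forall Q, Q \in s -> ord Q x < 0].
Proof.
elim: s => [_|Q s IH]; first by have [t t0 ht] := ord_unif P; exists t; rewrite ht.
rewrite inE negb_or => /andP[PQ /IH[z [z0 zP zs]]].
have [zQ|zQ] := ltP (ord Q z) 0.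
  by exists z; split=> // R; rewrite inE => /orP[/eqP ->|/zs].
have [y [y0 yP yQ]] := place_sep PQ.
(* Since [r] exceeds every $|\mathrm{ord}_R z|$, a pole of [y] at [R] dominates in $y^r + z$; at the
   other [R] in [s] the pole of [z] survives. *)
pose r := (\sum_(R <- s) `|ord R z|%N).+1.
have yr0 : y ^+ r != 0 by rewrite expf_neq0.
have [zy0 oQ] : y ^+ r + z != 0 /\ ord Q (y ^+ r + z) = ord Q (y ^+ r).
  by apply: (vge_ordD char2) => //; right; rewrite ordXz /r; nia.
exists (y ^+ r + z); split=> //.
  suff: vge P 1 (y ^+ r + z) by rewrite vgeP.
  by apply: vgeD; right; rewrite ?ordXz /r; nia.
move=> R; rewrite inE => /orP[/eqP ->|Rs]; first by rewrite oQ ordXz /r; nia.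
have hR : (`|ord R z| < r)%N.
  by rewrite /r ltnS (big_rem R Rs) /= leq_addr.
have := zs R Rs; have [yR|yR] := ltP (ord R y) 0 => zR.
  have [_ ->] : y ^+ r + z != 0 /\ ord R (y ^+ r + z) = ord R (y ^+ r).
    by apply: (vge_ordD char2) => //; right; rewrite ordXz; nia.
  by rewrite ordXz /r; nia.
have [_ e] : z + y ^+ r != 0 /\ ord R (z + y ^+ r) = ord R z.
  by apply: (vge_ordD char2) => //; right; rewrite ordXz; nia.
by rewrite addrC e.
Qed.

Lemma place_idem P (s : seq (place F)) : P \notin s ->
  exists u, [/\ vge P 1 (u + 1), vge P 0 u & forall Q, Q \in s -> vge Q 1 u].
Proof.
move=> /place_sep_seq[z [z0 zP zs]].
have [z10 oP] : 1 + z != 0 /\ ord P (1 + z) = ord P 1.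
  by apply: (vge_ordD char2); rewrite ?oner_neq0 //; right; rewrite ord1; lia.
rewrite ord1 in oP.
exists (1 + z)^-1; split.
- rewrite (_ : _ + 1 = z * (1 + z)^-1); last first.
    rewrite -[X in _ + X](mulfV z10) -{1}[_^-1]mul1r -mulrDl; congr (_ * _).
    by rewrite addrA addff // add0r.
  by right; rewrite ordM ?invr_eq0 // ordV oP; lia.
- by right; rewrite ordV oP.
move=> Q /zs zQ; right; rewrite ordV addrC.
have [_ ->] : z + 1 != 0 /\ ord Q (z + 1) = ord Q z; last lia.
by apply: (vge_ordD char2) => //; right; rewrite ord1; lia.
Qed.

(** The functions that are 1 at one place of [s] and vanish at the others are independent modulo
    [J], and [z] multiplies [O] into [J]. *)
Lemma zeros_bound z n (s : seq (place F)) : z != 0 -> Ls (pt P0 *+ n) z -> uniq s ->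
  (forall Q, Q \in s -> vge Q 1 z) -> (size s <= n)%N.
Proof.
move=> z0 hz us hs.
pose O u := forall Q, Q \in s -> vge Q 0 u.
pose J u := forall Q, Q \in s -> vge Q 1 u.
have sO : is_sub O by split=> [Q _|x y hx hy Q Qs]; [exact: vge0 | apply: vgeD; [apply: hx | apply: hy]].
have sJ : is_sub J by split=> [Q _|x y hx hy Q Qs]; [exact: vge0 | apply: vgeD; [apply: hx | apply: hy]].
have /choice[u hu] : forall Q, exists u, [/\ vge Q 1 (u + 1), vge Q 0 u &
    forall R, R \in s -> R != Q -> vge R 1 u].
  move=> Q; have [|u [h1 h2 h3]] := @place_idem Q (rem Q s); first by rewrite mem_rem_uniqF.
  by exists u; split=> // R Rs RQ; apply: h3; rewrite mem_rem_uniq // inE RQ.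
have uO t : {subset t <= s} -> forall v, v \in map u t -> O v.
  move=> ts v /mapP[Q /ts Qs ->] R Rs; have [_ h2 h3] := hu Q.
  by have [->//|RQ] := eqVneq R Q; apply: vgeW (h3 R Rs RQ).
rewrite -(size_map u); apply: (@indep_pole_bound O J z) => //.
- by move=> v hv Q Qs; apply: vgeW (hv Q Qs).
- by move=> v hv Q Qs; rewrite -[X in vge Q X _]addr0; apply: vgeM; [apply: hs | apply: hv].
- exact: uO.
suff H t : {subset t <= s} -> uniq t -> free J (map u t) by apply: H.
elim: t => //= Q t IH ts /andP[Qt ut].
have ts' : {subset t <= s} by move=> R Rt; apply: ts; rewrite inE Rt orbT.
split; last exact: IH.
move=> gQ; have Qs : Q \in s by apply: ts; rewrite inE eqxx.
have [h1 h2 h3] := hu Q.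
have : vge Q 1 (u Q).
  apply: (gen_min (addff char2) (vge_sub Q 1) _ _ gQ); first by move=> y /(_ Q Qs).
  move=> y /mapP[R Rt ->]; have [_ _ hR] := hu R; apply: hR => //.
  by apply: contraNneq Qt => ->.
move=> /(vgeD h1); rewrite addrAC addff // add0r vgeP ?oner_neq0 // ord1 //.
Qed.

Lemma finite_pred (A : place F -> Prop) n :
  (forall s, uniq s -> (forall Q, Q \in s -> A Q) -> (size s <= n)%N) ->
  exists s, uniq s /\ forall Q, Q \in s <-> A Q.
Proof.
move=> hb; pose R k := `[< exists s, [/\ uniq s, size s = k & forall Q, Q \in s -> A Q] >].
have exR : exists k, R k by exists 0%N; apply/asboolP; exists [::].
have bR k : R k -> (k <= n)%N by move=> /asboolP[s [us <- hs]]; apply: hb.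
case: (ex_maxnP exR bR) => k /asboolP[s [us sk hs]] mx; exists s; split=> // Q; split; first exact: hs.
move=> AQ; apply: contraT => Qs; have : R k.+1.
  apply/asboolP; exists (Q :: s); split=> //=; [by rewrite Qs | by rewrite sk |].
  by move=> T; rewrite inE => /orP[/eqP->|/hs].
by move/mx; rewrite ltnn.
Qed.

Lemma zeros_finite z : z != 0 -> reg z -> exists s : seq (place F), forall Q, vge Q 1 z -> Q \in s.
Proof.
move=> z0 /reg_pole[n hn].
have [|s [_ hs]] := @finite_pred (fun Q => vge Q 1 z) n; first by move=> s us; apply: zeros_bound.
by exists s => Q /hs.
Qed.

Definition div (w : F) : place F -> int := fun Q => ord Q w.

Lemma div_finsupp w : w != 0 -> finsupp (div w).
Proof.
move=> w0; have [a [a0 ra raw]] := reg_fraction w.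
have aw0 : a * w != 0 by rewrite mulf_neq0.
have [s hs] := zeros_finite a0 ra; have [t ht] := zeros_finite aw0 raw.
exists (P0 :: s ++ t) => Q; rewrite /div inE mem_cat => oQ.
have [//|QP /=] := eqVneq Q P0.
have [/hs ->//|n1] := pselect (vge Q 1 a); have [/ht ->|n2] := pselect (vge Q 1 (a * w)); first by rewrite orbT.
have /vgeP := ra Q QP => /(_ a0) h1; have /vgeP := raw Q QP => /(_ aw0) h2.
move: n1 n2 h2 oQ; rewrite !vgeP // ordM // => n1 n2 h2 oQ; exfalso; move/eqP: oQ; apply; lia.
Qed.
Lemma div_good w : w != 0 -> good (div w).
Proof. by move=> /div_finsupp/goodE. Qed.

Lemma divV w : div w^-1 = - div w.
Proof. by apply/funext => P; rewrite dN /div ordV. Qed.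

Lemma Ls_div D w : w != 0 -> forall x, Ls (D + div w) x <-> Ls D (w * x).
Proof.
move=> w0 x; split=> h P; have := h P; rewrite vge_mulP // dD /div opprD //.
Qed.

Lemma ell_div D w : good D -> w != 0 -> ell (D + div w) = ell D.
Proof.
move=> gD w0; apply: ell_uniq => //.
apply: (reldim_iso (addff char2) (addff char2) (f := *%R w) _ _ _ _ _ _ _ _ (ellP char2 hg gD)).
- by move=> x y; rewrite mulrDr.
- exact: zsub_sub.
- exact: Ls_sub.
- by move=> x ->; case: (Ls_sub (D + div w)).
- exact: zsub_sub.
- by move=> x /(Ls_div D w0).
- by move=> x _; rewrite /zsub; split=> [->|/eqP]; rewrite ?mulr0 // mulf_eq0 (negPf w0) => /eqP.
move=> y hy; exists (w^-1 * y); last by rewrite mulVKf // /zsub addff.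
by apply/(Ls_div D w0); rewrite mulVKf.
Qed.

(** All multiples of a principal divisor have [ell] equal to 1. A positive degree would contradict
    Riemann's inequality for the multiple by $g+1$; for a negative degree take the inverse. *)
Lemma deg_div w : w != 0 -> deg (div w) = 0.
Proof.
suff H v : v != 0 -> deg (div v) <= 0.
  move=> w0; apply/eqP; rewrite eq_le H //=; have := H w^-1.
  by rewrite invr_eq0 divV degN ?oppr_le0 => [->//|]; apply: div_finsupp.
move=> v0; rewrite leNgt; apply/negP => dv_gt0.
have fv := div_finsupp v0.
have e m : ell (div v *+ m) = 1%N.
  elim: m => [|m IH]; first by rewrite mulr0n (ell0 char2 fcf hg).
  by rewrite mulrSr ell_div //; apply/goodMn/div_good.
have := riemann_ge char2 hg (goodMn g.+1 (div_good v0)).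
by rewrite e degMn // mulrn_int; nia.
Qed.

Lemma deg_eff D : finsupp D -> eff D -> 0 <= deg D.
Proof.
move: D; apply: eff_ind; first by rewrite deg0.
move=> G Q fG _ IH; rewrite degD ?deg_pt //; last exact: finsupp_pt.
lia.
Qed.

Lemma ell_neg D : finsupp D -> deg D < 0 -> ell D = 0%N.
Proof.
move=> fD dD0; apply: ell_uniq => //; exists [::]; split=> //.
apply/prop_eq => x /=; rewrite /zsub; split=> [h|-> P]; last exact: vge0.
apply/eqP; apply: contraT => x0.
have : 0 <= deg (D + div x).
  apply: deg_eff; first exact/finsuppD/div_finsupp.
  by move=> P; have := h P; rewrite vgeP // dD /div; lia.
by rewrite degD ?deg_div ?addr0 //; [lia | exact: div_finsupp].
Qed.

(** Riemann's inequality is an equality at the divisor [A] that attains the genus, hence also at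
    every divisor above [A]. For degree at least [deg A + g], $D - A$ has a nonzero section, so [D]
    is equivalent to such a divisor. *)
Lemma riemann_eq : exists N : int, forall D, finsupp D -> N <= deg D -> (ell D)%:Z = deg D + 1 - g%:Z.
Proof.
have [A [l [gA hl eA]]] := genus_div char2 hg.
exists (deg A + g%:Z) => D fD hD; have gD := goodE fD.
apply/eqP; rewrite eq_le (riemann_ge char2 hg gD) andbT.
have fA : finsupp A by case: gA.
have := riemann_ge char2 hg (goodD gD (goodN gA)); rewrite degB // => h.
have [z z0 hz] : exists2 z, z != 0 & Ls (D - A) z.
  apply: contrapT => nz; have e : Ls (D - A) = @zsub F.
    apply/prop_eq => x; split=> [hx|->]; last by case: (Ls_sub (D - A)).
    by apply/eqP; apply: contraT => x0; case: nz; exists x.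
  have : ell (D - A) = 0%N by apply: ell_uniq => //; rewrite e; apply: reldim_refl.
  by move=> e0; rewrite e0 in h; lia.
have gz := div_good z0.
have [|e [_ e1 e2]] := ell_ext char2 hg gA (goodD gD gz).
  by move=> P; have := hz P; rewrite vgeP // !dE /div; lia.
rewrite ell_div // in e1; rewrite degD ?deg_div ?addr0 // in e2; last by case: gz.
rewrite (ell_uniq char2 hl) in e1; lia.
Qed.

End Structure.

(** * The Riemann-Roch theorem *)

Section Functionals.
Variable V : zmodType.
Hypothesis addvv : forall x : V, x + x = 0.

Definition functional (lam : V -> bool) : Prop := forall x y, lam (x + y) = lam x (+) lam y.
Definition kills (lam : V -> bool) (U : V -> Prop) : Prop := forall x, U x -> lam x = false.

Lemma functional0 lam : functional lam -> lam 0 = false.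
Proof. by move=> h; have := h 0 0; rewrite addr0; case: (lam 0). Qed.

Lemma kills_gen lam U s : functional lam -> kills lam U -> (forall x, x \in s -> lam x = false) ->
  kills lam (gen U s).
Proof.
move=> hl kl hs x; apply: (gen_min addvv (W := fun x => lam x = false)) => //.
by split=> [|y z]; [exact: functional0 | rewrite hl => -> ->].
Qed.

Lemma functional_extend U s (c : seq bool) : is_sub U -> free U s -> size c = size s ->
  exists lam, [/\ forall x y, gen U s x -> gen U s y -> lam (x + y) = lam x (+) lam y,
    kills lam U & map lam s = c].
Proof.
move=> hU; elim: s c => [|a s IH] [|b c] //=.
  by move=> _ _; exists (fun _ => false).
move=> [na fs] /succn_inj/(IH c fs)[lam [h1 h2 h3]].
pose G := gen U s; have sG : is_sub G by apply: gen_sub.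
have GD x y : G x -> G y -> G (x + y) by case: sG => _; apply.
have shift x : G (x + a) -> ~ G x.
  by move=> h hx; have := GD _ _ hx h; rewrite addrA addvv add0r; apply: na.
exists (fun y => if `[< G y >] then lam y else lam (y + a) (+) b); split.
- move=> x y hx hy; case: (asboolP (G x)) => gx; case: (asboolP (G y)) => gy.
  + by rewrite asboolT ?h1 //; apply: GD.
  + have {}hy : G (y + a) by case: hy.
    rewrite asboolF; last by apply: shift; rewrite -addrA; apply: GD.
    by rewrite -addrA (h1 x (y + a)) //=; case: (lam x); case: (lam (y + a)); case: b.
  + have {}hx : G (x + a) by case: hx.
    rewrite asboolF; last by apply: shift; rewrite addrAC; apply: GD.
    by rewrite addrAC (h1 (x + a) y) //=; case: (lam (x + a)); case: (lam y); case: b.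
  + have {}hx : G (x + a) by case: hx.
    have {}hy : G (y + a) by case: hy.
    have e : x + y = (x + a) + (y + a) by rewrite addrACA addvv addr0.
    rewrite asboolT; last by rewrite e; apply: GD.
    by rewrite e (h1 (x + a) (y + a)) //=; case: (lam (x + a)); case: (lam (y + a)); case: b.
- move=> x Ux; rewrite asboolT; first exact: h2.
  exact: gen_incl.
- rewrite asboolF // addvv; congr (_ :: _); first by rewrite h2 //; case: hU.
  rewrite -h3; apply/eq_in_map => x xs; rewrite asboolT //; exact: gen_mem.
Qed.

Lemma functional_exists U m : is_sub U -> reldim U (fun _ => True) m ->
  exists s : seq V, forall c : m.-tuple bool,
    exists lam, [/\ functional lam, kills lam U & map lam s = c].
Proof.
move=> hU [s [sm fs e]]; exists s => c.
have [|lam [h1 h2 h3]] := @functional_extend U s c hU fs; first by rewrite size_tuple.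
by exists lam; split=> // x y; apply: h1; rewrite -e.
Qed.

(** A functional that kills [U] is determined by its values on [m] vectors spanning modulo [U]. *)
Lemma functional_count (T : eqType) (L : seq T) (phi : T -> V -> bool) U m :
  is_sub U -> reldim U (fun _ => True) m -> uniq L ->
  (forall t, t \in L -> functional (phi t) /\ kills (phi t) U) ->
  (forall t t', t \in L -> t' \in L -> phi t =1 phi t' -> t = t') ->
  (size L <= 2 ^ m)%N.
Proof.
move=> hU [s [<- fs e]] uL hL inj.
have <- : #|{: (size s).-tuple bool}| = (2 ^ size s)%N by rewrite card_tuple card_bool.
pose f t := [tuple of map (phi t) (in_tuple s)].
have uf : uniq (map f L).
  rewrite map_inj_in_uniq // => t t' tL tL' ef; apply: inj => // x.
  have [h1 h2] := hL t tL; have [h1' h2'] := hL t' tL'.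
  have es : map (phi t) s = map (phi t') s by have := congr1 val ef.
  have h3 : functional (fun x => phi t x (+) phi t' x) by move=> y z; rewrite h1 h1' addbACA.
  have h4 : kills (fun x => phi t x (+) phi t' x) (gen U s).
    apply: kills_gen => //; first by move=> y Uy; rewrite h2 // h2'.
    by move=> y ys; move/eq_in_map: es => -> //; rewrite addbb.
  have : gen U s x by rewrite -e.
  by move/h4; case: (phi t x); case: (phi t' x).
by rewrite -(size_map f) -(card_uniqP uf); apply: max_card.
Qed.

(** All $2^m$ patterns of values on such vectors occur, so a shorter list of functions misses
    one. *)
Lemma functional_avoid (T : eqType) (L : seq T) (phi : T -> V -> bool) U m :
  is_sub U -> reldim U (fun _ => True) m -> (size L < 2 ^ m)%N ->
  exists lam, [/\ functional lam, kills lam U & forall t, t \in L -> ~ phi t =1 lam].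
Proof.
move=> hU hm sL; apply: contrapT => nex.
have [s hs] := functional_exists hU hm.
have /choice[f hf] : forall c : m.-tuple bool, exists t, t \in L /\
    exists2 lam, phi t =1 lam & map lam s = c.
  move=> c; apply: contrapT => nt; have [lam [h1 h2 h3]] := hs c.
  apply: nex; exists lam; split=> // t tL et; apply: nt; exists t; split=> //.
  by exists lam.
move: sL; rewrite ltnNge => /negP; apply.
rewrite -card_bool -card_tuple cardE -(size_map f); apply: uniq_leq_size.
  rewrite map_inj_uniq ?enum_uniq // => c c' e; apply: val_inj => /=.
  have [_ [lam l1 <-]] := hf c; have [_ [lam' l1' <-]] := hf c'.
  by apply: eq_map => x; rewrite -l1 -l1' e.
by move=> t /mapP[c _ ->]; have [] := hf c.
Qed.
End Functionals.

(** * Functionals as Weil differentials, and the canonical divisor *)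

Section Duality.
Variables (F : fieldType) (g : nat) (P0 : place F).
Hypothesis hcurve : pointed_curve g P0.
Let char2 : (2%:R : F) = 0. Proof. by case: hcurve. Qed.
Let hg : is_genus F g. Proof. by case: hcurve. Qed.
Let hP0 : place_deg P0 1. Proof. by case: hcurve. Qed.
Let aff := addff char2.
Implicit Types (P Q : place F) (D E G K : place F -> int).

(** The residue field of [P0] has two elements, so [v / x] is congruent to 0 or to 1. *)
Lemma P0_residue x v : x != 0 -> vge P0 (ord P0 x) v ->
  vge P0 (ord P0 x + 1) v \/ vge P0 (ord P0 x + 1) (v + x).
Proof.
move=> x0 hv; have := place_dim hcurve P0; rewrite (degP0 char2 hP0) => -[[|s [|? ?]] [//= _ [hs _] e]].
have h1 : vge P0 1 (1 + s).
  have : vge P0 0 1 by exact: vge1.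
  by rewrite e => -[|//]; rewrite vgeP ?oner_neq0 // ord1.
have hy : vge P0 0 (x^-1 * v) by rewrite vge_mulP ?invr_eq0 // ordV; apply: vgeW hv; lia.
have := hy; rewrite {1}e => -[h|h]; [left|right].
  by move: h; rewrite vge_mulP ?invr_eq0 // ordV; apply: vgeW; lia.
have : vge P0 1 (x^-1 * v + s + (1 + s)) by apply: vgeD.
rewrite [1 + s]addrC addrA (addKv aff) -(mulVf x0) -mulrDr.
by rewrite vge_mulP ?invr_eq0 // ordV; apply: vgeW; lia.
Qed.

Definition mreg D (w : F) : Prop := forall Q, Q != P0 -> vge Q (- D Q) w.
(* Stands for the repartitions congruent to a function modulo the repartition space of [D]: by strong
   approximation only the component at [P0] has to be recorded. *)
Definition Wd D (w : F) : Prop := exists2 u, mreg D u & vge P0 (- D P0) (w + u).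

Lemma mregD D x y : mreg D x -> mreg D y -> mreg D (x + y).
Proof. by move=> hx hy Q QP; apply: vgeD; [apply: hx | apply: hy]. Qed.
Lemma mreg0 D : mreg D 0. Proof. by move=> Q _; exact: vge0. Qed.
Lemma Wd_sub D : is_sub (Wd D).
Proof.
split; first by exists 0; [exact: mreg0 | rewrite addr0; exact: vge0].
move=> x y [u hu hx] [v hv hy]; exists (u + v); first exact: mregD.
by rewrite addrACA; apply: vgeD.
Qed.
Lemma Wd_mreg D u : mreg D u -> Wd D u.
Proof. by move=> h; exists u => //; rewrite aff; exact: vge0. Qed.
Lemma Wd_loc D v : vge P0 (- D P0) v -> Wd D v.
Proof. by move=> h; exists 0; [exact: mreg0 | rewrite addr0]. Qed.
Lemma Wd_mono D E : (forall P, D P <= E P) -> forall w, Wd D w -> Wd E w.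
Proof.
move=> DE w [u hu hw]; exists u; last by apply: vgeW hw; rewrite lerN2.
by move=> Q QP; apply: vgeW (hu Q QP); rewrite lerN2.
Qed.
Lemma LsE D x : Ls D x <-> mreg D x /\ vge P0 (- D P0) x.
Proof.
split=> [h|[h1 h2] Q]; first by split=> [Q _|]; apply: h.
by have [->|QP] := eqVneq Q P0; last exact: h1.
Qed.
Lemma mreg_P0 D x : mreg (D + pt P0) x <-> mreg D x.
Proof. by split=> h Q QP; have := h Q QP; rewrite !dE (negPf QP) addr0. Qed.

(** When [P0] is added, exactly one of [L] and [Wd] grows, by one dimension: a function with the new
    pole order at [P0] is just what is required to keep [Wd] unchanged. *)
Lemma Wd_step D : finsupp D -> exists2 c,
  reldim (Wd D) (Wd (D + pt P0)) c & (c + ell (D + pt P0)%R = ell D + 1)%N.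
Proof.
move=> fD; have gD := goodE hcurve fD; have gP := goodE hcurve (finsupp_pt P0).
have le P : D P <= (D + pt P0) P by rewrite !dE; case: (P == P0); lia.
have [e [he -> e1]] := ell_ext char2 hg gD (goodD gD gP) le.
have {}e1 : (e <= 1)%N.
  by move: e1; rewrite degD ?deg_pt ?(degP0 char2 hP0) //; [lia | exact: finsupp_pt].
have DP : - (D + pt P0) P0 = - D P0 - 1 by rewrite !dE eqxx opprD.
case: e e1 he => [|[|//]] _ he.
  have eL : Ls (D + pt P0) = Ls D by case: he => -[|? ?] [] // _ _ ->.
  exists 1%N; last by lia.
  have [t t0 ht] := ord_surj P0 (- D P0 - 1).
  exists [:: t]; split=> //=.
    split=> // -[u hu hv].
    have : Ls D u.
      rewrite -eL; apply/LsE; split; first exact/mreg_P0.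
      rewrite DP (_ : u = t + u + t); last by rewrite [t + u]addrC (addKv aff).
      by apply: vgeD; [apply: vgeW hv; lia | right; rewrite ht].
    move=> /(_ P0) hu2; have : vge P0 (- D P0) t.
      by rewrite -(addKv aff t u); apply: vgeD.
    by rewrite vgeP // ht; lia.
  apply/prop_eq => w; split; last first.
    have tW : Wd (D + pt P0) t by apply: Wd_loc; right; rewrite DP ht.
    case=> /(Wd_mono le) // h; rewrite -(addKv aff w t).
    by case: (Wd_sub (D + pt P0)) => _; apply.
  move=> [u /mreg_P0 hu]; rewrite DP -{1}ht => /(P0_residue t0); rewrite ht subrK.
  by case=> h; [left|right]; exists u => //; rewrite addrAC.
exists 0%N; last by lia.
exists [::]; split=> //=; apply/prop_eq => w; split; last exact: Wd_mono.
have [x [x0 hx nx]] : exists x, [/\ x != 0, Ls (D + pt P0) x & ~ Ls D x].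
  case: he => -[|x [|? ?]] [//= _ [nx _] ex]; exists x; split=> //.
    by apply/eqP => x0; apply: nx; rewrite x0; case: (Ls_sub D).
  by rewrite ex; right; rewrite aff; case: (Ls_sub D).
have ox : ord P0 x = - D P0 - 1.
  have := hx P0; rewrite vgeP // DP => h1.
  have : ~ vge P0 (- D P0) x by move/(Ls_pt hx).
  by rewrite vgeP // => h2; lia.
have xW : mreg D x by case/LsE: hx => /mreg_P0.
move=> [u /mreg_P0 hu]; rewrite DP -{1}ox => /(P0_residue x0); rewrite ox subrK.
case=> h; first by exists u.
by exists (u + x); [exact: mregD | rewrite addrA].
Qed.

Lemma ptMnS D n : D + pt P0 *+ n.+1 = D + pt P0 *+ n + pt P0.
Proof. by rewrite mulrSr addrA. Qed.

Lemma Wd_steps D n : finsupp D -> exists2 c,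
  reldim (Wd D) (Wd (D + pt P0 *+ n)) c & (c + ell (D + pt P0 *+ n)%R = ell D + n)%N.
Proof.
move=> fD; elim: n => [|n [c h e]].
  by exists 0%N; rewrite mulr0n addr0 ?addn0 //; apply: reldim_refl.
have fDn : finsupp (D + pt P0 *+ n) by apply/finsuppD/finsuppMn/finsupp_pt.
rewrite ptMnS; have [c' h' e'] := Wd_step fDn.
by exists (c + c')%N; [apply: reldim_trans h h' | lia].
Qed.

Lemma degDP0 D n : finsupp D -> deg (D + pt P0 *+ n) = deg D + n%:Z.
Proof. by move=> fD; rewrite degD ?(deg_P0 hcurve) //; apply/finsuppMn/finsupp_pt. Qed.

Lemma finsuppP0 D n : finsupp D -> finsupp (D + pt P0 *+ n).
Proof. by move=> fD; apply/finsuppD/finsuppMn/finsupp_pt. Qed.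

(* The index of [Wd D] is the index of speciality of [D]. *)
Lemma Wd_dim D : finsupp D -> exists2 i,
  reldim (Wd D) (fun _ => True) i & i%:Z = (ell D)%:Z - deg D - 1 + g%:Z.
Proof.
move=> fD; have [N hN] := riemann_eq hcurve.
pose a := absz (N - deg D); have [c h e] := Wd_steps a fD.
have ha : N <= deg (D + pt P0 *+ a) by rewrite degDP0 // /a; lia.
have := hN _ (finsuppP0 a fD) ha; rewrite degDP0 // => ea.
exists c; last by lia.
suff -> : (fun _ => True) = Wd (D + pt P0 *+ a) by [].
apply/prop_eq => w; split=> // _.
pose b := absz (ord P0 w + D P0); have [c' h' e'] := Wd_steps b (finsuppP0 a fD).
have hb : N <= deg (D + pt P0 *+ a + pt P0 *+ b).
  by rewrite (degDP0 _ (finsuppP0 a fD)); apply: le_trans ha _; rewrite lerDl.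
have := hN _ (finsuppP0 b (finsuppP0 a fD)) hb.
rewrite (degDP0 b (finsuppP0 a fD)) degDP0 // => eb.
have c0 : c' = 0%N by lia.
move: h'; rewrite c0 => -[[|? ?] [//= _ _ <-]].
apply: Wd_loc; right; rewrite !(ptMnE, dD) eqxx /b; lia.
Qed.

Lemma Wd_mul D z w : z != 0 -> Wd D w -> Wd (D - div z) (z * w).
Proof.
move=> z0 [u hu hw]; exists (z * u).
  by move=> Q QP; rewrite vge_mulP // !dE /div opprB addrAC subrr add0r; apply: hu.
by rewrite -mulrDr vge_mulP // !dE /div opprB addrAC subrr add0r.
Qed.

Lemma Wd_mulE D z w : z != 0 -> Wd D w <-> Wd (D - div z) (z * w).
Proof.
move=> z0; split; first exact: Wd_mul.
have zV : z^-1 != 0 by rewrite invr_eq0.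
move=> /(Wd_mul zV); rewrite divV opprK subrK mulKf //.
Qed.

Lemma mreg_pole D u : mreg D u -> exists n, Ls (D + pt P0 *+ n) u.
Proof.
move=> h; exists (absz (ord P0 u + D P0)); apply/LsE; split.
  by move=> Q QP; rewrite dD ptMnE (negPf QP) addr0; apply: h.
right; rewrite dD ptMnE eqxx; lia.
Qed.

Lemma Ls_shift_mono D n m u : (n <= m)%N -> Ls (D + pt P0 *+ n) u -> Ls (D + pt P0 *+ m) u.
Proof. by move=> nm; apply: Ls_mono => P; rewrite !dD !ptMnE; case: eqP => _; lia. Qed.

(** Strong approximation at [Q]. Far along [P0], passing from $E - Q$ to [E] and from [K] to $K + Q$
    raises [ell] by the same amount, so the embedding of the first quotient in the second is
    onto. *)
Lemma mreg_cover K E Q : finsupp K -> finsupp E -> Q != P0 ->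
  (forall P, E P <= (K + pt Q) P) -> E Q = K Q + 1 ->
  forall u, mreg (K + pt Q) u -> exists2 v, mreg E v & mreg K (u + v).
Proof.
move=> fK fE QP EK EQ u hu; have [n hn] := mreg_pole hu.
have [N hN] := riemann_eq hcurve.
pose a := (n + `|N| + `|deg K| + `|deg E| + degp Q)%N.
have fQ := finsupp_pt Q.
pose sh D := D + pt P0 *+ a.
have dim D : finsupp D -> - (`|deg K|%N + `|deg E|%N + degp Q)%:Z <= deg D ->
    (ell (sh D))%:Z = deg D + a%:Z + 1 - g%:Z.
  move=> fD hD; have e : deg (sh D) = deg D + a%:Z by apply: degDP0.
  by rewrite (hN _ (finsuppP0 a fD)) -/(sh D) e // /a; lia.
have fEQ : finsupp (E - pt Q) by apply/finsuppD/finsuppN.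
have fKQ : finsupp (K + pt Q) by apply: finsuppD.
have good_sh D : finsupp D -> good (sh D) by move=> fD; apply/(goodE hcurve)/finsuppP0.
have shle D D' : (forall P, D P <= D' P) -> forall P, sh D P <= sh D' P.
  by move=> h P; rewrite /sh !(dD _ (pt P0 *+ a)) lerD2r.
have dEQ : deg (E - pt Q) = deg E - (degp Q)%:Z by rewrite degB // deg_pt.
have dKQ : deg (K + pt Q) = deg K + (degp Q)%:Z by rewrite degD // deg_pt.
have leEQ P : (E - pt Q) P <= E P by rewrite !dE; case: (P == Q); lia.
have leKQ P : K P <= (K + pt Q) P by rewrite !dE; case: (P == Q); lia.
have [e1 [h1 e1E _]] := ell_ext char2 hg (good_sh _ fEQ) (good_sh _ fE) (shle _ _ leEQ).
have [e2 [h2 e2E _]] := ell_ext char2 hg (good_sh _ fK) (good_sh _ fKQ) (shle _ _ leKQ).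
have e12 : e1 = e2.
  have := dim _ fEQ; have := dim _ fE; have := dim _ fK; have := dim _ fKQ.
  by rewrite dEQ dKQ; lia.
rewrite -e12 in h2.
have uK : Ls (sh (K + pt Q)) u by apply: Ls_shift_mono hn; rewrite /a; lia.
have iff x : Ls (sh E) x -> Ls (sh (E - pt Q)) x <-> Ls (sh K) x.
  move=> hx; split=> h P; have := h P; have := hx P; rewrite /sh !dE.
    by have := EK P; rewrite !dE; have [->|PQ] := eqVneq P Q; rewrite ?EQ => h1' _;
      apply: vgeW; lia.
  have [->|PQ] := eqVneq P Q; first by rewrite EQ => _; apply: vgeW; lia.
  by move=> h1' _; apply: vgeW h1'; lia.
have [v hv huv] := reldim_cover aff (Ls_sub _) (Ls_sub _) (Ls_sub _) (Ls_mono (shle _ _ EK))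
  iff (Ls_mono (shle _ _ leEQ)) h1 h2 uK.
exists v.
  by move=> R RP; have := hv R; rewrite /sh dD ptMnE (negPf RP) addr0.
by move=> R RP; have := huv R; rewrite /sh dD ptMnE (negPf RP) addr0.
Qed.

(** [K] has maximal degree among the divisors whose [Wd] is killed. If [Wd D] is killed and $D(Q) >
    K(Q)$, every element of [Wd (K + pt Q)] is a sum of elements of [Wd K] and [Wd D], so that $K +
    Q$ contradicts maximality. *)
Lemma functional_divisor lam D0 : functional lam -> (exists w, lam w) -> finsupp D0 ->
  kills lam (Wd D0) ->
  exists2 K, finsupp K & forall D, finsupp D -> kills lam (Wd D) <-> forall P, D P <= K P.
Proof.
move=> fl [w0 lw0] fD0 kD0; have [N hN] := riemann_eq hcurve.
have bound D : finsupp D -> kills lam (Wd D) -> deg D < N.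
  move=> fD kD; rewrite ltNge; apply/negP => /(hN D fD) eD.
  have [i hi ei] := Wd_dim fD; have i0 : i = 0%N by lia.
  move: hi; rewrite i0 => -[[|? ?] [//= _ _ e]].
  by move: lw0; rewrite kD // -e.
pose R k := `[< exists D, [/\ finsupp D, kills lam (Wd D) & deg D = deg D0 + k%:Z] >].
have exR : exists k, R k by exists 0%N; apply/asboolP; exists D0; rewrite addr0.
have bR k : R k -> (k <= absz (N - deg D0))%N.
  by move=> /asboolP[D [fD kD e]]; have := bound D fD kD; rewrite e; lia.
case: (ex_maxnP exR bR) => k /asboolP[K [fK kK eK]] mx; exists K => // D fD; split; last first.
  by move=> DK w /(Wd_mono DK); apply: kK.
move=> kD Q; rewrite leNgt; apply/negP => KQ.
have fKQ : finsupp (K + pt Q) by apply/finsuppD/finsupp_pt.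
suff kKQ : kills lam (Wd (K + pt Q)).
  have : R (k + degp Q)%N.
    apply/asboolP; exists (K + pt Q); split=> //.
    by rewrite degD ?deg_pt ?eK //; [lia | exact: finsupp_pt].
  by move/mx; have := degp_gt0 hcurve Q; lia.
move=> w [u hu hv]; have -> : w = (w + u) + u by rewrite (addKv aff).
have [QP|QP] := eqVneq Q P0.
  rewrite fl (kD (w + u)); last first.
    by apply: Wd_loc; apply: vgeW hv; rewrite QP !dE eqxx; rewrite QP in KQ; lia.
  by rewrite (kK u) //; apply: Wd_mreg; rewrite QP in hu; apply/mreg_P0.
rewrite fl (kK (w + u)); last first.
  by apply: Wd_loc; apply: vgeW hv; rewrite !dE eq_sym (negPf QP); lia.
(* Below [D], yet with the coefficient $K(Q)+1$ at [Q] that [mreg_cover] asks for. *)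
pose E : place F -> int := fun P => Num.min (D P) ((K + pt Q) P).
have fE : finsupp E.
  have [s [_ h1 h2]] := finsupp2 fD fKQ; exists s => P; rewrite /E => hP.
  have [/eqP DP|] := boolP (D P == 0); last exact: h1.
  by apply: h2; apply: contraNneq hP => KP; rewrite DP KP minxx.
have [||v hv1 hv2] := @mreg_cover K E Q fK fE QP _ _ u hu.
- by move=> P; rewrite /E ge_min lexx orbT.
- by rewrite /E !dE eqxx; apply/min_idPr; lia.
have -> : u = (u + v) + v by rewrite (addKv aff).
rewrite fl (kK (u + v)); last exact: Wd_mreg.
rewrite (kD v) //; apply: Wd_mreg => R' R'P; apply: vgeW (hv1 R' R'P).
by rewrite lerN2 /E ge_min lexx.
Qed.

Lemma Wd_functional_ex D i : reldim (Wd D) (fun _ => True) i -> (0 < i)%N ->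
  exists lam, [/\ functional lam, kills lam (Wd D) & exists w, lam w].
Proof.
move=> hi i0; have [|lam [h1 h2 h3]] := @functional_avoid _ aff _ [:: tt]
    (fun _ (_ : F) => false) _ i (Wd_sub D) hi.
  by rewrite /= -[1%N](expn0 2) ltn_exp2l.
exists lam; split=> //; apply: contrapT => nw; apply: (h3 tt); first by rewrite inE.
by move=> w; apply/esym/negP => lw; apply: nw; exists w.
Qed.

Definition twist (lam : F -> bool) (z : F) : F -> bool := fun w => lam (z * w).

Lemma twist_functional lam z : functional lam -> functional (twist lam z).
Proof. by move=> h x y; rewrite /twist mulrDr h. Qed.

Lemma Ls_list D : finsupp D -> exists s, [/\ uniq s, size s = (2 ^ ell D)%N & forall x, x \in s <-> Ls D x].
Proof. by move=> fD; apply: (reldim_list aff (ellP char2 hg (goodE hcurve fD))). Qed.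

Section Canonical.
Variables (lam : F -> bool) (K : place F -> int).
Hypotheses (fl : functional lam) (nl : exists w, lam w) (fK : finsupp K).
Hypothesis hK : forall D, finsupp D -> kills lam (Wd D) <-> forall P, D P <= K P.

(** Twisting by [z] translates the divisor of the functional from [K] to [K + div z]. *)
Lemma twist_kills D z : finsupp D -> z != 0 -> kills (twist lam z) (Wd D) <-> Ls (K - D) z.
Proof.
move=> fD z0; have fDz : finsupp (D - div z) by apply/finsuppD/finsuppN/(div_finsupp hcurve).
apply: (@iff_trans _ (kills lam (Wd (D - div z)))).
  split=> h w hw.
    have := h (z^-1 * w); rewrite /twist mulVKf //; apply.
    by apply/(Wd_mulE D _ z0); rewrite mulVKf.
  by rewrite /twist; apply: h; apply/(Wd_mulE D w z0).
by apply: (iff_trans (hK fDz)); split=> h P; have := h P; rewrite vgeP // !dE /div; lia.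
Qed.

Lemma twist_kills_Ls D z : finsupp D -> Ls (K - D) z -> kills (twist lam z) (Wd D).
Proof.
move=> fD hz; have [->|z0] := eqVneq z 0; last by apply/twist_kills.
by move=> w _; rewrite /twist mul0r functional0.
Qed.

Lemma twist_inj z z' : twist lam z =1 twist lam z' -> z = z'.
Proof.
move=> e; apply: (addvv_eq0 aff); apply/eqP; apply: contraT => n0.
case: nl => w; have := e ((z + z')^-1 * w); rewrite /twist => e'.
have : twist lam (z + z') ((z + z')^-1 * w) = false.
  by rewrite /twist mulrDl fl e' addbb.
by rewrite /twist mulVKf // => ->.
Qed.

(** Twisting embeds $L(K-D)$ in the dual of [F / Wd D]. *)
Lemma canonical_le D i : finsupp D -> reldim (Wd D) (fun _ => True) i -> (ell (K - D)%R <= i)%N.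
Proof.
move=> fD hi; have [s [us ss hs]] := Ls_list (finsuppD fK (finsuppN fD)).
rewrite -(leq_exp2l _ _ (ltnSn 1)) -ss.
apply: (functional_count aff (phi := twist lam) (Wd_sub D) hi us).
  by move=> z /hs hz; split; [exact: twist_functional | exact: twist_kills_Ls].
by move=> z z' _ _; apply: twist_inj.
Qed.

End Canonical.

(* If [deg K] were smaller, some functional [lam1] would not be a multiple of [lam]; the multiples of
   [lam] and of [lam1] together would then be too many to annihilate a large negative divisor. *)
Lemma canonical_deg lam K : functional lam -> (exists w, lam w) -> finsupp K ->
  (forall D, finsupp D -> kills lam (Wd D) <-> forall P, D P <= K P) ->
  2 * g%:Z - 2 <= deg K.
Proof.
move=> fl nl fK hK; rewrite leNgt; apply/negP => dK.
have [N hN] := riemann_eq hcurve.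
pose B n : place F -> int := - (pt P0 *+ n).
have fB n : finsupp (B n) by apply/finsuppN/finsuppMn/finsupp_pt.
have dB n : deg (B n) = - n%:Z by rewrite degN ?(deg_P0 hcurve) //; apply/finsuppMn/finsupp_pt.
have idx n : (0 < n)%N -> exists2 i, reldim (Wd (B n)) (fun _ => True) i & i%:Z = n%:Z - 1 + g%:Z.
  move=> n0; have [i hi e] := Wd_dim (fB n); exists i => //.
  by rewrite e (ell_neg hcurve) ?dB //; lia.
have ellB D n : finsupp D -> N <= deg D + n%:Z -> (ell (D - B n))%:Z = deg D + n%:Z + 1 - g%:Z.
  move=> fD h; have e : deg (D - B n) = deg D + n%:Z by rewrite degB // dB opprK.
  by rewrite hN ?e //; apply: finsuppD => //; apply: finsuppN.
pose b := (absz (N - deg K)).+1.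
have [i hi ei] := idx b isT.
have [s [us ss hs]] := Ls_list (finsuppD fK (finsuppN (fB b))).
have [|lam1 [fl1 kl1 nt]] := functional_avoid aff (L := s) (twist lam) (Wd_sub _) hi.
  rewrite ss ltn_exp2l //; have := ellB K b fK; rewrite /b; lia.
have nl1 : exists w, lam1 w.
  apply: contrapT => nw; apply: (nt 0); first by apply/hs; case: (Ls_sub (K - B b)).
  move=> w; rewrite /twist mul0r functional0 //; apply/esym/negP => lw; apply: nw; by exists w.
have [K1 fK1 hK1] := functional_divisor fl1 nl1 (fB b) kl1.
(* From [hb3] on, the $2^{\deg K + \deg K_1 + 2b' + 2 - 2g}$ pairs outnumber the $2^{b'-1+g}$
   functionals that kill [Wd (B b')]. *)
pose b' := (b + absz (N - deg K1)%R + absz (3 * g%:Z - deg K - deg K1)%R)%N.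
have hb1 : N <= deg K + b'%:Z by rewrite /b' /b; lia.
have hb2 : N <= deg K1 + b'%:Z by rewrite /b' /b; lia.
have hb3 : 3 * g%:Z - deg K - deg K1 <= b'%:Z by rewrite /b' /b; lia.
have b'0 : (0 < b')%N by rewrite /b' /b.
clearbody b'; have [//|i' hi' ei'] := idx b'.
have [s0 [us0 ss0 hs0]] := Ls_list (finsuppD fK (finsuppN (fB b'))).
have [s1 [us1 ss1 hs1]] := Ls_list (finsuppD fK1 (finsuppN (fB b'))).
pose phi (z : F * F) w := twist lam z.1 w (+) twist lam1 z.2 w.
have : (size [seq (x, y) | x <- s0, y <- s1] <= 2 ^ i')%N.
  apply: (functional_count aff (phi := phi) (Wd_sub _) hi').
  - by rewrite allpairs_uniq // => -[? ?] [? ?] _ _ [-> ->].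
  - move=> _ /allpairsP[[x y] [/hs0 hx /hs1 hy ->]]; split.
      by move=> u v; rewrite /phi !twist_functional // addbACA.
    by move=> w hw; rewrite /phi (twist_kills_Ls fl hK (fB b') hx) // (twist_kills_Ls fl1 hK1 (fB b') hy).
  move=> [x y] [x' y'] _ _ e; rewrite /phi /= in e.
  have e2 w : twist lam (x + x') w = twist lam1 (y + y') w.
    have := e w; rewrite /twist !mulrDl fl fl1.
    by case: (lam _); case: (lam _); case: (lam1 _); case: (lam1 _).
  have [yy|yy] := eqVneq (y + y') 0.
    have xx : x + x' = 0.
      by apply: (twist_inj fl nl) => w; rewrite e2 yy /twist !mul0r !functional0.
    by rewrite (addvv_eq0 aff xx) (addvv_eq0 aff yy).
  exfalso; pose z := (x + x') / (y + y').
  have ez w : twist lam z w = lam1 w.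
    have := e2 ((y + y')^-1 * w); rewrite /twist mulVKf // => <-.
    by rewrite /z -mulrA.
  have z0 : z != 0.
    apply/eqP => z0; case: nl1 => w; rewrite -ez /twist z0 mul0r functional0 //.
  apply: (nt z); last exact: ez.
  by apply/hs/(twist_kills hK (fB b) z0) => w /kl1; rewrite ez.
rewrite size_allpairs ss0 ss1 -expnD leq_exp2l //.
have := ellB K b' fK hb1; have := ellB K1 b' fK1 hb2; lia.
Qed.

(** The inequality of [canonical_le] at [D] and at $K - D$ leaves a total slack of $2g - 2 - \deg
    K$, which [canonical_deg] makes nonpositive; so both are equalities. *)
Theorem riemann_roch : exists2 K, finsupp K /\ deg K = 2 * g%:Z - 2 &
  forall D, finsupp D -> (ell D)%:Z = deg D + 1 - g%:Z + (ell (K - D))%:Z.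
Proof.
pose D0 : place F -> int := - (pt P0 *+ 2).
have fD0 : finsupp D0 by apply/finsuppN/finsuppMn/finsupp_pt.
have dD0 : deg D0 = - 2 by rewrite degN ?(deg_P0 hcurve) //; apply/finsuppMn/finsupp_pt.
have [i0 hi0 ei0] := Wd_dim fD0.
have [|lam [fl kl nl]] := Wd_functional_ex hi0; first by lia.
have [K fK hK] := functional_divisor fl nl fD0 kl.
have dK := canonical_deg fl nl fK hK.
have half D : finsupp D -> (ell (K - D))%:Z <= (ell D)%:Z - deg D - 1 + g%:Z.
  by move=> fD; have [i hi <-] := Wd_dim fD; rewrite lez_nat; apply: (canonical_le fl nl fK hK fD hi).
have half' D : finsupp D -> (ell D)%:Z <= (ell (K - D))%:Z - (deg K - deg D) - 1 + g%:Z.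
  move=> fD; have fKD := finsuppD fK (finsuppN fD).
  by have := half _ fKD; rewrite degB // opprB addrCA subrr addr0.
exists K; first split=> //.
  by have := half 0 (finsupp0 F); have := half' 0 (finsupp0 F); rewrite deg0; lia.
by move=> D fD; have := half D fD; have := half' D fD; lia.
Qed.
End Duality.

(** * Counting effective divisors *)

Section ClassSums.
Variables (F : fieldType) (g : nat) (P0 : place F).
Hypothesis hcurve : pointed_curve g P0.
Let char2 : (2%:R : F) = 0. Proof. by case: hcurve. Qed.
Implicit Types (P Q : place F) (D E G K : place F -> int).

Definition lineq D E : Prop := exists2 x : F, x != 0 & D = E + div x.

Lemma divM (x y : F) : x != 0 -> y != 0 -> div (x * y) = div x + div y.
Proof. by move=> x0 y0; apply/funext => P; rewrite dD /div ordM. Qed.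

Lemma lineq_sym D E : lineq D E -> lineq E D.
Proof.
move=> [x x0 ->]; exists x^-1; first by rewrite invr_eq0.
by rewrite divV addrK.
Qed.
Lemma lineq_trans D E G : lineq D E -> lineq E G -> lineq D G.
Proof.
move=> [x x0 ->] [y y0 ->]; exists (y * x); first by rewrite mulf_neq0.
by rewrite divM // addrA.
Qed.
Lemma lineqD D E G : lineq D E -> lineq (D + G) (E + G).
Proof. by move=> [x x0 ->]; exists x => //; rewrite addrAC. Qed.

Variable h : nat.

Definition class_reps (R : 'I_h -> place F -> int) : Prop :=
  [/\ forall i, finsupp (R i), forall i, deg (R i) = 0,
      forall i j, lineq (R i) (R j) -> i = j
    & forall D, finsupp D -> deg D = 0 -> exists i, lineq D (R i)].

Lemma lin_equivP (D E : divisor F) : lin_equiv D E <-> lineq (dv D) (dv E).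
Proof.
split=> [[x [x0 e]]|[x x0 e]]; exists x => //; first by apply/funext => P; rewrite dD /div e.
by split=> // P; rewrite e.
Qed.

Lemma finsupp_dv (D : divisor F) : finsupp (dv D).
Proof. by case: D => D [s hs]; exists s => P /eqP/hs/InP. Qed.

Lemma to_divisor D : finsupp D -> exists D' : divisor F, dv D' = D.
Proof.
move=> [s hs]; have hs' : exists s, forall P, D P <> 0 -> List.In P s.
  by exists s => P /eqP/hs/InP.
by exists (exist _ D hs').
Qed.

Lemma dv_inj : injective (@dv F).
Proof.
move=> [D hD] [E hE]; rewrite /dv /= => e; have {}e : D = E := e; subst E.
by congr exist; apply: Prop_irrelevance.
Qed.

Lemma nth_error_nth (T : Type) (x0 : T) (s : seq T) i :
  (i < size s)%N -> List.nth_error s i = Some (nth x0 s i).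
Proof. by elim: s i => //= a s IH [|i] //= /IH. Qed.

Lemma class_reps_exist : class_number F h -> exists R, class_reps R.
Proof.
move=> [s [sh hdeg hne hall]].
have [D0 _] := to_divisor (finsupp0 F).
exists (fun i => dv (nth D0 s i)).
have mem i : (i < h)%N -> List.In (nth D0 s i) s.
  by rewrite -sh => ih; apply/InP; apply: mem_nth.
split=> [i|i|i j|D fD dD].
- exact: finsupp_dv.
- by have /(div_degP char2)[] := hdeg _ (mem i (ltn_ord i)).
- move=> e; apply: contrapT => ij.
  apply: (hne i j (ltn_ord i) (ltn_ord j) _ (nth D0 s i) (nth D0 s j)).
  + by move=> e2; apply: ij; apply: val_inj.
  + by apply: nth_error_nth; rewrite sh.
  + by apply: nth_error_nth; rewrite sh.
  + exact/lin_equivP.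
have [D' eD] := to_divisor fD.
have [|E [/InP Es /lin_equivP e]] := hall D'.
  by apply/(div_degP char2); rewrite eD; split=> //; apply: goodE hcurve _ fD.
have ih : (index E s < h)%N by rewrite -sh index_mem.
by exists (Ordinal ih); rewrite /= nth_index // -eD.
Qed.

Variable R : 'I_h -> place F -> int.
Hypothesis hR : class_reps R.

(** A class with [ell] equal to $l$ contains $2^l - 1$ effective divisors, 1 being the only nonzero
    constant. The sum is thus the number of effective divisors of degree [deg E], plus [h]. *)
Definition Tsum E : nat := \sum_(i < h) 2 ^ ell (R i + E)%R.

Lemma ell_lineq D E : finsupp E -> lineq D E -> ell D = ell E.
Proof. by move=> fE [x x0 ->]; rewrite (ell_div hcurve) //; apply: goodE hcurve _ fE. Qed.

(** An injection of a set of [h] classes into itself is onto, so any [h] inequivalent divisors of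
    degree 0 can replace the [R i]; translates and negatives of the [R i] are used. *)
Lemma Tsum_reps (S : 'I_h -> place F -> int) E : (forall i, finsupp (S i)) ->
  (forall i, deg (S i) = 0) -> (forall i j, lineq (S i) (S j) -> i = j) -> finsupp E ->
  (\sum_(i < h) 2 ^ ell (S i + E)%R)%N = Tsum E.
Proof.
case: hR => fR dR iR aR fS dS iS fE.
have /choice[s hs] : forall i, exists j, lineq (S i) (R j) by move=> i; apply: aR.
have injs : injective s.
  move=> i j e; apply: iS; apply: lineq_trans (hs i) _; rewrite e; exact: lineq_sym (hs j).
rewrite /Tsum [RHS](reindex s) /=; last by apply: onW_bij; apply: injF_bij.
apply: eq_bigr => i _; congr (2 ^ _)%N; apply: ell_lineq; first exact: finsuppD.
exact: (lineqD E (hs i)).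
Qed.

Lemma Tsum_deg E E' : finsupp E -> finsupp E' -> deg E = deg E' -> Tsum E = Tsum E'.
Proof.
case: (hR) => fR dR iR aR fE fE' e.
rewrite -(@Tsum_reps (fun i => R i + (E - E')) E').
- by apply: eq_bigr => i _; rewrite -addrA subrK.
- by move=> i; apply/finsuppD/finsuppD/finsuppN.
- by move=> i; rewrite degD ?dR ?degB ?e ?subrr //; apply/finsuppD/finsuppN.
- by move=> i j /(lineqD (E' - E)); rewrite -[E' - E]opprB !addrK; apply: iR.
- by [].
Qed.

Definition effn (n : nat) : nat := (Tsum (pt P0 *+ n)%R - h)%N.

Lemma Tsum_ge E : (h <= Tsum E)%N.
Proof.
rewrite /Tsum -[X in (X <= _)%N]card_ord -sum1_card; apply: leq_sum => i _.
by rewrite expn_gt0.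
Qed.

Lemma effnE n : (effn n + h)%N = Tsum (pt P0 *+ n).
Proof. by rewrite subnK // Tsum_ge. Qed.

Lemma Tsum_neg E : finsupp E -> deg E < 0 -> Tsum E = h.
Proof.
case: (hR) => fR dR _ _ fE dE0; rewrite /Tsum (eq_bigr (fun=> 1%N)); first by rewrite sum1_card card_ord.
move=> i _; rewrite (ell_neg hcurve) //; first exact: finsuppD.
by rewrite degD // dR add0r.
Qed.

(** The involution that sends a divisor [D] to $K - D$ permutes the classes, and Riemann-Roch lowers
    every [ell] by the same [j]. *)
Lemma Tsum_dual K E (j : nat) : finsupp K -> deg K = 2 * g%:Z - 2 ->
  (forall D, finsupp D -> (ell D)%:Z = deg D + 1 - g%:Z + (ell (K - D))%:Z) ->
  finsupp E -> deg E + 1 - g%:Z = j%:Z -> Tsum E = (2 ^ j * Tsum (K - E)%R)%N.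
Proof.
case: (hR) => fR dR iR aR fK dK rr fE ej.
rewrite -(@Tsum_reps (fun i => - R i) (K - E)).
- rewrite /Tsum big_distrr /=; apply: eq_bigr => i _; rewrite -expnD; congr (2 ^ _)%N.
  have := rr (R i + E) (finsuppD (fR i) fE); rewrite degD // dR add0r ej => e.
  apply/eqP; rewrite -eqz_nat e PoszD; apply/eqP; congr (_ + Posz (ell _)).
  by rewrite opprD addrCA addrA addrAC addrC addrA.
- by move=> i; apply: finsuppN.
- by move=> i; rewrite degN // dR oppr0.
- move=> i k [x x0 e]; apply/esym/iR; exists x => //.
  by rewrite -[R k]opprK -[R i]opprK e opprD opprK addrNK.
- exact/finsuppD/finsuppN.
Qed.

Lemma effn_dual j : (0 < g)%N -> (effn (g.-1 + j) + h =
  2 ^ j * (if (j < g)%N then effn (g.-1 - j) + h else h))%N.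
Proof.
move=> g0; have [K [fK dK] rr] := riemann_roch hcurve.
have fP n : finsupp (pt P0 *+ n) by apply/finsuppMn/finsupp_pt.
rewrite effnE (@Tsum_dual K _ j) //; last by rewrite (deg_P0 hcurve); lia.
congr (_ * _)%N; have fKP n : finsupp (K - pt P0 *+ n) by apply/finsuppD/finsuppN.
have dKP n : deg (K - pt P0 *+ n) = 2 * g%:Z - 2 - n%:Z.
  by rewrite degB // dK (deg_P0 hcurve).
have [jg|jg] := ltnP j g; last by rewrite Tsum_neg // dKP; lia.
by rewrite effnE; apply: Tsum_deg => //; rewrite dKP (deg_P0 hcurve); lia.
Qed.

(** The case of a single class: the indices name the removed points and the numbers are the
    remaining dimensions. If some point is a base point, the terms cancel in pairs; otherwise each
    first removal halves $2^a$, and a second one halves again or changes nothing. *)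
Lemma incl_excl_nat (a a1 a2 a3 a12 a13 a23 a123 : nat) :
  (a1 <= a <= a1.+1)%N -> (a2 <= a <= a2.+1)%N -> (a3 <= a <= a3.+1)%N ->
  (a12 <= a1 <= a12.+1)%N -> (a13 <= a1 <= a13.+1)%N -> (a23 <= a2 <= a23.+1)%N ->
  (a12 <= a2)%N -> (a13 <= a3)%N -> (a23 <= a3)%N ->
  (a123 <= a12)%N -> (a123 <= a13)%N -> (a123 <= a23)%N ->
  (a1 = a -> [/\ a12 = a2, a13 = a3 & a123 = a23]) ->
  (a2 = a -> [/\ a12 = a1, a23 = a3 & a123 = a13]) ->
  (a3 = a -> [/\ a13 = a1, a23 = a2 & a123 = a12]) ->
  (2 ^ a1 + 2 ^ a2 + 2 ^ a3 + 2 ^ a123 <= 2 ^ a + 2 ^ a12 + 2 ^ a13 + 2 ^ a23)%N.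
Proof.
move=> h1 h2 h3 h12 h13 h23 l1 l2 l3 m1 m2 m3 e1 e2 e3.
have [ea|n1] := eqVneq a1 a; first by have [-> -> ->] := e1 ea; rewrite ea; lia.
have [ea|n2] := eqVneq a2 a; first by have [-> -> ->] := e2 ea; rewrite ea; lia.
have [ea|n3] := eqVneq a3 a; first by have [-> -> ->] := e3 ea; rewrite ea; lia.
have -> : a = a1.+1 by lia.
have -> : a2 = a1 by lia.
have -> : a3 = a1 by lia.
have le x y : (x <= y)%N -> (2 ^ x <= 2 ^ y)%N by move=> xy; rewrite leq_exp2l.
have half x y : (x <= y <= x.+1)%N -> (2 ^ y = 2 ^ x \/ 2 ^ y = 2 * 2 ^ x)%N.
  move=> xy; have [->|->] : y = x \/ y = x.+1 by lia.
    by left.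
  by right; rewrite expnS.
have := le _ _ m1; have := le _ _ m2; have := le _ _ m3; rewrite expnS.
have k12 := half a12 a1 h12; have k13 := half a13 a1 h13.
have /half k23 : (a23 <= a1 <= a23.+1)%N by lia.
by case: k12; case: k13; case: k23; lia.
Qed.

End ClassSums.

(** * Effective divisors and inclusion-exclusion *)

Section EffectiveDivisors.
Variables (F : fieldType) (g : nat) (P0 : place F).
Hypothesis hcurve : pointed_curve g P0.
Let char2 : (2%:R : F) = 0. Proof. by case: hcurve. Qed.
Let fcf : full_constant_field_F2 F. Proof. by case: hcurve. Qed.
Let hg : is_genus F g. Proof. by case: hcurve. Qed.
Let aff := addff char2.
Variables (h : nat) (R : 'I_h -> place F -> int).
Hypothesis hR : class_reps R.
Implicit Types (P Q : place F) (D E G K : place F -> int).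
Local Notation effn := (effn P0 R).

Lemma ell_pt D Q : finsupp D -> degp Q = 1%N ->
  (ell (D - pt Q)%R <= ell D <= (ell (D - pt Q)%R).+1)%N.
Proof.
move=> fD dQ; have fDQ : finsupp (D - pt Q) by apply/finsuppD/finsuppN/finsupp_pt.
have [|e [_ -> he]] := ell_ext char2 hg (goodE hcurve fDQ) (goodE hcurve fD).
  by move=> P; rewrite !dE; case: (P == Q); lia.
by move: he; rewrite degB ?deg_pt ?dQ //; [lia | exact: finsupp_pt].
Qed.

(** A base point [Q] of [D] stays one for $D - G$ when the effective [G] avoids [Q]. *)
Lemma ell_drop D Q G : finsupp D -> ell (D - pt Q) = ell D -> eff G -> G Q = 0 ->
  ell (D - G - pt Q) = ell (D - G).
Proof.
move=> fD e eG GQ; have fDQ : finsupp (D - pt Q) by apply/finsuppD/finsuppN/finsupp_pt.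
have eL : Ls (D - pt Q) = Ls D.
  have h1 := ellP char2 hg (goodE hcurve fDQ); rewrite e in h1.
  apply: (reldim_eq aff (zsub_sub F) h1 (ellP char2 hg (goodE hcurve fD))).
  by apply: Ls_mono => P; rewrite !dE; case: (P == Q); lia.
suff -> : Ls (D - G - pt Q) = Ls (D - G) -> ell (D - G - pt Q) = ell (D - G).
  by [].
- apply/prop_eq => x; split; first by apply: Ls_mono => P; rewrite !dE; case: (P == Q); lia.
  move=> hx P; have := hx P; rewrite !dE; have [->|PQ] := eqVneq P Q; last by rewrite subr0.
  move=> _; have : Ls (D - pt Q) x.
    by rewrite eL; apply: Ls_mono hx => S; rewrite !dE; have := eG S; lia.
  by move=> /(_ Q); rewrite !dE eqxx GQ subr0.
by rewrite /ell => ->.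
Qed.

Lemma Tsum_incl_excl E P1 P2 P3 : finsupp E -> P1 != P2 -> P1 != P3 -> P2 != P3 ->
  degp P1 = 1%N -> degp P2 = 1%N -> degp P3 = 1%N ->
  (Tsum R (E - pt P1)%R + Tsum R (E - pt P2)%R + Tsum R (E - pt P3)%R
     + Tsum R (E - pt P1 - pt P2 - pt P3)%R <=
   Tsum R E + Tsum R (E - pt P1 - pt P2)%R + Tsum R (E - pt P1 - pt P3)%R
     + Tsum R (E - pt P2 - pt P3)%R)%N.
Proof.
move=> fE n12 n13 n23 d1 d2 d3; rewrite /Tsum -!big_split /=; apply: leq_sum => i _.
have fD : finsupp (R i + E) by case: hR => fR _ _ _; apply: finsuppD.
rewrite !addrA; move: (R i + E) fD => D fD.
have f Q D' : finsupp D' -> finsupp (D' - pt Q) by move=> f; apply/finsuppD/finsuppN/finsupp_pt.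
have ef Q : eff (pt Q) by move=> P; rewrite ptE; case: (P == Q).
have ac Q Q' D' : D' - pt Q - pt Q' = D' - pt Q' - pt Q by rewrite addrAC.
have pt0 Q Q' : Q != Q' -> pt Q Q' = 0 by rewrite ptE eq_sym => /negPf ->.
have n21 : P2 != P1 by rewrite eq_sym.
have n31 : P3 != P1 by rewrite eq_sym.
have n32 : P3 != P2 by rewrite eq_sym.
have eff2 Q Q' : eff (pt Q + pt Q') by move=> P; rewrite dD addr_ge0 // ef.
have two Q Q' D' : D' - (pt Q + pt Q') = D' - pt Q - pt Q' by rewrite opprD addrA.
have e123 : D - pt P1 - pt P2 - pt P3 = D - pt P2 - pt P3 - pt P1.
  by rewrite (addrAC D) (addrAC (D - pt P2)).
apply: incl_excl_nat.
- exact: ell_pt.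
- exact: ell_pt.
- exact: ell_pt.
- by apply: ell_pt => //; apply: f.
- by apply: ell_pt => //; apply: f.
- by apply: ell_pt => //; apply: f.
- by rewrite ac; have /andP[] := @ell_pt (D - pt P2) P1 (f _ _ fD) d1.
- by rewrite ac; have /andP[] := @ell_pt (D - pt P3) P1 (f _ _ fD) d1.
- by rewrite ac; have /andP[] := @ell_pt (D - pt P3) P2 (f _ _ fD) d2.
- by have /andP[] := @ell_pt (D - pt P1 - pt P2) P3 (f _ _ (f _ _ fD)) d3.
- by rewrite ac; have /andP[] := @ell_pt (D - pt P1 - pt P3) P2 (f _ _ (f _ _ fD)) d2.
- rewrite e123.
  by have /andP[] := @ell_pt (D - pt P2 - pt P3) P1 (f _ _ (f _ _ fD)) d1.
- move=> e; split.
  + by rewrite ac (ell_drop fD e (ef P2) (pt0 _ _ n21)).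
  + by rewrite ac (ell_drop fD e (ef P3) (pt0 _ _ n31)).
  + rewrite e123 -(two P2 P3 D) (ell_drop fD e (eff2 P2 P3)) //.
    by rewrite dD !pt0.
- move=> e; split.
  + by rewrite (ell_drop fD e (ef P1) (pt0 _ _ n12)).
  + by rewrite ac (ell_drop fD e (ef P3) (pt0 _ _ n32)).
  + rewrite ac -(two P1 P3 D) (ell_drop fD e (eff2 P1 P3)) //.
    by rewrite dD !pt0.
- move=> e; split.
  + by rewrite (ell_drop fD e (ef P1) (pt0 _ _ n13)).
  + by rewrite (ell_drop fD e (ef P2) (pt0 _ _ n23)).
  + rewrite -(two P1 P2 D) (ell_drop fD e (eff2 P1 P2)) //.
    by rewrite dD !pt0.
Qed.

Lemma effn_incl_excl n P1 P2 P3 : P1 != P2 -> P1 != P3 -> P2 != P3 ->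
  degp P1 = 1%N -> degp P2 = 1%N -> degp P3 = 1%N ->
  (3 * effn n.+2 + effn n <= effn n.+3 + 3 * effn n.+1)%N.
Proof.
move=> n12 n13 n23 d1 d2 d3.
have fP k : finsupp (pt P0 *+ k) by apply/finsuppMn/finsupp_pt.
have f Q D : finsupp D -> finsupp (D - pt Q) by move=> fD; apply/finsuppD/finsuppN/finsupp_pt.
have dg Q D : finsupp D -> degp Q = 1%N -> deg (D - pt Q) = deg D - 1.
  by move=> fD dQ; rewrite degB ?deg_pt ?dQ //; apply: finsupp_pt.
have T k D : finsupp D -> deg D = k%:Z -> Tsum R D = (effn k + h)%N.
  by move=> fD dD; rewrite effnE; apply: (Tsum_deg hcurve hR) => //; rewrite dD (deg_P0 hcurve).
have := Tsum_incl_excl (fP n.+3) n12 n13 n23 d1 d2 d3.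
have dn := deg_P0 hcurve n.+3.
set E := pt P0 *+ n.+3 in dn *; have fE : finsupp E := fP _.
have S1 Q : degp Q = 1%N -> Tsum R (E - pt Q) = (effn n.+2 + h)%N.
  by move=> dQ; apply: T; [exact: f | rewrite dg // dn; lia].
have S2 Q Q' : degp Q = 1%N -> degp Q' = 1%N ->
    Tsum R (E - pt Q - pt Q') = (effn n.+1 + h)%N.
  by move=> dQ dQ'; apply: T; [exact/f/f | rewrite !dg ?dn //; try lia; do ?apply: f].
have S3 : Tsum R (E - pt P1 - pt P2 - pt P3) = (effn n + h)%N.
  apply: T; first exact/f/f/f.
  rewrite (dg P3 _ (f P2 _ (f P1 _ fE)) d3) (dg P2 _ (f P1 _ fE) d2) (dg P1 _ fE d1) dn; lia.
by rewrite (T n.+3 E fE dn) !S1 // !S2 // S3; lia.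
Qed.

Lemma div_inj (z w : F) : z != 0 -> w != 0 -> div z = div w -> z = w.
Proof.
move=> z0 w0 e; have wV : w^-1 != 0 by rewrite invr_eq0.
have : F2c (z / w).
  apply: (Ls0_const char2 fcf hg) => P; rewrite d0 oppr0; right; rewrite ordM // ordV.
  by have := congr1 (fun f => f P) e; rewrite /div => ->; rewrite subrr.
case=> [/eqP|e1]; first by rewrite mulf_eq0 (negPf z0) (negPf wV).
by rewrite -[z](mulfVK w0) e1 mul1r.
Qed.

(** Justifies [effn]. Each effective divisor of degree [n] is $R_i + nP_0 + \mathrm{div}\, z$ for
    one class [i] and one nonzero [z], which is unique because 1 is the only nonzero constant. *)
Lemma effn_list n : exists L : seq (place F -> int), [/\ uniq L, size L = effn n &
  forall D, D \in L <-> [/\ finsupp D, eff D & deg D = n%:Z]].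
Proof.
case: (hR) => fR dR iR aR; have fP k : finsupp (pt P0 *+ k) by apply/finsuppMn/finsupp_pt.
have fE i : finsupp (R i + pt P0 *+ n) by apply: finsuppD.
have /choice[s hs] : forall i, exists s, [/\ uniq s, size s = (2 ^ ell (R i + pt P0 *+ n)%R)%N &
    forall x, x \in s <-> Ls (R i + pt P0 *+ n) x].
  by move=> i; apply: (Ls_list hcurve).
pose t i := rem 0 (s i).
have ht i x : x \in t i <-> x != 0 /\ Ls (R i + pt P0 *+ n) x.
  have [us _ hsx] := hs i; rewrite mem_rem_uniq // inE.
  by split=> [/andP[x0 /hsx]|[x0 /hsx xs]] //; apply/andP.
have ut i : uniq (t i) by have [us _ _] := hs i; apply: rem_uniq.
have st i : (size (t i)).+1 = (2 ^ ell (R i + pt P0 *+ n)%R)%N.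
  have [us <- hsx] := hs i; rewrite size_rem ?prednK //; last first.
    by apply/hsx; case: (Ls_sub (R i + pt P0 *+ n)).
  by rewrite lt0n; apply/eqP => /size0nil e; have := hsx 0; rewrite e => -[_]; case: (Ls_sub (R i + pt P0 *+ n)) => h0 _ /(_ h0).
pose L := [seq R i + pt P0 *+ n + div z | i <- enum 'I_h, z <- t i].
exists L; split.
- apply: allpairs_uniq_dep; [exact: enum_uniq | by move=> i _ |].
  move=> [i z] [j w] /allpairsPdep[i' [z' [_ /ht[z0 _] [-> ->]]]].
  move=> /allpairsPdep[j' [w' [_ /ht[w0 _] [-> ->]]]] /= e.
  have ij : i' = j'.
    apply: iR; exists (w' / z'); first by rewrite mulf_neq0 ?invr_eq0.
    rewrite divM ?invr_eq0 // divV.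
    by apply/funext => P; have := congr1 (fun f => f P) e; rewrite !dD dN; lia.
  subst j'; congr (existT _ _ _); apply: (div_inj z0 w0).
  by apply/funext => P; have := congr1 (fun f => f P) e; rewrite !dD; lia.
- rewrite size_allpairs_dep sumnE big_map big_enum /=; apply/eqP.
  rewrite -(eqn_add2r h) effnE /Tsum; apply/eqP.
  rewrite -[X in (_ + X)%N]card_ord -sum1_card -big_split /=.
  by apply: eq_bigr => i _; rewrite addn1 st.
move=> D; split.
  move=> /allpairsPdep[i [z [_ /ht[z0 hz] ->]]]; split.
  - exact/finsuppD/(div_finsupp hcurve).
  - by move=> P; have := hz P; rewrite vgeP // (dD (R i + pt P0 *+ n)) /div; lia.
  - rewrite degD ?(deg_div hcurve) ?addr0 ?degD ?dR ?add0r ?(deg_P0 hcurve) //.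
    exact: (div_finsupp hcurve).
move=> [fD eD hdeg]; have [||i [x x0 e]] := aR (D - pt P0 *+ n).
- exact/finsuppD/finsuppN.
- by rewrite degB // hdeg (deg_P0 hcurve) subrr.
have e2 : D = R i + pt P0 *+ n + div x by rewrite addrAC -e subrK.
apply/allpairsPdep; exists i, x; split=> //; first by rewrite mem_enum.
apply/ht; split=> // P; have := eD P; rewrite vgeP // e2 (dD (R i + pt P0 *+ n)) /div; lia.
Qed.
End EffectiveDivisors.

(** The finiteness behind this choice is proved in [places_leP], from the finite lists of effective
    divisors. *)
Definition places_le (F : fieldType) (n : nat) : seq (place F) :=
  if pselect (exists s : seq (place F), uniq s /\ forall Q, Q \in s <-> (degp Q <= n)%N)
    is left e then projT1 (cid e) else [::].

(* The number of points over the field with [2 ^ n] elements. *)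
Definition npts (F : fieldType) (n : nat) : nat :=
  \sum_(Q <- places_le F n | (degp Q %| n)%N) degp Q.

Lemma sum_ord_ltn n m : (m <= n)%N -> (\sum_(j < n) (j < m) = m)%N.
Proof.
move=> mn; rewrite -(big_mkord predT (fun j => nat_of_bool (j < m)%N)) (big_cat_nat _ mn) //=.
rewrite (eq_big_nat _ _ (F2 := fun=> 1%N)); last by move=> i /andP[_ ->].
rewrite big_const_nat subn0 iter_addn_0 mul1n big_nat big1 ?addn0 //.
by move=> i /andP[mi _]; rewrite ltnNge mi.
Qed.

Lemma sum_multiples (n d : nat) (f : nat -> nat) : (0 < d)%N ->
  (\sum_(j < n) (if j.+1 * d <= n then f (j.+1 * d) else 0) =
   \sum_(k < n) (if d %| k.+1 then f k.+1 else 0))%N.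
Proof.
move=> d0.
transitivity (\sum_(j < n) \sum_(k < n) (if j.+1 * d == k.+1 then f k.+1 else 0))%N.
  apply: eq_bigr => j _; case: leqP => h.
    have kn : ((j.+1 * d).-1 < n)%N by rewrite prednK // muln_gt0.
    rewrite (bigD1 (Ordinal kn)) //= prednK ?muln_gt0 // eqxx big1 ?addn0 // => k kn'.
    case: eqP => // e; case/eqP: kn'; apply: val_inj => /=; by rewrite e.
  rewrite big1 // => k _; case: eqP => // e; have := ltn_ord k; move: h; rewrite e; lia.
rewrite exchange_big; apply: eq_bigr => k _; case: ifP => [/dvdnP[q e]|h].
  have q0 : (0 < q)%N by move: e; case: q.
  have qn : (q.-1 < n)%N by have := ltn_ord k; rewrite prednK //; nia.
  rewrite (bigD1 (Ordinal qn)) //= prednK // e eqxx big1 ?addn0 // => j jn.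
  case: eqP => // /eqP; rewrite eqn_pmul2r // => /eqP e2.
  by case/eqP: jn; apply: val_inj => /=; rewrite -e2.
rewrite big1 // => j _; case: eqP => // e; by rewrite -e dvdn_mull in h.
Qed.

(** * Newton's identity *)

Section Newton.
Variables (F : fieldType) (g : nat) (P0 : place F).
Hypothesis hcurve : pointed_curve g P0.
Variables (h : nat) (R : 'I_h -> place F -> int).
Hypothesis hR : class_reps R.
Implicit Types (P Q : place F) (D E G K : place F -> int).
Local Notation effn := (effn P0 R).

Lemma pt_inj : injective (@pt F).
Proof. by move=> P Q e; have := congr1 (fun f => f P) e; rewrite /pt eqxx; case: eqP. Qed.

Lemma eff_pt Q : eff (pt Q). Proof. by move=> P; rewrite ptE; case: (P == Q). Qed.

Lemma places_leP n : uniq (places_le F n) /\ forall Q, Q \in places_le F n <-> (degp Q <= n)%N.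
Proof.
rewrite /places_le; case: pselect => [e|[]]; first by case: cid.
have /choice[L hL] := effn_list hcurve hR.
apply: (@finite_pred F (fun Q => (degp Q <= n)%N) (size (flatten [seq L d | d <- iota 0 n.+1]))).
move=> s us hs; rewrite -(size_map (@pt F)); apply: uniq_leq_size.
  by rewrite map_inj_uniq //; apply: pt_inj.
move=> D /mapP[Q /hs Qn ->]; apply/flattenP; exists (L (degp Q)).
  by apply: map_f; rewrite mem_iota.
have [_ _ h1] := hL (degp Q); apply/h1; split; [exact: finsupp_pt | exact: eff_pt | exact: deg_pt].
Qed.

Lemma eff_mult_le D Q i : finsupp D -> eff D -> i%:Z <= D Q -> (i * degp Q)%:Z <= deg D.
Proof.
move=> fD eD h1; have fQ : finsupp (pt Q *+ i) by apply/finsuppMn/finsupp_pt.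
have := @deg_eff F (D - pt Q *+ i) (finsuppD fD (finsuppN fQ)).
rewrite degB // degMn ?deg_pt ?mulrn_int; last exact: finsupp_pt.
have h2 : eff (D - pt Q *+ i).
  by move=> P; rewrite dD dN ptMnE; have := eD P; case: eqP => [->|_]; lia.
by move=> /(_ h2); rewrite PoszM; lia.
Qed.

(** Subtracting [i] times [Q] is a bijection onto the effective divisors of degree $n - i \deg
    Q$. *)
Lemma effn_multiple n Q i L : uniq L ->
  (forall D, D \in L <-> [/\ finsupp D, eff D & deg D = n%:Z]) ->
  (\sum_(D <- L) (i <= `|D Q|) = if i * degp Q <= n then effn (n - i * degp Q) else 0)%N.
Proof.
move=> uL hL.
have -> : (\sum_(D <- L) (i <= `|D Q|) = count (fun D => i <= `|D Q|) L)%N.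
  by rewrite -sum1_count [RHS]big_mkcond; apply: eq_bigr => D _; case: (i <= _)%N.
case: leqP => hi; last first.
  apply/eqP; rewrite -leqn0 leqNgt -has_count; apply/hasPn => D /hL[fD eD hd].
  rewrite -ltnNge ltnNge; apply/negP => h1.
  by have := @eff_mult_le D Q i fD eD; rewrite hd; have := eD Q; lia.
have [M [uM <- hM]] := effn_list hcurve hR (n - i * degp Q).
rewrite -size_filter -[RHS](size_map (fun D => D + pt Q *+ i)).
have fQ : finsupp (pt Q *+ i) by apply/finsuppMn/finsupp_pt.
have dQ : deg (pt Q *+ i) = (i * degp Q)%:Z.
  by rewrite degMn ?deg_pt ?mulrn_int ?PoszM //; apply: finsupp_pt.
apply: perm_size; apply: uniq_perm; first by rewrite filter_uniq.
  by rewrite map_inj_uniq //; apply: addIr.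
move=> D; rewrite mem_filter; apply/andP/mapP => [[iD /hL[fD eD hd]]|[E /hM[fE eE he] ->]].
  exists (D - pt Q *+ i); last by rewrite subrK.
  apply/hM; split; first exact/finsuppD/finsuppN.
    by move=> P; rewrite dD dN ptMnE; have := eD P; case: eqP => [->|_]; lia.
  by rewrite degB // hd dQ; lia.
split; first by rewrite dD ptMnE eqxx; have := eE Q; lia.
apply/hL; split; first exact: finsuppD.
  by move=> P; rewrite dD ptMnE; have := eE P; case: eqP => _; lia.
by rewrite degD // he dQ; lia.
Qed.

Lemma npts_le n k : (0 < k <= n)%N ->
  npts F k = (\sum_(Q <- places_le F n) if degp Q %| k then degp Q else 0)%N.
Proof.
move=> /andP[k0 kn]; rewrite /npts -big_mkcond -big_filter -[RHS]big_filter.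
have [uk hk] := places_leP k; have [un hn] := places_leP n.
apply: perm_big; apply: uniq_perm; rewrite ?filter_uniq // => Q; rewrite !mem_filter.
case e: (degp Q %| k)%N => //=; have Qk := dvdn_leq k0 e.
by apply/idP/idP => _; [apply/hn/(leq_trans Qk) | apply/hk].
Qed.

(** Both sides add up the degrees of all effective divisors of degree [n]. The multiplicity of [Q]
    in [D] is the number of [j] below it, and the products $(j+1)\deg Q$ are regrouped by their
    value. *)
Lemma newton n : (n * effn n = \sum_(k < n) npts F k.+1 * effn (n - k.+1))%N.
Proof.
have [L [uL sL hL]] := effn_list hcurve hR n; have [un hn] := places_leP n.
have e1 D : D \in L -> n = (\sum_(Q <- places_le F n) \sum_(j < n) (j < `|D Q|) * degp Q)%N.
  move=> /hL[fD eD hd].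
  have hs Q : D Q != 0 -> Q \in places_le F n.
    move=> DQ; apply/hn; have := @eff_mult_le D Q 1 fD eD; rewrite hd mul1n.
    by have := eD Q; lia.
  apply/eqP; rewrite -eqz_nat -hd (deg_sum un hs) raddf_sum; apply/eqP.
  apply: eq_bigr => Q _; rewrite -big_distrl /= sum_ord_ltn.
    by rewrite PoszM gez0_abs.
  have := @eff_mult_le D Q `|D Q|%N fD eD; rewrite hd gez0_abs // => /(_ (lexx _)).
  by have := degp_gt0 hcurve Q; nia.
rewrite -sL mulnC -[size L]sum1_size big_distrl /=.
transitivity (\sum_(D <- L) \sum_(Q <- places_le F n) \sum_(j < n) (j < `|D Q|) * degp Q)%N.
  by rewrite [LHS]big_seq [RHS]big_seq; apply: eq_bigr => D DL; rewrite mul1n; apply: e1.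
rewrite exchange_big /=.
transitivity (\sum_(Q <- places_le F n) \sum_(k < n)
    if degp Q %| k.+1 then degp Q * effn (n - k.+1) else 0)%N.
  apply: eq_bigr => Q _; rewrite exchange_big /=.
  rewrite -(@sum_multiples n (degp Q) (fun k => degp Q * effn (n - k))%N (degp_gt0 hcurve Q)).
  apply: eq_bigr => j _; rewrite -big_distrl /= (effn_multiple Q j.+1 uL hL) mulnC.
  by case: ifP; rewrite ?muln0.
rewrite exchange_big; apply: eq_bigr => k _; rewrite (@npts_le n) ?ltn_ord // [RHS]big_distrl /=.
by apply: eq_bigr => Q _; case: ifP.
Qed.

End Newton.

(** * The bound on the class number *)

Section PowerSeries.
Variable F : archiRealFieldType.
Implicit Types (a b s : nat -> F).

(* [t a' = s a] as formal power series in [t]. *)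
Definition log_deriv s a : Prop :=
  forall n, n%:R * a n = \sum_(k < n) s k.+1 * a (n - k.+1)%N.

(* Coefficients of [a / (1 - r t)]. *)
Fixpoint geom_quot (r : F) a n : F :=
  if n is n'.+1 then r * geom_quot r a n' + a n else a 0.

(** $t$ times the logarithmic derivative of $1/(1-rt)$ is $\sum_{k \ge 1} r^k t^k$; the proof
    compares the recurrences of both sides. *)
Lemma log_deriv_quot r a s : log_deriv s a ->
  log_deriv (fun k => s k + r ^+ k) (geom_quot r a).
Proof.
move=> W n; elim: n {-2}n (leqnn n) => [|N IH] [|n]; rewrite ?mul0r ?big_ord0 // ltnS => nN.
set b := geom_quot r a.
have e1 : n.+1%:R * b n.+1 = r * b n + r * (n%:R * b n) + n.+1%:R * a n.+1.
  by rewrite /b /= -natr1; ring.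
have eN : \sum_(k < n.+1) s k.+1 * b (n.+1 - k.+1)%N =
    r * \sum_(k < n) s k.+1 * b (n - k.+1)%N + \sum_(k < n.+1) s k.+1 * a (n.+1 - k.+1)%N.
  rewrite !big_ord_recr /= !subnn mulr_sumr addrA -big_split /=; congr (_ + _).
  apply: eq_bigr => k _; have kn := ltn_ord k.
  rewrite (_ : (n.+1 - k.+1 = (n - k.+1).+1)%N); last by rewrite subSn.
  by rewrite /b /=; ring.
rewrite e1 IH // W.
rewrite [RHS](eq_bigr (fun k : 'I_n.+1 => s k.+1 * b (n.+1 - k.+1)%N + r ^+ k.+1 * b (n.+1 - k.+1)%N));
  last by move=> k _; rewrite mulrDl.
rewrite big_split /= eN [X in _ = _ + X]big_ord_recl /= subSS subn0 expr1.
rewrite [in LHS](eq_bigr (fun k : 'I_n => s k.+1 * b (n - k.+1)%N + r ^+ k.+1 * b (n - k.+1)%N));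
  last by move=> k _; rewrite mulrDl.
rewrite big_split /=.
have -> : \sum_(i < n) r ^+ (bump 0 i).+1 * b (n.+1 - (bump 0 i).+1)%N =
    r * \sum_(k < n) r ^+ k.+1 * b (n - k.+1)%N.
  by rewrite mulr_sumr; apply: eq_bigr => k _; rewrite /bump /= add1n subSS exprS mulrA.
ring.
Qed.

(* Coefficients of [(1 - r t) a]. *)
Definition geom_mul (r : F) a n : F := a n - (if n is n'.+1 then r * a n' else 0).

Lemma log_deriv_mul r a s : log_deriv s a ->
  log_deriv (fun k => s k - r ^+ k) (geom_mul r a).
Proof.
move=> W; set m := geom_mul r a.
have am n : a n = \sum_(k < n.+1) r ^+ k * m (n - k)%N.
  elim: n => [|n IH]; first by rewrite big_ord_recl big_ord0 /m /geom_mul /=; ring.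
  rewrite big_ord_recl /= subn0 expr0 mul1r.
  rewrite (eq_bigr (fun k : 'I_n.+1 => r * (r ^+ k * m (n - k)%N))); last first.
    by move=> k _; rewrite /bump /= add1n subSS exprS mulrA.
  by rewrite -mulr_sumr -IH /m /geom_mul; ring.
case=> [|n]; first by rewrite mul0r big_ord0.
have -> : n.+1%:R * m n.+1 = n.+1%:R * a n.+1 - r * (n%:R * a n) - r * a n.
  by rewrite /m /geom_mul -natr1; ring.
rewrite !W {1}am.
rewrite [RHS](eq_bigr (fun k : 'I_n.+1 => s k.+1 * m (n.+1 - k.+1)%N - r ^+ k.+1 * m (n.+1 - k.+1)%N));
  last by move=> k _; rewrite mulrBl.
rewrite sumrB mulr_sumr; congr (_ - _); last first.
  by rewrite mulr_sumr; apply: eq_bigr => k _; rewrite subSS exprS mulrA.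
rewrite !big_ord_recr /= !subnn addrAC -sumrB; congr (_ + _); last by rewrite /m /geom_mul subr0.
apply: eq_bigr => k _; have kn := ltn_ord k.
rewrite (_ : (n.+1 - k.+1 = (n - k.+1).+1)%N); last by rewrite subSn.
by rewrite /m /geom_mul /=; ring.
Qed.

Lemma log_deriv_ge0 a s : log_deriv s a -> 0 <= a 0%N -> (forall k, 0 <= s k.+1) ->
  forall n, 0 <= a n.
Proof.
move=> W a0 s0 n; elim: n {-2}n (leqnn n) => [|N IH] [|n] // nN.
have : 0 <= n.+1%:R * a n.+1.
  rewrite W; apply: sumr_ge0 => k _; apply: mulr_ge0; first exact: s0.
  by apply: IH; rewrite subSS; apply: leq_trans (leq_subr _ _) _.
by rewrite pmulr_rge0 // ltr0n.
Qed.

Definition psum a (t : F) X : F := \sum_(n < X) a n * t ^+ n.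

(** Convergence with a geometric rate, in a form that makes sense over the rationals. *)
Definition converges (th : F) a t u X0 : Prop :=
  exists K, forall X, (X0 <= X)%N -> `|psum a t X - u| <= K * th ^+ X.

Lemma converges_quot th r a t u X0 : 0 <= r * t < th -> th < 1 -> converges th a t u X0 ->
  converges th (geom_quot r a) t (u / (1 - r * t)) X0.
Proof.
move=> /andP[rt0 rt1] th1 [K hK].
have th0 : 0 < th by lra.
have d0 : 0 < th - r * t by lra.
have e0 : 1 - r * t != 0 by apply: lt0r_neq0; lra.
pose b := geom_quot r a; pose v := u / (1 - r * t).
have step X : psum b t X.+1 = r * t * psum b t X + psum a t X.+1.
  have pS c Y : psum c t Y.+1 = psum c t Y + c Y * t ^+ Y by rewrite /psum big_ord_recr.
  have p0 c : psum c t 0 = 0 by rewrite /psum big_ord0.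
  elim: X => [|X IH]; first by rewrite !pS !p0 /b /=; ring.
  by rewrite [LHS]pS [X in X + _ = _]IH (pS a X.+1) (pS b X) /b /= exprS; ring.
have ev X : psum b t X.+1 - v = r * t * (psum b t X - v) + (psum a t X.+1 - u).
  by rewrite step /v; field.
have [k0 hk0] : exists k0, 0 <= k0 /\ `|psum b t X0 - v| <= k0 * th ^+ X0.
  exists (`|psum b t X0 - v| / th ^+ X0); split; first by rewrite divr_ge0 // exprn_ge0 // ltW.
  by rewrite divfK // expf_neq0 // gt_eqF.
(* [q] solves $rtq + th = th\,q$, so the error bound reproduces itself under the recurrence [ev]. *)
pose q := th / (th - r * t).
have q0 : 0 <= q by rewrite divr_ge0 // ltW.
have eq_ : r * t * q + th = th * q by rewrite /q; field; rewrite gt_eqF.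
exists (k0 + `|K| * q) => X X0X; rewrite -(subnK X0X); move: (X - X0)%N => {X0X}X.
elim: X => [|X IH].
  rewrite add0n; apply: le_trans hk0.2 _; rewrite ler_pM2r ?exprn_gt0 // lerDl.
  by rewrite mulr_ge0.
rewrite addSn ev; apply: le_trans (ler_normD _ _) _.
rewrite normrM (ger0_norm rt0).
have h1 : `|psum a t (X + X0).+1 - u| <= `|K| * th * th ^+ (X + X0).
  rewrite -mulrA -exprS; apply: le_trans (hK _ _) _; first by rewrite leqW // leq_addl.
  by apply: ler_wpM2r; [rewrite exprn_ge0 // ltW | exact: ler_norm].
apply: le_trans (lerD (ler_wpM2l rt0 IH) h1) _.
rewrite exprS; set T := th ^+ (X + X0); set k := `|K|.
have -> : r * t * ((k0 + k * q) * T) + k * th * T = (r * t * k0 + k * (r * t * q + th)) * T.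
  by ring.
have -> : (k0 + k * q) * (th * T) = (th * k0 + k * (th * q)) * T by ring.
rewrite eq_; apply: ler_wpM2r; first by rewrite exprn_ge0 // ltW.
by rewrite lerD2r; apply: ler_wpM2r; [exact: hk0.1 | exact: ltW].
Qed.

(** The partial sums are at least 1, so a negative limit would keep the error above 1, whereas
    $K\,th^X$ tends to 0; Bernoulli's inequality makes this effective. *)
Lemma converges_ge0 th a t u X0 : 0 < th -> th < 1 -> 0 <= t -> a 0%N = 1 -> (forall n, 0 <= a n) ->
  converges th a t u X0 -> 0 <= u.
Proof.
move=> th0 th1 t0 a0 an [K hK]; rewrite leNgt; apply/negP => u0.
have p1 X : 1 <= psum a t X.+1.
  rewrite /psum big_ord_recl /= a0 expr0 mulr1 lerDl; apply: sumr_ge0 => i _.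
  by rewrite mulr_ge0 // exprn_ge0.
have bern X : 1 + X%:R * (th^-1 - 1) <= th^-1 ^+ X.
  elim: X => [|X IH]; first by rewrite mul0r addr0.
  have y1 : 1 <= th^-1 by rewrite invf_ge1 // ltW.
  have Y1 : 1 <= th^-1 ^+ X by apply: exprn_ege1.
  have : 0 <= (th^-1 - 1) * (th^-1 ^+ X - 1) by apply: mulr_ge0; rewrite subr_ge0.
  rewrite exprS -natr1; move: IH y1 Y1; set y := th^-1; set Y := y ^+ X; set x := X%:R.
  by lra.
have c0 : 0 < th^-1 - 1 by rewrite subr_gt0 invf_gt1.
pose Y := (X0 + (Num.bound (`|K| / (th^-1 - 1))))%N.
have hY : `|K| < th^-1 ^+ Y.+1.
  have h2 := archi_boundP (_ : 0 <= `|K| / (th^-1 - 1)).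
  have {}h2 : `|K| / (th^-1 - 1) < (Num.bound (`|K| / (th^-1 - 1)))%:R.
    by apply: h2; rewrite divr_ge0 // ltW.
  rewrite ltr_pdivrMr // in h2; apply: lt_le_trans h2 _; apply: le_trans (bern _).
  apply: le_trans (_ : Y.+1%:R * (th^-1 - 1) <= _); last by rewrite lerDr.
  by rewrite ler_pM2r // ler_nat /Y; lia.
have := hK Y.+1 (_ : X0 <= Y.+1)%N; rewrite /Y => /(_ _) h3.
have h4 : `|psum a t Y.+1 - u| <= K * th ^+ Y.+1 by apply: hK; rewrite /Y; lia.
have h5 : K * th ^+ Y.+1 < 1.
  apply: le_lt_trans (ler_wpM2r _ (ler_norm K)) _; first by rewrite exprn_ge0 // ltW.
  by rewrite -ltr_pdivlMr ?exprn_gt0 // mul1r -exprVn.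
have := le_lt_trans h4 h5; rewrite ltr_norml => /andP[_ h6].
have : 1 - u < 1 by apply: le_lt_trans h6; rewrite lerD2r p1.
by rewrite ltrBlDr ltrDl ltNge ltW.
Qed.

End PowerSeries.

(** * The numerical contradiction, in genus $g = m+3$ *)

Section ClassNumberBound.
Variable F : archiRealFieldType.
Variables (A N : nat -> nat) (m h C : nat).
Hypothesis h_gt0 : (0 < h)%N.
Hypothesis A0 : A 0 = 1%N.
Hypothesis newton_A : forall n, (n * A n = \sum_(k < n) N k.+1 * A (n - k.+1))%N.
Hypothesis dual_A : forall j,
  (A (m.+2 + j) + h = 2 ^ j * (if j < m.+3 then A (m.+2 - j) + h else h))%N.
Hypothesis incl_excl_A : forall n, (3 * A n.+2 + A n <= A n.+3 + 3 * A n.+1)%N.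
Hypothesis low_N : forall n, (0 < n)%N -> (2 ^ n <= N n + C * 2 ^ uphalf n)%N.

Let Aq n : F := (A n)%:R.
Let M := geom_mul 2 Aq.
(* What matters: [rho ^ 2 > 2], [rho * t < th < 1], and [t] makes the last inequality contradictory. *)
Let rho : F := 17 / 12.
Let t : F := 7 / 10.
Let th : F := 199 / 200.
Let s c k : F := (N k)%:R - 2 ^+ k + c%:R * rho ^+ k.
Let G c := iter c (geom_quot rho) M.

Let pow_uphalf n : (2 ^ uphalf n)%:R <= 2 * rho ^+ n.
Proof.
have step x y : 0 < x -> y <= 2 * x -> 2 * y <= 2 * (rho * (rho * x)) by rewrite /rho; lra.
suff [h1 _] : (2 ^ uphalf n)%:R <= 2 * rho ^+ n /\ (2 ^ uphalf n.+1)%:R <= 2 * rho ^+ n.+1.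
  exact: h1.
elim: n => [|n [h1 h2]].
  split; first by rewrite expr0 mulr1 ler1n.
  by rewrite expr1 (_ : (2 ^ uphalf 1)%N = 2%N) // /rho; lra.
split; first exact: h2.
rewrite (_ : uphalf n.+2 = (uphalf n).+1) // expnS natrM !exprS.
by apply: (step _ _ _ h1); apply: exprn_gt0; rewrite /rho; lra.
Qed.

Let G_log c : log_deriv (s c) (G c).
Proof.
elim: c => [|c IH].
  have -> : s 0 = (fun k => (N k)%:R - 2 ^+ k) by apply/funext => k; rewrite /s mul0r addr0.
  apply: log_deriv_mul => n; rewrite /Aq -natrM newton_A natr_sum.
  by apply: eq_bigr => k _; rewrite natrM.
have -> : s c.+1 = (fun k => s c k + rho ^+ k).
  by apply/funext => k; rewrite /s -natr1; ring.
exact: log_deriv_quot.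
Qed.

Let G0 c : G c 0 = 1.
Proof. by elim: c => //; rewrite /G /M /geom_mul /Aq /= A0 subr0. Qed.

(** The exponent $2C$ absorbs the error term of [low_N], because $2^{\lceil n/2 \rceil} \le
    2\rho^n$. *)
Let G_ge0 n : 0 <= G (2 * C) n.
Proof.
apply: (log_deriv_ge0 (@G_log (2 * C))); first by rewrite G0.
move=> k; have := low_N (ltn0Sn k); rewrite -(ler_nat F) natrD natrM natrX /s natrM.
have := pow_uphalf k.+1; have : 0 <= (C%:R : F) by apply: ler0n.
set x := C%:R; set y := (2 ^ uphalf _)%:R; set z := rho ^+ _ => x0 yz h1.
by have := ler_wpM2l x0 yz; lra.
Qed.

Let A_large j : (m.+3 <= j)%N -> Aq (m.+2 + j) = 2 ^+ j * h%:R - h%:R.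
Proof.
move=> mj; have := dual_A j; rewrite ltnNge mj /= => e.
by rewrite /Aq -natrX -natrM -e natrD addrK.
Qed.

Let M_large n : (2 * m.+3 <= n)%N -> M n = h%:R.
Proof.
move=> gn; have [j [mj ->]] : exists j, (m.+3 <= j)%N /\ n = (m.+2 + j).+1.
  by exists (n - m.+3)%N; lia.
have e := A_large mj; have := A_large (leqW mj); rewrite addnS => e'.
by rewrite /M /geom_mul e' e exprS; ring.
Qed.

Let psum_S a X : psum a t X.+1 = psum a t X + a X * t ^+ X.
Proof. by rewrite /psum big_ord_recr. Qed.

(** The value of [M] at [t]: from index $2g$ on all coefficients are [h], and $10/3 = 1/(1-t)$. *)
Let limit := psum M t (2 * m.+3) + h%:R * t ^+ (2 * m.+3) * (10 / 3).

Let M_converges : converges th M t limit (2 * m.+3).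
Proof.
exists (h%:R * (10 / 3)) => X; elim: X => [|X IH] //.
have e Y : (2 * m.+3 <= Y)%N -> psum M t Y - limit = - (h%:R * t ^+ Y * (10 / 3)).
  elim: Y => [//|Y IHY]; rewrite leq_eqVlt => /orP[/eqP <-|YX]; first by rewrite /limit; ring.
  have := IHY YX; rewrite psum_S (M_large YX) exprS => e1.
  by rewrite addrAC e1 /t; field.
move=> /e ->; rewrite normrN ger0_norm; last first.
  by rewrite !mulr_ge0 ?exprn_ge0 // /t; lra.
rewrite mulrAC; apply: ler_wpM2l; first by rewrite mulr_ge0 //; lra.
by apply: lerXn2r; rewrite ?nnegrE /t /th; lra.
Qed.

Let G_converges c : converges th (G c) t (limit / (1 - rho * t) ^+ c) (2 * m.+3).
Proof.
elim: c => [|c IH]; first by rewrite expr0 divr1; exact: M_converges.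
rewrite exprSr invfM mulrA; apply: converges_quot => //; rewrite /rho /t /th; last by lra.
by apply/andP; split; lra.
Qed.

Let limit_ge0 : 0 <= limit.
Proof.
have th0 : 0 < th by rewrite /th; lra.
have th1 : th < 1 by rewrite /th; lra.
have t0 : 0 <= t by rewrite /t; lra.
have := converges_ge0 th0 th1 t0 (G0 (2 * C)) G_ge0 (G_converges (2 * C)).
rewrite pmulr_lge0 // invr_gt0; apply: exprn_gt0; rewrite /rho /t; lra.
Qed.

(** The factor $-2/5$ is $1-2t$, and the last term is the error of truncation. *)
Let psum_M X : psum M t X.+1 = - (2 / 5) * psum Aq t X.+1 + 2 * Aq X * t ^+ X.+1.
Proof.
elim: X => [|X IH]; first by rewrite !psum_S /psum !big_ord0 /M /geom_mul subr0 expr0 expr1 /t; field.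
by rewrite psum_S IH [in RHS]psum_S /M /geom_mul !exprS /t; field.
Qed.

Let geom_sum n : 2 / 5 * \sum_(j < n) (2 ^+ j.+1 - 1) * t ^+ j.+1 =
  7 / 5 * ((7 / 5) ^+ n - 1) - 14 / 15 * (1 - t ^+ n).
Proof.
elim: n => [|n IH]; first by rewrite big_ord0 !expr0; field.
rewrite big_ord_recr /= mulrDr IH !exprS /t.
have -> : (7 / 5 : F) ^+ n = 2 ^+ n * (7 / 10) ^+ n by rewrite -exprMn; congr (_ ^+ _); field.
by set x := 2 ^+ n; set y := _ ^+ n; field.
Qed.

Lemma class_number_bound : (A m.+1 < h)%N.
Proof.
(* The variables are $A_{g-1}, A_{g-2}, A_{g-3}$ and [h]. The first three inequalities give $x_1 \le
   3x_2$, after which the last expression is negative. *)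
have fin (x0 x1 x2 y : F) : 0 < y -> y <= x1 -> 3 * x0 + x2 <= 5 * x1 + y ->
    7 * x1 <= 4 * x2 + 3 * x0 ->
    0 <= 343 / 300 * y - 2 / 5 * (49 / 100 * x0 + (7 / 10 + 343 / 500) * x1 + (1 + 2401 / 2500) * x2) ->
    False by lra.
rewrite ltnNge; apply/negP => ah.
have d1 := dual_A 1; have d2 := dual_A 2; rewrite /= in d1 d2.
rewrite !addnS addn0 !subSS !subn0 expn1 in d1 d2.
have i0 := incl_excl_A m; have i1 := incl_excl_A m.+1.
have n0 : (3 * A m.+2 + A m <= 5 * A m.+1 + h)%N by lia.
have n1 : (7 * A m.+1 <= 4 * A m + 3 * A m.+2)%N by lia.
have q1 : (2 * m.+3 = (m.+2 + m.+3).+1)%N by lia.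
clear d1 d2 i0 i1.
pose T := t ^+ m; have T0 : 0 < T by apply: exprn_gt0; rewrite /t; lra.
pose a0 := Aq m.+2; pose a1 := Aq m.+1; pose a2 := Aq m.
pose p : F := (7 / 5) ^+ m.+3; pose tg := t ^+ m.+3.
have pge a X : psum a t X.+1 = psum a t X + a X * t ^+ X by apply: psum_S.
have t_ge0 : 0 <= t by rewrite /t; lra.
have low : T * (49 / 100 * a0 + 7 / 10 * a1 + a2) <= psum Aq t m.+3.
  rewrite !pge /a0 /a1 /a2 !exprS -/T.
  have : 0 <= psum Aq t m by apply: sumr_ge0 => i _; rewrite mulr_ge0 ?exprn_ge0 // ler0n.
  by rewrite /t; lra.
(* Duality reads $A_{g+j} = (2^{j+1}-1)h + 2^{j+1}A_{g-2-j}$ as long as the last index is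
   nonnegative; its second term is kept for $j = 0, 1$ only. *)
have upA j : (2 ^+ j.+1 - 1) * h%:R + (if j == 0%N then 2 * a1 else if j == 1%N then 4 * a2 else 0)
    <= Aq (m.+3 + j).
  have e := dual_A j.+1; rewrite addnS -addSn in e.
  have {}e : Aq (m.+3 + j) = 2 ^+ j.+1 * (if (j.+1 < m.+3)%N then Aq (m.+2 - j.+1)%N + h%:R else h%:R) - h%:R.
    rewrite /Aq -[LHS](addrK h%:R) -natrD e natrM natrX; congr (_ * _ - _).
    by case: ifP; rewrite ?natrD.
  rewrite e; case: j {e} => [|[|j]] /=.
  - by rewrite subSS subn0 expr1 /a1; lra.
  - by rewrite !subSS subn0 /a2 exprS expr1; lra.
  have hh : 0 <= (h%:R : F) by apply: ler0n.
  have : 0 <= Aq (m.+2 - j.+3)%N by apply: ler0n.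
  have : 0 <= (2 : F) ^+ j.+3 by apply: exprn_ge0.
  case: ifP => _; set x := 2 ^+ _; set y := Aq _; nra.
have up : psum Aq t m.+3 + \sum_(j < m.+3) Aq (m.+3 + j) * t ^+ (m.+3 + j) = psum Aq t (2 * m.+3).
  by rewrite /psum mul2n -addnn big_split_ord.
have ge2 : h%:R * (T * t ^+ 2) * (\sum_(j < m.+3) (2 ^+ j.+1 - 1) * t ^+ j.+1) +
    T * (2 * (343 / 1000) * a1 + 4 * (2401 / 10000) * a2) <=
    \sum_(j < m.+3) Aq (m.+3 + j) * t ^+ (m.+3 + j).
  have -> : T * (2 * (343 / 1000) * a1 + 4 * (2401 / 10000) * a2) =
      \sum_(j < m.+3) (if j == 0%N :> nat then 2 * a1 else if j == 1%N :> nat then 4 * a2 else 0) *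
        t ^+ (m.+3 + j).
    rewrite !big_ord_recl /= big1 => [|i _]; last by rewrite mul0r.
    by rewrite /bump /= !addnS !addn0 !exprS -/T /t; field.
  rewrite mulr_sumr -big_split /=; apply: ler_sum => j _.
  have tj : 0 <= t ^+ (m.+3 + j) by apply: exprn_ge0.
  apply: le_trans (ler_wpM2r tj (upA j)); rewrite [X in _ <= X]mulrDl lerD2r.
  by rewrite exprD !exprS -/T le_eqVlt; apply/orP; left; apply/eqP; ring.
have := geom_sum m.+3; rewrite -/p -/tg; set S := \sum_(j < m.+3) _ => eS; rewrite -/S in ge2.
have eA : Aq (m.+2 + m.+3) = 2 ^+ m.+3 * h%:R - h%:R by apply: A_large.
have := limit_ge0; rewrite /limit {1}q1 psum_M eA -q1 -up.
have -> : t ^+ (2 * m.+3) = T * t ^+ 3 * tg.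
  by rewrite mul2n -addnn exprD /tg !exprS /T; ring.
have pt : p = 2 ^+ m.+3 * tg.
  by rewrite /p /tg -exprMn; congr (_ ^+ _); rewrite /t; field.
have t3 : t ^+ 3 = 343 / 1000 by rewrite /t; field.
have t2 : t ^+ 2 = 49 / 100 by rewrite /t; field.
rewrite t3; rewrite t2 in ge2; move: low ge2 eS pt n0 n1; clear up upA pge.
rewrite -/a0 -/a1 -/a2; set z1 := psum _ _ _; set z2 := \sum_(j < _) _; set w := 2 ^+ _.
move=> low ge2 eS pt n0 n1 L; set H : F := h%:R in L ge2 *.
have eS' : H * T * (2 / 5 * S) = H * T * (7 / 5 * (p - 1) - 14 / 15 * (1 - tg)) by rewrite eS.
have pt' : H * T * p = H * T * (w * tg) by rewrite pt.
(* All terms in $t^g$ and $(2t)^g$ cancel. What remains of [h] is $t^3/(1-t) = 343/300$; the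
   fractions $343/500 = 2t^3$ and $2401/2500 = 4t^4$ come from $A_g$ and $A_{g+1}$. *)
have bracket : 0 <= T * (343 / 300 * H - 2 / 5 * (49 / 100 * a0 + (7 / 10 + 343 / 500) * a1 + (1 + 2401 / 2500) * a2)).
  clear eS pt; lra.
have {}bracket : 0 <= 343 / 300 * H - 2 / 5 * (49 / 100 * a0 + (7 / 10 + 343 / 500) * a1 + (1 + 2401 / 2500) * a2).
  by rewrite pmulr_rge0 in bracket.
have e0 : 3 * a0 + a2 <= 5 * a1 + H by rewrite /a0 /a1 /a2 /Aq -!natrM -!natrD ler_nat.
have e1 : 7 * a1 <= 4 * a2 + 3 * a0 by rewrite /a0 /a1 /a2 /Aq -!natrM -!natrD ler_nat.
have e2 : H <= a1 by rewrite ler_nat.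
by apply: (fin _ _ _ _ _ e2 e0 e1 bracket); rewrite ltr0n.
Qed.
End ClassNumberBound.

(** * Stepanov's lower bound for the number of points *)

Section Poles.
Variables (F : fieldType) (g : nat) (P0 : place F).
Hypothesis hcurve : pointed_curve g P0.
Let char2 : (2%:R : F) = 0. Proof. by case: hcurve. Qed.
Let hg : is_genus F g. Proof. by case: hcurve. Qed.
Let hP0 : place_deg P0 1. Proof. by case: hcurve. Qed.
Let aff := addff char2.
Implicit Types (P Q : place F) (D E G : place F -> int) (z : F).

Lemma exact_pole : exists N : nat, forall n, (N <= n)%N ->
  exists z, [/\ z != 0, reg P0 z & ord P0 z = - n.+1%:Z].
Proof.
have [N hN] := riemann_eq hcurve; exists `|N|%N => n Nn.
have fP k : finsupp (pt P0 *+ k) by apply/finsuppMn/finsupp_pt.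
have e1 := hN _ (fP n); have e2 := hN _ (fP n.+1); rewrite !(deg_P0 hcurve) in e1 e2.
have [|e [he el _]] := ell_ext char2 hg (good_P0 hcurve n) (good_P0 hcurve n.+1).
  by move=> P; rewrite !ptMnE; case: eqP; lia.
have e_1 : e = 1%N by lia.
case: he; rewrite e_1 => -[|z [|? ?]] [//= _ [nz _] eL].
have hz : Ls (pt P0 *+ n.+1) z by rewrite eL; right; rewrite aff; case: (Ls_sub (pt P0 *+ n)).
have z0 : z != 0 by apply/eqP => z0; apply: nz; rewrite z0; case: (Ls_sub (pt P0 *+ n)).
exists z; split=> //; first exact: reg_Ls hz.
have /LsP0[rz] := hz; rewrite vgeP // => h1.
have : ~ vge P0 (- n%:Z) z by move=> h; apply: nz; apply/LsP0.
by rewrite vgeP // => h2; lia.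
Qed.

Lemma reg_zeros_eq z s : z != 0 -> reg P0 z -> uniq s -> P0 \notin s ->
  (forall Q, Q != P0 -> ord Q z != 0 -> Q \in s) ->
  \sum_(Q <- s) ord Q z * (degp Q)%:Z = - ord P0 z.
Proof.
move=> z0 rz us Ps hs; have := deg_div hcurve z0.
rewrite (@deg_sum _ _ (P0 :: s)) /=; last 2 first.
- by rewrite Ps.
- by move=> Q; rewrite /div inE; have [//|QP] := eqVneq Q P0; move/(hs Q QP).
by rewrite big_cons (degP0 char2 hP0) mulr1 /div => /eqP; rewrite addr_eq0 => /eqP ->; rewrite opprK.
Qed.

Lemma zeros_list z : z != 0 -> exists s, [/\ uniq s, P0 \notin s &
  forall Q, Q \in s <-> Q != P0 /\ ord Q z != 0].
Proof.
move=> z0; have [s [us hs]] := finsuppP (div_finsupp hcurve z0).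
exists [seq Q <- s | (Q != P0) && (ord Q z != 0)].
split; first by rewrite filter_uniq.
  by rewrite mem_filter eqxx.
by move=> Q; rewrite mem_filter; split=> [/andP[/andP[]]//|[h1 h2]]; rewrite h1 h2 hs.
Qed.

Lemma reg_zeros z s : z != 0 -> reg P0 z -> uniq s -> P0 \notin s ->
  \sum_(Q <- s) ord Q z * (degp Q)%:Z <= - ord P0 z.
Proof.
move=> z0 rz us Ps; have [t [ut Pt ht]] := zeros_list z0.
have pos Q : Q != P0 -> 0 <= ord Q z * (degp Q)%:Z.
  by move=> QP; rewrite mulr_ge0 //; have := rz Q QP; rewrite vgeP.
have hu : uniq (undup (s ++ t)) by apply: undup_uniq.
have Pu : P0 \notin undup (s ++ t) by rewrite mem_undup mem_cat negb_or Ps.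
rewrite -(reg_zeros_eq z0 rz hu Pu); last first.
  by move=> Q QP oQ; rewrite mem_undup mem_cat; apply/orP; right; apply/ht.
rewrite [X in _ <= X](bigID (mem s)) /= -[X in X <= _]addr0; apply: lerD; last first.
  rewrite big_seq_cond; apply: sumr_ge0 => Q /andP[Qu _]; apply: pos.
  by apply: contraNneq Pu => <-.
rewrite -[X in _ <= X]big_filter le_eqVlt; apply/orP; left; apply/eqP; apply: perm_big; apply: uniq_perm => //.
  by rewrite filter_uniq.
by move=> Q; rewrite mem_filter mem_undup mem_cat /=; case: (Q \in s).
Qed.

Lemma reg_ord_le0 z : z != 0 -> reg P0 z -> ord P0 z <= 0.
Proof.
by move=> z0 rz; have := @reg_zeros z [::] z0 rz isT isT; rewrite big_nil oppr_ge0.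
Qed.

Lemma reg_zero_deg z Q n : z != 0 -> Ls (pt P0 *+ n) z -> Q != P0 ->
  ord Q z * (degp Q)%:Z <= n%:Z.
Proof.
move=> z0 /LsP0[rz]; rewrite vgeP // => hn QP.
have := @reg_zeros z [:: Q] z0 rz isT; rewrite inE eq_sym => /(_ QP).
by rewrite big_seq1; lia.
Qed.

(** Zeros and poles balance, so a zero at [Q] costs at least [degp Q] in pole order at [P0]. *)
Lemma reg_unit z Q n : z != 0 -> Ls (pt P0 *+ n) z -> Q != P0 -> (n < degp Q)%N -> ord Q z = 0.
Proof.
move=> z0 hz QP nQ; have := reg_zero_deg z0 hz QP.
have : 0 <= ord Q z by have := reg_Ls hz QP; rewrite vgeP.
by move: (ord Q z) => o h1 h2; nia.
Qed.

Lemma sum_distinct_ord r (a : nat -> F) : (exists2 i, (i < r)%N & a i != 0) ->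
  (forall i j, (i < r)%N -> (j < r)%N -> a i != 0 -> a j != 0 -> ord P0 (a i) = ord P0 (a j) -> i = j) ->
  \sum_(i < r) a i != 0.
Proof.
move=> [i0 ir0 ai0] inj.
pose Pr (i : 'I_r) := a i != 0.
case: (@Order.TotalTheory.arg_minP _ _ _ (Ordinal ir0) Pr (fun i => ord P0 (a i)) ai0) => i ai mn.
rewrite (bigD1 i) //=; have [] // := @vge_ordD F char2 P0 (a i) (\sum_(j < r | j != i) a j) ai.
apply: vge_sum => j ji; have [->|aj] := eqVneq (a j) 0; first exact: vge0.
right; have := mn j aj; rewrite le_eqVlt => /orP[/eqP e|]; last lia.
by case/eqP: ji; apply: val_inj; apply: (inj _ _ (ltn_ord j) (ltn_ord i) aj ai (esym e)).
Qed.

Lemma F2poly_ord x (p : {poly F}) n : x != 0 -> ord P0 x = - n%:Z -> (0 < n)%N -> F2poly p -> p != 0 ->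
  p.[x] != 0 /\ ord P0 p.[x] = - (n * (size p).-1)%:Z.
Proof.
move=> x0 ox n0 hp p0; have sp : (size p).-1.+1 = size p by rewrite prednK // lt0n size_poly_eq0.
have lc : lead_coef p = 1 by have [/eqP|//] := hp (size p).-1; rewrite -/(lead_coef p) lead_coef_eq0 (negPf p0).
rewrite horner_coef -sp big_ord_recr /= -/(lead_coef p) lc mul1r addrC.
have xn0 : x ^+ (size p).-1 != 0 by apply: expf_neq0.
have -> : - (n * (size p).-1)%:Z = ord P0 (x ^+ (size p).-1) by rewrite ordXz ox PoszM; lia.
apply: (vge_ordD char2) => //; apply: vge_sum => i _.
case: (hp i) => ->; first by rewrite mul0r; exact: vge0.
rewrite mul1r; right; rewrite !ordXz ox; have := ltn_ord i; nia.
Qed.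
End Poles.

(** * Multiplicities of the zeros of $x^q + x$ *)

Section Unramified.
Variables (F : fieldType) (g : nat) (P0 : place F).
Hypothesis hcurve : pointed_curve g P0.
Let char2 : (2%:R : F) = 0. Proof. by case: hcurve. Qed.
Let hg : is_genus F g. Proof. by case: hcurve. Qed.
Let aff := addff char2.
Implicit Types (P Q : place F) (z : F).
Variables (x : F) (m' : nat).
Hypotheses (x0 : x != 0) (rx : reg P0 x) (ox : ord P0 x = - m'.*2.+1%:Z).

Let t0 := (m' + 3 * g + 1)%N.

(* [F] is spanned by [1] and [x] over its squares; the denominator [c] is bounded independently of [z]. *)
Lemma square_decomposition z : reg P0 z -> exists a b c,
  [/\ reg P0 b, c != 0, Ls (pt P0 *+ t0) c & c ^+ 2 * z = a ^+ 2 + x * b ^+ 2].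
Proof.
move=> rz; have [N hz] := reg_pole rz; pose s := (t0 + N + m')%N.+1.
(* With these bounds $a^2$, $xb^2$ and $c^2z$ all have pole order at most $2s$. The value of [t0]
   makes the three dimensions add up to at least $2s+3$, while $L(2sP_0)$ has at most $2s+1$. *)
pose dim i := match i with 0%N => s | 1%N => (s - m'.+1)%N | _ => t0 end.
have hS i : reldim (@zsub F) (Ls (pt P0 *+ dim i)) (ell (pt P0 *+ dim i)).
  exact: (ellP char2 hg (good_P0 hcurve _)).
have h3 := reldim_poly aff 3 hS.
have hT := ellP char2 hg (good_P0 hcurve (2 * s)).
pose f (p : {poly F}) := p`_0 ^+ 2 + x * p`_1 ^+ 2 + p`_2 ^+ 2 * z.
have fD : {morph f : p q / p + q} by move=> p q; rewrite /f !coefD !(sqrD char2); ring.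
have lx : Ls (pt P0 *+ m'.*2.+1) x by apply/LsP0; split=> //; right; rewrite ox.
have sq n a : Ls (pt P0 *+ n) a -> Ls (pt P0 *+ (2 * n)) (a ^+ 2).
  by move=> ha; rewrite mul2n -addnn expr2; apply: LsP0_mul.
have fW (p : {poly F}) : (size p <= 3)%N /\ (forall i, (i < 3)%N -> Ls (pt P0 *+ dim i) p`_i) ->
    Ls (pt P0 *+ (2 * s)) (f p).
  move=> [_ hp]; case: (Ls_sub (pt P0 *+ (2 * s))) => _ add.
  rewrite /f; apply: (add); first apply: (add).
  - exact: (sq _ _ (hp 0%N isT)).
  - apply: (@LsP0_mono _ _ (m'.*2.+1 + 2 * (s - m'.+1))); first by rewrite /s; lia.
    by apply: LsP0_mul => //; exact: (sq _ _ (hp 1%N isT)).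
  - apply: (@LsP0_mono _ _ (2 * t0 + N)); first by rewrite /s; lia.
    by apply: LsP0_mul => //; exact: (sq _ _ (hp 2%N isT)).
have [|p [[sp hp] p0 e]] := reldim_kernel (addpp aff) aff fD fW h3 hT.
  rewrite !big_ord_recr big_ord0 /= add0n.
  have := ell_P0_le hcurve (2 * s); have := ell_P0_ge hcurve s.
  have := ell_P0_ge hcurve (s - m'.+1); have := ell_P0_ge hcurve t0.
  by rewrite /s /t0; lia.
have fe : p`_2 ^+ 2 * z = p`_0 ^+ 2 + x * p`_1 ^+ 2.
  by apply/esym/(addvv_eq0 aff); exact: e.
exists p`_0, p`_1, p`_2; split=> //; last exact: (hp 2%N isT).
  exact: reg_Ls (hp 1%N isT).
(* If [c] were 0, then $a^2 = xb^2$, and the odd pole order of [x] leaves only $a = b = 0$. *)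
apply/eqP => c0; apply: p0; apply/polyP => i; rewrite coef0.
move: fe; rewrite c0 expr0n mul0r => /esym/(addvv_eq0 aff) e2.
have b0 : p`_1 = 0.
  apply/eqP; apply: contraT => b0.
  have a0 : p`_0 != 0.
    apply/eqP => a0; move/eqP: e2; rewrite a0 expr0n /= eq_sym mulf_eq0 (negPf x0) /= expf_eq0 /=.
    by rewrite (negPf b0).
  have := congr1 (ord P0) e2; rewrite ordM ?expf_neq0 // !ordXz ox; lia.
have a0 : p`_0 = 0 by move/eqP: e2; rewrite b0 expr0n mulr0 expf_eq0 => /eqP.
by case: i => [|[|[|i]]] //; rewrite nth_default // (leq_trans sp).
Qed.

(** A substitute for differentiation: with $v^2 = x^q$, one has $(a+vb)^2 = c^2z + ub^2$. For [z] of
    order 1 at [Q] the term $c^2z$ has odd order, so the order of [u] cannot exceed $1 +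
    2\,\mathrm{ord}_Q c$. *)
Lemma unramified Q n : Q != P0 -> (0 < n)%N ->
  let u := x ^+ (2 ^ n) + x in
  ord Q u <= 1 + 2 * t0%:Z /\ ((t0 < degp Q)%N -> ord Q u <= 1).
Proof.
move=> QP n0 u.
have [N hN] := riemann_eq hcurve.
(* A uniformiser regular outside [P0], which exists because [ell] drops from $kP_0 - Q$ to $kP_0 -
   2Q$ for large [k]. *)
have [z [z0 rz oz]] : exists z, [/\ z != 0, reg P0 z & ord Q z = 1].
  pose k := (`|N| + 2 * degp Q)%N; have fk : finsupp (pt P0 *+ k) by apply/finsuppMn/finsupp_pt.
  have fQ := finsupp_pt Q; have fQ2 : finsupp (pt Q *+ 2) by apply: finsuppMn.
  have f1 : finsupp (pt P0 *+ k - pt Q) by apply/finsuppD/finsuppN.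
  have f2 : finsupp (pt P0 *+ k - pt Q *+ 2) by apply/finsuppD/finsuppN.
  have dQ2 : deg (pt Q *+ 2) = 2 * (degp Q)%:Z by rewrite degMn // deg_pt mulrn_int.
  have := hN _ f1; have := hN _ f2; rewrite !degB // (deg_P0 hcurve) dQ2 deg_pt.
  move=> e2 e1; have dQ := degp_gt0 hcurve Q.
  have [z [hz nz]] : exists z, Ls (pt P0 *+ k - pt Q) z /\ ~ Ls (pt P0 *+ k - pt Q *+ 2) z.
    apply: contrapT => nex.
    have : (ell (pt P0 *+ k - pt Q)%R <= ell (pt P0 *+ k - pt Q *+ 2)%R)%N.
      apply: (reldim_le aff (zsub_sub F) (ellP char2 hg (goodE hcurve f1)) (ellP char2 hg (goodE hcurve f2))).
      by move=> z hz; apply: contrapT => nz; apply: nex; exists z.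
    by move: e1 e2; rewrite /k; lia.
  have z0 : z != 0 by apply/eqP => z0; apply: nz; rewrite z0; case: (Ls_sub (pt P0 *+ k - pt Q *+ 2)).
  exists z; split=> //.
    move=> R RP; have := hz R; rewrite dD dN ptMnE (negPf RP) ptE; apply: vgeW.
    by case: (R == Q); lia.
  have := hz Q; rewrite vgeP // dD dN ptMnE (negPf QP) ptE eqxx => h1.
  apply/eqP; rewrite eq_le; apply/andP; split; last by lia.
  rewrite leNgt; apply/negP => h2; apply: nz => R.
  have := hz R; rewrite !dD !dN !ptMnE; have [->|RQ] := eqVneq R Q; last by rewrite ptE (negPf RQ).
  by rewrite (negPf QP) => _; right; lia.
have [a [b [c [rb c0 hc e]]]] := square_decomposition rz.
have key : ord Q u <= 1 + 2 * ord Q c.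
  rewrite leNgt; apply/negP => big.
  pose v := x ^+ (2 ^ n.-1).
  have ev : u = v ^+ 2 + x by rewrite /u /v -exprM mulnC -expnS prednK.
  have cz0 : c ^+ 2 * z != 0 by rewrite mulf_neq0 // expf_neq0.
  have ocz : ord Q (c ^+ 2 * z) = 2 * ord Q c + 1 by rewrite ordM ?expf_neq0 // ordXz oz.
  have e2 : (a + v * b) ^+ 2 = c ^+ 2 * z + u * b ^+ 2.
    rewrite e ev (sqrD char2) exprMn mulrDl -!addrA; congr (_ + _).
    by rewrite addrC -addrA [X in _ + X]aff addr0.
  have hub : vge Q (ord Q (c ^+ 2 * z) + 1) (u * b ^+ 2).
    rewrite -[X in vge Q X _]addr0; apply: vgeM; first by right; lia.
    by apply: vgeX0; apply: rb.
  have [n0' oe] := vge_ordD char2 cz0 hub; rewrite -e2 in oe.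
  by move: oe; rewrite ordXz ocz; lia.
have rc := reg_zero_deg hcurve c0 hc QP.
have c_ge0 : 0 <= ord Q c by have := reg_Ls hc QP; rewrite vgeP.
split.
  have := degp_gt0 hcurve Q; move: key rc c_ge0; set o := ord Q c; nia.
move=> tQ; rewrite (reg_unit hcurve c0 hc QP tQ) in key.
lia.
Qed.

End Unramified.

(** * Residue fields through representatives *)

Section ResidueField.
Variables (F : fieldType) (Q : place F).
Hypothesis char2 : (2%:R : F) = 0.
Variable d : nat.
Hypothesis hd : reldim (vge Q 1) (vge Q 0) d.
Let aff := addff char2.
Implicit Types (x y z : F) (s : seq F).

Definition congQ x y : Prop := vge Q 1 (x + y).

Lemma congQ_refl x : congQ x x. Proof. by rewrite /congQ aff; exact: vge0. Qed.
Lemma congQ_sym x y : congQ x y -> congQ y x. Proof. by rewrite /congQ addrC. Qed.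
Lemma congQ_trans x y z : congQ x y -> congQ y z -> congQ x z.
Proof.
move=> h1 h2; rewrite /congQ (_ : x + z = (x + y) + (y + z)); first exact: vgeD.
by rewrite addrA (addKv aff).
Qed.
Lemma congQ_add x y x' y' : congQ x x' -> congQ y y' -> congQ (x + y) (x' + y').
Proof. by move=> h1 h2; rewrite /congQ addrACA; apply: vgeD. Qed.
Lemma vge01 x : vge Q 1 x -> vge Q 0 x. Proof. by apply: vgeW. Qed.
Lemma vgeM1 x y : vge Q 0 x -> vge Q 1 y -> vge Q 1 (x * y).
Proof. by move=> h1 h2; rewrite -[X in vge Q X _]add0r; apply: vgeM. Qed.
Lemma congQ_mul x y x' y' : vge Q 0 x -> vge Q 0 y' -> congQ x x' -> congQ y y' -> congQ (x * y) (x' * y').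
Proof.
move=> hx hy' h1 h2; apply: (@congQ_trans _ (x * y')).
  by rewrite /congQ -mulrDr; apply: vgeM1.
by rewrite /congQ -mulrDl mulrC; apply: vgeM1.
Qed.
Lemma congQ_exp2k k x y : congQ x y -> congQ (x ^+ (2 ^ k)) (y ^+ (2 ^ k)).
Proof.
move=> h; rewrite /congQ -(exp2kD char2) -(prednK (_ : 0 < 2 ^ k)%N) ?expn_gt0 // exprS.
by rewrite mulrC; apply: vgeM1 => //; apply: vgeX0; apply: vge01.
Qed.

(** The root bound in the residue field, done on lifts: division by $X - a$ keeps the quotient monic
    and integral and leaves the remainder $p(a)$, which is 0 modulo [Q]. *)
Lemma roots_mod (p : {poly F}) s : (forall i, vge Q 0 p`_i) -> p \is monic ->
  (forall x, x \in s -> vge Q 0 x /\ vge Q 1 p.[x]) ->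
  pairwise (fun x y => ~~ `[< congQ x y >]) s -> (size s <= (size p).-1)%N.
Proof.
elim: s p => [|a s IH] p // hp mp hs /= /andP[/allP na ps].
have [ha hpa] : vge Q 0 a /\ vge Q 1 p.[a] by apply: hs; rewrite inE eqxx.
have [q eq_] : exists q, p = q * ('X - a%:P) + p.[a]%:P.
  have : root (p - p.[a]%:P) a by rewrite rootE hornerD hornerN hornerC subrr.
  by move/factor_theorem => [q e]; exists q; rewrite -e subrK.
have sp : (1 < size p)%N.
  rewrite ltnNge; apply/negP => sp1; move: hpa mp; rewrite (size1_polyC sp1) hornerC.
  by rewrite monicE lead_coefC => h /eqP e; move: h; rewrite e vgeP ?oner_neq0 // ord1.
have q0 : q != 0 by apply/eqP => q0; move: sp; rewrite eq_ q0 mul0r add0r ltnNge size_polyC_leq1.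
have sq : size p = (size q).+1.
  have e1 : size (q * ('X - a%:P)) = (size q).+1 by rewrite size_Mmonic ?monicXsubC // size_XsubC addn2.
  rewrite eq_ size_polyDl // e1; apply: leq_ltn_trans (size_polyC_leq1 _) _.
  by rewrite ltnS size_poly_gt0.
have coefq i : p`_i.+1 = q`_i - q`_i.+1 * a.
  by rewrite eq_ coefD coefC /= addr0 mulrBr coefB coefMX coefMC.
have mq : q \is monic.
  rewrite monicE lead_coefE; move: mp; rewrite monicE lead_coefE sq /=.
  have -> : size q = (size q).-1.+1 by rewrite prednK // size_poly_gt0.
  rewrite coefq prednK ?size_poly_gt0 // [q`_(size q)]nth_default // mul0r subr0.
  done.
have hq i : vge Q 0 q`_i.
  have [n] := ubnP (size q - i); elim: n i => // n IHn i hn.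
  have [iq|qi] := ltnP i (size q); last by rewrite nth_default //; exact: vge0.
  have -> : q`_i = p`_i.+1 + q`_i.+1 * a by rewrite coefq subrK.
  by apply: vgeD => //; apply: vgeM0 => //; apply: IHn; lia.
have := IH q hq mq _ ps; rewrite sq /= -ltnS prednK ?size_poly_gt0 //; apply=> y ys.
 have [hy hpy] : vge Q 0 y /\ vge Q 1 p.[y] by apply: hs; rewrite inE ys orbT.
split=> //; have ny : ~ congQ a y by have /negP := na y ys; move=> h1 h2; apply: h1; apply/asboolP.
have h : vge Q 1 ((y + a) * q.[y]).
  have -> : (y + a) * q.[y] = p.[y] + p.[a].
    by rewrite [in p.[y]]eq_ !hornerE (oppx char2) (addKv aff) mulrC.
  exact: vgeD.
have ya0 : y + a != 0.
  by apply/eqP => e; apply: ny; rewrite (addvv_eq0 aff e); exact: congQ_refl.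
have o0 : ord Q (y + a) = 0.
  have h0 : vge Q 0 (y + a) by apply: vgeD.
  rewrite vgeP // in h0; apply/eqP; rewrite eq_le h0 andbT leNgt; apply/negP => h1.
  by apply: ny; rewrite /congQ addrC vgeP.
exact: vge_cancel ya0 o0 h.
Qed.

Lemma residue_reps : exists s, [/\ size s = (2 ^ d)%N, forall x, x \in s -> vge Q 0 x,
  pairwise (fun x y => ~~ `[< congQ x y >]) s, forall x, vge Q 0 x -> exists2 y, y \in s & congQ x y
  & 0 \in s].
Proof.
have [b [bd fb eb]] := hd; exists (sums b); split.
- by rewrite size_sums bd.
- move=> x /(sums_gen aff) gx; rewrite eb; apply: (gen_min aff _ _ _ gx) => //.
  + exact/(gen_sub aff)/vge_sub.
  + by move=> y ->; apply: gen_incl; exact: vge0.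
  + by move=> y yb; apply: (gen_mem aff) => //; exact: vge_sub.
- by apply: (free_pairwise aff) => //; exact: vge_sub.
- by move=> x; rewrite eb => /gen_sums[y ys h]; exists y.
- by apply/(sums_gen aff)/gen_incl.
Qed.

(** For [z] prime to [Q], multiplication by [z] permutes the nonzero representatives modulo [Q], and
    their product cancels. *)
Lemma residue_fermat z : vge Q 0 z -> congQ (z ^+ (2 ^ d)) z.
Proof.
move=> hz; have [s [ss hs ps cs s0]] := residue_reps.
have [h1|n1] := pselect (vge Q 1 z).
  rewrite /congQ; apply: vgeD => //; rewrite -(prednK (_ : 0 < 2 ^ d)%N) ?expn_gt0 // exprS mulrC.
  by apply: vgeM1 => //; apply: vgeX0.
have z0 : z != 0 by apply/eqP => z0; apply: n1; rewrite z0; exact: vge0.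
have oz : ord Q z = 0.
  move: hz n1; rewrite !vgeP // => h h'; lia.
have us : uniq s.
  rewrite uniq_pairwise; apply: sub_pairwise ps => x y; apply: contra => /eqP ->.
  by apply/asboolP; exact: congQ_refl.
have inj x y : x \in s -> y \in s -> congQ x y -> x = y.
  move=> xs ys h; apply/eqP; apply: contraT => xy; move/(pairwiseP 0): ps => ps.
  have ix : (index x s < size s)%N by rewrite index_mem.
  have iy : (index y s < size s)%N by rewrite index_mem.
  have := ltngtP (index x s) (index y s); case=> [lt|gt|e].
  - by have := ps _ _ ix iy lt; rewrite !nth_index // => /asboolPn.
  - by have := ps _ _ iy ix gt; rewrite !nth_index // => /asboolPn[]; apply: congQ_sym.
  - by move: xy; rewrite -(nth_index 0 xs) e nth_index // eqxx.
have /choice[r hr] : forall x, exists y, x \in s -> y \in s /\ congQ (z * x) y.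
  move=> x; have [xs|] := boolP (x \in s); last by exists 0.
  by have [y ys h] := cs (z * x) (vgeM0 hz (hs x xs)); exists y.
pose t := rem 0 s.
have ut : uniq t by apply: rem_uniq.
have mt x : (x \in t) = (x != 0) && (x \in s) by rewrite mem_rem_uniq // inE.
have nz x : x \in t -> ~ vge Q 1 x.
  rewrite mt => /andP[x0 xs] h; move/eqP: x0; apply; apply: inj => //.
  by rewrite /congQ addr0.
have st : (size t).+1 = (2 ^ d)%N by rewrite size_rem // ss prednK // expn_gt0.
have rt x : x \in t -> r x \in t.
  move=> xt; have := xt; rewrite mt => /andP[x0 xs]; have [rs h] := hr x xs.
  rewrite mt rs andbT; apply/eqP => r0; apply: (nz x xt).
  by move: h; rewrite /congQ r0 addr0 => /(vge_cancel z0 oz).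
have rinj : {in t &, injective r}.
  move=> x y; rewrite !mt => /andP[_ xs] /andP[_ ys] e; apply: inj => //.
  have [_ h1] := hr x xs; have [_ h2] := hr y ys; rewrite e in h1.
  have := congQ_trans h1 (congQ_sym h2); rewrite /congQ -mulrDr; exact: vge_cancel.
have pr : perm_eq (map r t) t.
  apply: uniq_perm => //; first by rewrite map_inj_in_uniq.
  have sub : {subset map r t <= t} by move=> y /mapP[x xt ->]; apply: rt.
  by have [] := uniq_min_size (_ : uniq (map r t)) sub _; rewrite ?size_map ?map_inj_in_uniq.
have prod (v : seq F) : {subset v <= t} -> congQ (\prod_(x <- v) (z * x)) (\prod_(x <- v) r x) /\
    vge Q 0 (\prod_(x <- v) r x).
  elim: v => [|x v IH] vt; first by rewrite !big_nil; split; [exact: congQ_refl | exact: vge1].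
  have [|h1 h2] := IH; first by move=> y yv; apply: vt; rewrite inE yv orbT.
  have xt : x \in t by apply: vt; rewrite inE eqxx.
  have := xt; rewrite mt => /andP[_ xs]; have [rs h] := hr x xs.
  rewrite !big_cons; split; last by apply: vgeM0 => //; apply: hs.
  by apply: congQ_mul => //; apply: vgeM0 => //; apply: hs.
have [h _] := prod t (fun x xt => xt).
rewrite -(big_map r predT id) (perm_big _ pr) /= big_split /= in h.
rewrite big_const_seq count_predT iter_mulr_1 in h.
set B := \prod_(x <- t) x in h.
have unit (v : seq F) : {subset v <= t} -> \prod_(x <- v) x != 0 /\ ord Q (\prod_(x <- v) x) = 0.
  elim: v => [|x v IH] vt; first by rewrite big_nil oner_neq0 ord1.
  have [|b0 ob] := IH; first by move=> y yv; apply: vt; rewrite inE yv orbT.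
  have xt : x \in t by apply: vt; rewrite inE eqxx.
  have := xt; rewrite mt => /andP[x0 xs].
  rewrite big_cons mulf_neq0 // ordM // ob addr0; split=> //.
  by have := hs x xs; have := nz x xt; rewrite !vgeP //; lia.
have [b0 ob] : B != 0 /\ ord Q B = 0 by apply: unit.
have : congQ (z ^+ size t) 1.
  apply: (vge_cancel b0 ob).
  by rewrite mulrDr mulr1 mulrC.
rewrite -st exprS => h1; rewrite -[X in congQ _ X]mulr1.
by apply: congQ_mul => //; [exact: vge1 | exact: congQ_refl].
Qed.

(** With [r] the remainder of [n] by [d], all $2^d$ residues are roots of $X^{2^r} + X$, which is
    too many if $0 < r < d$. *)
Lemma residue_degree_dvd n : (0 < d)%N -> (forall z, vge Q 0 z -> congQ (z ^+ (2 ^ n)) z) -> (d %| n)%N.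
Proof.
move=> d0 hn; rewrite /dvdn; apply/eqP/eqP; rewrite -leqn0 leqNgt; apply/negP => r0.
set r := (n %% d)%N in r0; have rd : (r < d)%N by rewrite ltn_mod.
have fd a z : vge Q 0 z -> congQ (z ^+ (2 ^ (a * d))) z.
  move=> hz; elim: a => [|a IH]; first by rewrite mul0n expr1; exact: congQ_refl.
  rewrite mulSn expnD exprM; apply: (congQ_trans _ IH).
  by apply: congQ_exp2k; apply: residue_fermat.
have hr z : vge Q 0 z -> congQ (z ^+ (2 ^ r)) z.
  move=> hz; apply: congQ_trans (hn z hz); apply: congQ_sym.
  by rewrite [X in (2 ^ X)%N](divn_eq n d) expnD exprM; apply/congQ_exp2k/fd.
have [s [ss hs ps _ _]] := residue_reps.
have r1 : (1 < 2 ^ r)%N by rewrite -[1%N](expn0 2) ltn_exp2l.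
pose p : {poly F} := 'X^(2 ^ r) + 'X.
have sp : size p = (2 ^ r).+1 by rewrite size_polyDl size_polyXn // size_polyX ltnS.
have := @roots_mod p s _ _ _ ps; rewrite sp /= ss leq_exp2l // => h.
have : (d <= r)%N.
  apply: h => [i||z zs].
  - rewrite coefD coefXn coefX; apply: vgeD; case: (_ == _)%N; try exact: vge0; exact: vge1.
  - by rewrite monicE lead_coefDl ?size_polyXn ?size_polyX ?ltnS // lead_coefXn.
  - split; first exact: hs.
    by rewrite hornerD hornerXn hornerX; apply/hr/hs.
by rewrite leqNgt rd.
Qed.
End ResidueField.

(** * Functions fixed by a power of Frobenius modulo a place *)

Section FrobeniusFixed.
Variables (F : fieldType) (Q : place F) (n : nat).
Hypothesis char2 : (2%:R : F) = 0.
Implicit Types z w : F.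

Definition frob_fixed z : Prop := vge Q 0 z /\ congQ Q (z ^+ (2 ^ n)) z.

Lemma frob_fixedM z w : frob_fixed z -> frob_fixed w -> frob_fixed (z * w).
Proof.
move=> [hz ez] [hw ew]; split; first exact: vgeM0.
by rewrite exprMn; apply: congQ_mul => //; apply: vgeX0.
Qed.
Lemma frob_fixed1 : frob_fixed 1.
Proof. by split; [exact: vge1 | rewrite expr1n; exact: congQ_refl]. Qed.
Lemma frob_fixed_sub : is_sub frob_fixed.
Proof.
split=> [|z w [hz ez] [hw ew]].
  by split; [exact: vge0 | rewrite expr0n expn_eq0 /=; exact: congQ_refl].
by split; [exact: vgeD | rewrite (exp2kD char2); apply: congQ_add].
Qed.
Lemma frob_fixedX z k : frob_fixed z -> frob_fixed (z ^+ k).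
Proof.
by move=> hz; elim: k => [|k IH]; rewrite ?expr0 ?exprS; [exact: frob_fixed1 | exact: frob_fixedM].
Qed.
Lemma frob_fixed_horner (p : {poly F}) z : F2poly p -> frob_fixed z -> frob_fixed p.[z].
Proof. by move=> hp hz; apply: F2c_horner => //; [exact: frob_fixed_sub | move=> i; exact: frob_fixedX]. Qed.
End FrobeniusFixed.

Section Exponents.
Variable m : nat.
Hypothesis m0 : (0 < m)%N.

(* Exponents of the monomial [x ^ i * y ^ j], [j < m], with pole order [o >= m ^ 2]. *)
Definition yexp o := (o %% m)%N.
Definition xexp o := ((o - o %% m * m.+1) %/ m)%N.

Lemma exp_order o : (m * m <= o)%N -> (xexp o * m + yexp o * m.+1 = o)%N.
Proof.
move=> mo; rewrite /xexp /yexp; have r1 : (o %% m < m)%N by rewrite ltn_mod.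
have le : (o %% m * m.+1 <= o)%N by nia.
have -> : (o - o %% m * m.+1 = (o %/ m - o %% m) * m)%N.
  by have := divn_eq o m; rewrite mulnBl mulnS; lia.
have e := divn_eq o m; move: (o %/ m)%N (o %% m)%N e le r1 => a r e le r1.
rewrite mulnK //; nia.
Qed.

Lemma yexp_lt o : (yexp o < m)%N. Proof. by rewrite ltn_mod. Qed.

End Exponents.

(** * Regular functions as fractions in $x$ and $y$ *)

Section Generation.
Variables (F : fieldType) (g : nat) (P0 : place F).
Hypothesis hcurve : pointed_curve g P0.
Let char2 : (2%:R : F) = 0. Proof. by case: hcurve. Qed.
Let hg : is_genus F g. Proof. by case: hcurve. Qed.
Let aff := addff char2.
Implicit Types (P Q : place F) (z : F).
Variables (x y : F) (m : nat).
Hypotheses (m0 : (0 < m)%N) (x0 : x != 0) (y0 : y != 0) (rx : reg P0 x) (ry : reg P0 y).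
Hypotheses (ox : ord P0 x = - m%:Z) (oy : ord P0 y = - m.+1%:Z).

Definition monomial o : F := x ^+ xexp m o * y ^+ yexp m o.

Lemma monomial_neq0 o : monomial o != 0.
Proof. by rewrite mulf_neq0 // expf_neq0. Qed.

Lemma monomial_ord o : (m * m <= o)%N -> ord P0 (monomial o) = - o%:Z.
Proof.
move=> mo; rewrite ordM ?expf_neq0 // !ordXz ox oy -[in RHS](exp_order m0 mo) PoszD !PoszM; lia.
Qed.

Lemma monomial_reg o : reg P0 (monomial o).
Proof. by apply: regM; apply: regX. Qed.

Definition monoeval k (p : {poly F}) : F := \sum_(e < k) p`_e * monomial (m * m + e).

Lemma monoeval_neq0 k p : polyF2 k p -> p != 0 -> monoeval k p != 0.
Proof.
move=> [sp hp] p0; apply: (sum_distinct_ord hcurve (a := fun e => p`_e * monomial (m * m + e))).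
  have [i pi0] : exists i, p`_i != 0.
    apply: contrapT => nz; move/eqP: p0; apply; apply/polyP => i; rewrite coef0.
    by apply/eqP; apply: contraT => pi; case: nz; exists i.
  exists i; last by rewrite mulf_neq0 // monomial_neq0.
  by rewrite ltnNge; apply: contraNN pi0 => ki; rewrite nth_default // (leq_trans sp).
have o i : (i < k)%N -> p`_i * monomial (m * m + i) != 0 ->
    ord P0 (p`_i * monomial (m * m + i)) = - (m * m + i)%:Z.
  move=> ik; case: (hp i ik) => ->; first by rewrite mul0r eqxx.
  by rewrite mul1r monomial_ord // leq_addr.
by move=> i j ik jk ai aj; rewrite !o //; lia.
Qed.

Lemma monoeval_Ls k p : polyF2 k p -> Ls (pt P0 *+ (m * m + k)) (monoeval k p).
Proof.
move=> [_ hp]; case: (Ls_sub (pt P0 *+ (m * m + k))) => s0 sD.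
rewrite /monoeval; elim/big_ind: _ => // e _; case: (hp e (ltn_ord e)) => ->; rewrite ?mul0r ?mul1r //.
apply/LsP0; split; first exact: monomial_reg.
right; rewrite monomial_ord ?leq_addr //; have := ltn_ord e; lia.
Qed.

(* The denominator [c] is bounded independently of [z]. *)
Lemma monomial_fraction z : reg P0 z -> exists k p q,
  [/\ polyF2 k p, polyF2 k q, monoeval k p != 0, Ls (pt P0 *+ (2 * (m * m) + 2)) (monoeval k p)
    & monoeval k p * z = monoeval k q].
Proof.
(* The $l_1 + k$ unknown coefficients must outnumber the dimension, at most $n+1$, of the target. As
   the monomials start only at pole order $m^2$, this takes $l_1 = m^2 + 2$. *)
move=> rz; have [N hz] := reg_pole rz; pose l1 := (m * m + 2)%N; pose k := (l1 + N)%N.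
pose dim i := if i == 0%N then l1 else k.
have hS i : reldim (@zsub {poly F}) (polyF2 (dim i)) (dim i) by apply: polyF2_dim.
have h3 := reldim_poly (addpp aff) 2 hS.
pose n := (m * m + l1 + N)%N.
have hT := ellP char2 hg (good_P0 hcurve n).
pose f (p : {poly {poly F}}) := monoeval k p`_0 * z + monoeval k p`_1.
have evD : {morph monoeval k : p q / p + q}.
  by move=> p q; rewrite -big_split; apply: eq_bigr => e _; rewrite coefD mulrDl.
have fD : {morph f : p q / p + q} by move=> p q; rewrite /f !coefD !evD; ring.
have ev1 p : polyF2 l1 p -> monoeval k p = monoeval l1 p.
  move=> [sp _]; rewrite /monoeval /k big_split_ord /= [X in _ + X]big1 ?addr0 // => e _.
  by rewrite nth_default ?mul0r //; apply: leq_trans sp (leq_addr _ _).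
have fW (p : {poly {poly F}}) : (size p <= 2)%N /\ (forall i, (i < 2)%N -> polyF2 (dim i) p`_i) ->
    Ls (pt P0 *+ n) (f p).
  move=> [_ hp]; case: (Ls_sub (pt P0 *+ n)) => _ add; apply: (add).
    have h0 : polyF2 l1 p`_0 by exact: (hp 0%N isT).
    by rewrite ev1 //; apply: (LsP0_mul (monoeval_Ls h0) hz).
  apply: (@LsP0_mono _ _ (m * m + k)); first by rewrite /n /k; lia.
  exact/monoeval_Ls/(hp 1%N).
have [|p [[sp hp] p0 e]] := reldim_kernel (addpp (addpp aff)) aff fD fW h3 hT.
  by rewrite !big_ord_recr big_ord0 /=; have := ell_P0_le hcurve n; rewrite /n /dim /= /k /l1; lia.
have h0 : polyF2 l1 p`_0 by exact: (hp 0%N isT).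
have h1 : polyF2 k p`_1 by exact: (hp 1%N isT).
have h0k : polyF2 k p`_0 by apply: (polyF2_mono _ h0); rewrite leq_addr.
have fe : monoeval k p`_0 * z = monoeval k p`_1 by apply: (addvv_eq0 aff); exact: e.
exists k, p`_0, p`_1; split=> //.
  apply: monoeval_neq0 => //; apply/eqP => p00.
  have p1 : p`_1 = 0.
    apply/eqP; apply: contraT => p1; have /negP[] := monoeval_neq0 h1 p1.
    rewrite -fe p00 /monoeval big1 ?mul0r // => i _; by rewrite coef0 mul0r.
  apply: p0; apply/polyP => i; rewrite coef0; case: i => [|[|i]] //.
  by rewrite nth_default // (leq_trans sp).
rewrite ev1 //; apply: (@LsP0_mono _ _ (m * m + l1)); first by rewrite /l1; lia.
exact: monoeval_Ls.
Qed.

(** The denominators of [monomial_fraction] are units at [Q], so every regular function is fixed by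
    the power $2^n$ modulo [Q]. Regular functions represent all residues at [Q], hence the residue
    field is fixed as well. *)
Lemma frobenius_generated Q n : Q != P0 -> (2 * (m * m) + 2 < degp Q)%N ->
  congQ Q (x ^+ (2 ^ n)) x -> congQ Q (y ^+ (2 ^ n)) y -> (degp Q %| n)%N.
Proof.
move=> QP hQ fx fy.
have ref := congQ_refl Q char2.
have fixed_x : frob_fixed Q n x by split=> //; apply: rx.
have fixed_y : frob_fixed Q n y by split=> //; apply: ry.
have fixev k p : polyF2 k p -> frob_fixed Q n (monoeval k p).
  have [fix0 fixD] := frob_fixed_sub Q n char2.
  move=> [_ hp]; rewrite /monoeval; elim/big_ind: _ => // e _.
  case: (hp e (ltn_ord e)) => ->; rewrite ?mul0r // mul1r.
  by apply: (frob_fixedM char2); apply: (frob_fixedX char2).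
have fixreg z : reg P0 z -> frob_fixed Q n z.
  move=> rz; split; first exact: rz.
  have [k [p [q [hp hq c0 hc e]]]] := monomial_fraction rz.
  have [hcO fc] := fixev _ _ hp; have [_ fr] := fixev _ _ hq.
  have oc := reg_unit hcurve c0 hc QP hQ.
  apply: (vge_cancel c0 oc); set c := monoeval k p in c0 hc e hcO fc oc *.
  have h1 : congQ Q (c ^+ (2 ^ n) * z ^+ (2 ^ n)) (c * z) by rewrite -exprMn e.
  have h2 : congQ Q (c * z ^+ (2 ^ n)) (c ^+ (2 ^ n) * z ^+ (2 ^ n)).
    apply: congQ_mul => //; [by apply: vgeX0; apply: rz | exact: congQ_sym].
  by rewrite mulrDr; apply: (congQ_trans char2 h2 h1).
have hd := place_dim hcurve Q.
apply: (residue_degree_dvd char2 hd); first exact: (degp_gt0 hcurve).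
move=> z hz.
have [N hN] := riemann_eq hcurve.
pose k := (`|N| + degp Q)%N; have fk : finsupp (pt P0 *+ k) by apply/finsuppMn/finsupp_pt.
have fQ := finsupp_pt Q; have fkQ : finsupp (pt P0 *+ k - pt Q) by apply/finsuppD/finsuppN.
have e1 := hN _ fk; have e2 := hN _ fkQ; rewrite degB // (deg_P0 hcurve) deg_pt in e1 e2.
have [|e [he el _]] := ell_ext char2 hg (goodE hcurve fkQ) (goodE hcurve fk).
  by move=> P; rewrite !dE; case: (P == Q); lia.
have ed : e = degp Q by move: e1 e2; rewrite el /k; lia.
rewrite ed in he.
have kQ : (pt P0 *+ k) Q = 0 by rewrite ptMnE (negPf QP).
have [|||w hw hzw] := reldim_cover aff (Ls_sub _) (vge_sub Q 1) (Ls_sub _) _ _ _ he hd hz.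
- by move=> w /(_ Q); rewrite kQ oppr0.
- move=> w hw; split=> [/(_ Q)|h P]; first by rewrite dD kQ dN ptE eqxx.
  have := hw P; rewrite dD dN ptE; have [->|PQ] := eqVneq P Q; first by rewrite kQ.
  by rewrite subr0.
- by apply: Ls_mono => P; rewrite !dE; case: (P == Q); lia.
have [_ fw] := fixreg w (reg_Ls hw).
have h1 : congQ Q (z ^+ (2 ^ n)) (w ^+ (2 ^ n)) by apply: congQ_exp2k.
apply: (congQ_trans char2 h1); apply: (congQ_trans char2 fw).
exact: congQ_sym.
Qed.

End Generation.

(** * The equation of $y$ over $x$ and its other roots *)

Section Conjugates.
Variables (F : fieldType) (g : nat) (P0 : place F).
Hypothesis hcurve : pointed_curve g P0.
Let char2 : (2%:R : F) = 0. Proof. by case: hcurve. Qed.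
Let hg : is_genus F g. Proof. by case: hcurve. Qed.
Let aff := addff char2.
Implicit Types (P Q : place F) (z : F).
Variables (x y : F) (m : nat).
Hypotheses (m0 : (0 < m)%N) (x0 : x != 0) (y0 : y != 0) (rx : reg P0 x) (ry : reg P0 y).
Hypotheses (ox : ord P0 x = - m%:Z) (oy : ord P0 y = - m.+1%:Z).

Lemma LsP0_X a z k : Ls (pt P0 *+ a) z -> Ls (pt P0 *+ (a * k)) (z ^+ k).
Proof.
move=> hz; elim: k => [|k IH]; last by rewrite exprS mulnS; apply: LsP0_mul.
by rewrite muln0 expr0 => Q; rewrite dMn mulr0n oppr0; exact: vge1.
Qed.

Let lx : Ls (pt P0 *+ m) x. Proof. by apply/LsP0; split=> //; right; rewrite ox. Qed.
Let ly : Ls (pt P0 *+ m.+1) y. Proof. by apply/LsP0; split=> //; right; rewrite oy. Qed.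

Lemma horner_Ls a p : polyF2 a.+1 p -> Ls (pt P0 *+ (m * a)) p.[x].
Proof.
move=> [sp hp]; case: (Ls_sub (pt P0 *+ (m * a))) => s0 sD.
rewrite horner_coef; elim/big_ind: _ => // i _.
have ia : (i < a.+1)%N by apply: leq_trans (ltn_ord i) sp.
case: (hp i ia) => ->; rewrite ?mul0r // mul1r.
by apply: (@LsP0_mono _ _ (m * i)); [rewrite leq_mul2l -ltnS ia orbT | exact: LsP0_X].
Qed.

(** The coefficient of $y^m$ in the relation is nonzero because the nonzero terms with $j < m$ have
    pole orders congruent to [j] modulo [m] and cannot cancel one another. *)
Lemma plane_relation : exists f : nat -> {poly F},
  [/\ forall j, F2poly (f j), f m != 0 & \sum_(j < m.+1) (f j).[x] * y ^+ j = 0].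
Proof.
(* Degree $m^2+1$ in [x] yields $(m+1)(m^2+2)$ coefficients, exactly one more than $n+1$. *)
pose B := (m * m + 1)%N.
have h3 := reldim_poly (addpp aff) m.+1 (fun=> polyF2_dim char2 B.+1).
pose n := (m * B + m.+1 * m)%N.
have hT := ellP char2 hg (good_P0 hcurve n).
pose ev (p : {poly {poly F}}) := \sum_(j < m.+1) (p`_j).[x] * y ^+ j.
have evD : {morph ev : p q / p + q}.
  by move=> p q; rewrite -big_split; apply: eq_bigr => j _; rewrite coefD hornerD mulrDl.
have evW (p : {poly {poly F}}) : (size p <= m.+1)%N /\ (forall i, (i < m.+1)%N -> polyF2 B.+1 p`_i) ->
    Ls (pt P0 *+ n) (ev p).
  move=> [_ hp]; case: (Ls_sub (pt P0 *+ n)) => s0 sD; rewrite /ev; elim/big_ind: _ => // j _.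
  rewrite /n; apply: LsP0_mul; first by apply: horner_Ls; apply: hp.
  apply: (@LsP0_mono _ _ (m.+1 * j)); first by rewrite leq_mul2l -ltnS ltn_ord orbT.
  exact: LsP0_X.
have [|p [[sp hp] p0 e]] := reldim_kernel (addpp (addpp aff)) aff evD evW h3 hT.
  rewrite sum_nat_const card_ord; have := ell_P0_le hcurve n; rewrite /n /B; nia.
exists (fun j => p`_j); split=> //.
  move=> j; have [jm|mj] := ltnP j m.+1; first exact: polyF2P (hp j jm).
  by rewrite nth_default ?(leq_trans sp) // => i; rewrite coef0; left.
apply/eqP => pm; have : \sum_(j < m) (p`_j).[x] * y ^+ j != 0.
  apply: (sum_distinct_ord hcurve (a := fun j => (p`_j).[x] * y ^+ j)).
    have [i pi0] : exists i, p`_i != 0.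
      apply: contrapT => nz; apply: p0; apply/polyP => i; rewrite coef0.
      by apply/eqP; apply: contraT => pi; case: nz; exists i.
    have im : (i < m)%N.
      rewrite ltnNge; apply: contraNN pi0; rewrite leq_eqVlt => /orP[/eqP <-|mi]; first exact/eqP.
      by rewrite nth_default // (leq_trans sp).
    exists i => //; rewrite mulf_neq0 ?expf_neq0 //.
    by have [] := F2poly_ord hcurve x0 ox m0 (polyF2P (hp i (ltnW im))) pi0.
  have o i : (i < m)%N -> (p`_i).[x] * y ^+ i != 0 ->
      exists k, ord P0 ((p`_i).[x] * y ^+ i) = - (m * (k + i) + i)%:Z.
    move=> im h; have pi0 : p`_i != 0 by apply: contraNneq h => ->; rewrite horner0 mul0r.
    have [q0 oq] := F2poly_ord hcurve x0 ox m0 (polyF2P (hp i (ltnW im))) pi0.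
    exists (size p`_i).-1; rewrite ordM ?expf_neq0 // oq ordXz oy. rewrite mulnDr -[m.+1]addn1 !PoszD !PoszM; ring.
  move=> i j im jm ai aj; have [k ->] := o i im ai; have [k' ->] := o j jm aj => e'.
  have {}e' : (m * (k + i) + i = m * (k' + j) + j)%N by lia.
  by have := congr1 (modn^~ m) e'; rewrite !(mulnC m) !modnMDl !modn_small.
by move=> /eqP; apply; rewrite -[RHS]e /ev big_ord_recr /= pm horner0 mul0r addr0.
Qed.

(* [fs] has the conjugates of [y] over [F_2(x)] as roots, hence [y ^ q] modulo every [Q] at which
   [x ^ q = x] but [y ^ q <> y]. *)
Lemma conjugate_relation : exists (fs : {poly F}) C, [/\ (size fs <= m)%N, fs`_m.-1 != 0,
  forall j, Ls (pt P0 *+ C) fs`_j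
  & forall Q n, Q != P0 -> congQ Q (x ^+ (2 ^ n)) x -> ~ congQ Q (y ^+ (2 ^ n)) y ->
      vge Q 1 fs.[y ^+ (2 ^ n)]].
Proof.
have [f [hf fm fy]] := plane_relation.
pose fx : {poly F} := \poly_(j < m.+1) (f j).[x].
have fm0 : (f m).[x] != 0 by have [] := F2poly_ord hcurve x0 ox m0 (hf m) fm.
have sfx : size fx = m.+1 by rewrite size_poly_eq.
have /factor_theorem[fs efs] : root fx y by rewrite rootE horner_poly fy.
have fs0 : fs != 0 by apply/eqP => fs0; move: sfx; rewrite efs fs0 mul0r size_poly0.
have sfs : size fs = m.
  by move: sfx; rewrite efs size_Mmonic ?monicXsubC // size_XsubC addn2 => -[].
have coefs i : fx`_i.+1 = fs`_i - fs`_i.+1 * y.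
  by rewrite efs mulrBr coefB coefMX coefMC.
have regfx i : reg P0 fx`_i.
  rewrite coef_poly; case: ifP => _; last by move=> Q _; exact: vge0.
  exact: reg_horner.
have regfs i : reg P0 fs`_i.
  have [n] := ubnP (m - i); elim: n i => // n IHn i hn.
  have [im|mi] := ltnP i m; last by rewrite nth_default ?sfs // => Q _; exact: vge0.
  have -> : fs`_i = fx`_i.+1 + fs`_i.+1 * y by rewrite coefs subrK.
  by apply: regD => //; apply: regM => //; apply: IHn; lia.
have /choice[N hN] : forall i, exists k, Ls (pt P0 *+ k) fs`_i by move=> i; apply: reg_pole.
exists fs, (\sum_(i < m) N i)%N; split.
- by rewrite sfs.
- by rewrite -sfs -/(lead_coef fs) lead_coef_eq0.
- move=> j; have [jm|mj] := ltnP j m; last first.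
    by rewrite nth_default ?sfs //; case: (Ls_sub (pt P0 *+ (\sum_(i < m) N i)%N)).
  apply: (@LsP0_mono _ _ (N j)) => //.
  by rewrite (bigD1 (Ordinal jm)) //= leq_addr.
move=> Q n QP cx ncy; pose q := (2 ^ n)%N.
have fixx : frob_fixed Q n x by split=> //; apply: rx.
(* Modulo [Q] the $q$-th power fixes the coefficients, so $f(x, y^q) \equiv f(x,y)^q = 0$; the
   factor $y^q - y$ is a unit at [Q] and leaves the value of [fs]. *)
have h1 : vge Q 1 fx.[y ^+ q].
  have e0 : \sum_(j < m.+1) ((f j).[x] * y ^+ j) ^+ q = 0.
    rewrite -(big_morph (fun z => z ^+ q) (exp2kD char2 n) (_ : 0 ^+ q = 0)) ?fy //.
      by rewrite expr0n expn_eq0.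
    by rewrite expr0n expn_eq0.
  rewrite horner_poly -[X in vge Q 1 X]addr0 -[X in _ + X]e0 -big_split /=; apply: vge_sum => j _.
  rewrite exprMn -!exprM (mulnC q) -mulrDl mulrC /=; apply: vgeM1.
    by apply: vgeX0; apply: ry.
  have [_] := frob_fixed_horner char2 (hf j) fixx.
  exact: congQ_sym.
have e : fx.[y ^+ q] = (y ^+ q - y) * fs.[y ^+ q] by rewrite efs !hornerE mulrC.
rewrite e (oppx char2) in h1.
have yq0 : y ^+ q + y != 0 by apply/eqP => e0; apply: ncy; rewrite /congQ e0; exact: vge0.
apply: (vge_cancel yq0 _ h1).
have : vge Q 0 (y ^+ q + y) by apply: vgeD; [apply: vgeX0 | ]; apply: ry.
move: ncy; rewrite /congQ -/q !vgeP //; move: (ord Q _) => o h2 h3; lia.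
Qed.

End Conjugates.

(** * Stepanov's auxiliary function *)

Section Auxiliary.
Variables (F : fieldType) (g : nat) (P0 : place F).
Hypothesis hcurve : pointed_curve g P0.
Let char2 : (2%:R : F) = 0. Proof. by case: hcurve. Qed.
Let hg : is_genus F g. Proof. by case: hcurve. Qed.
Let aff := addff char2.
Implicit Types (P Q : place F) (z : F).
Variables (x y : F) (m : nat).
Hypotheses (m0 : (0 < m)%N) (x0 : x != 0) (y0 : y != 0) (rx : reg P0 x) (ry : reg P0 y).
Hypotheses (ox : ord P0 x = - m%:Z) (oy : ord P0 y = - m.+1%:Z).
Variables (fs : {poly F}) (C : nat).
Hypotheses (sfs : (size fs <= m)%N) (lfs : fs`_m.-1 != 0) (hfs : forall j, Ls (pt P0 *+ C) fs`_j).
Hypothesis fs_conj : forall Q n, Q != P0 -> congQ Q (x ^+ (2 ^ n)) x -> ~ congQ Q (y ^+ (2 ^ n)) y ->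
  vge Q 1 fs.[y ^+ (2 ^ n)].
Variables (a b r : nat).
Let mu := (2 ^ a)%N.
Let q' := (2 ^ b)%N.
Let o e := (m * m + e)%N.

(** The auxiliary function will be $h = \sum_e p_e (x^i y^j)^{q'}$, where $x^i y^j$ has pole order
    $m^2+e$. Where $x^q \equiv x$, its power $h^{\mu}$ is congruent to the value of this polynomial
    at $y^q$. *)
Definition monopoly (p : {poly F}) : {poly F} :=
  \sum_(e < r) (p`_e ^+ mu * x ^+ xexp m (o e)) *: 'X^(yexp m (o e)).

Lemma monopolyD : {morph monopoly : p s / p + s}.
Proof.
move=> p s; rewrite -big_split; apply: eq_bigr => e _ /=.
by rewrite coefD (exp2kD char2) -scalerDl mulrDl.
Qed.

Lemma size_monopoly p : (size (monopoly p) <= m)%N.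
Proof.
apply: leq_trans (size_sum _ _ _) _; apply/bigmax_leqP => e _.
by apply: leq_trans (size_scale_leq _ _) _; rewrite size_polyXn yexp_lt.
Qed.

Let coefsLs (p : {poly F}) := (size p <= r)%N /\ forall i, (i < r)%N -> Ls (pt P0 *+ q'.-1) p`_i.

Lemma coef_monopoly p j : coefsLs p -> Ls (pt P0 *+ (q'.-1 * mu + (m * m + r))) (monopoly p)`_j.
Proof.
move=> [_ hp]; set n := (_ + _)%N; have [s0 sD] := Ls_sub (pt P0 *+ n).
rewrite coef_sum; elim/big_ind: _ => // e _; rewrite coefZ coefXn.
case: (_ == _)%N; last by rewrite mulr0.
rewrite mulr1 /n; apply: LsP0_mul; first exact/LsP0_X/hp.
apply: (@LsP0_mono _ _ (m * xexp m (o e))).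
  have := exp_order m0 (leq_addr e (m * m)%N : (m * m <= o e)%N); have := ltn_ord e; rewrite /o; lia.
by apply: LsP0_X; apply/LsP0; split=> //; right; rewrite ox.
Qed.

(** Zero exactly when [monopoly p] is a multiple of [fs]. Its coefficient of index $m-1$ vanishes
    identically, which leaves $m-1$ conditions. *)
Definition eliminant p : {poly F} := fs`_m.-1 *: monopoly p - (monopoly p)`_m.-1 *: fs.

(** The power $\mu$ is additive, so the conditions are linear over the field with two elements: [r]
    unknowns from $L((q'-1)P_0)$ against $m-1$ coefficients. *)
Lemma eliminant_zero : (m.-1 * (q'.-1 * mu + (m * m + r) + C + 1) < r * (q' - g))%N ->
  exists p, [/\ coefsLs p, p <> 0 & eliminant p = 0].
Proof.
move=> big; pose n := (q'.-1 * mu + (m * m + r) + C)%N.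
have hS := ellP char2 hg (good_P0 hcurve q'.-1).
have hT := ellP char2 hg (good_P0 hcurve n).
have h1 := reldim_poly aff r (fun=> hS); have h2 := reldim_poly aff m.-1 (fun=> hT).
apply: (reldim_kernel (f := eliminant) (addpp aff) (addpp aff) _ _ h1 h2).
- by move=> p s; rewrite /eliminant monopolyD coefD scalerDr scalerDl opprD addrACA.
- move=> p hp; have [s0 sD] := Ls_sub (pt P0 *+ n).
  have coefE j : (eliminant p)`_j = fs`_m.-1 * (monopoly p)`_j - (monopoly p)`_m.-1 * fs`_j.
    by rewrite coefB !coefZ.
  split; last first.
    move=> j _; rewrite coefE (oppx char2); apply: (sD); last exact: (LsP0_mul (coef_monopoly _ hp) (hfs _)).
    by rewrite mulrC; exact: (LsP0_mul (coef_monopoly _ hp) (hfs _)).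
  apply/leq_sizeP => j mj; rewrite coefE; have [<-|mj'] := eqVneq m.-1 j.
    by rewrite mulrC subrr.
  have {mj'}mj : (m <= j)%N by lia.
  rewrite [fs`_j]nth_default ?(leq_trans sfs) // [_`_j]nth_default ?(leq_trans (size_monopoly p)) //.
  by rewrite !mulr0 subrr.
rewrite !sum_nat_const !card_ord; apply: leq_ltn_trans (leq_trans big _).
  by rewrite leq_mul2l addn1 (ell_P0_le hcurve) orbT.
rewrite leq_mul2l; apply/orP; right; have := ell_P0_ge hcurve q'.-1.
have : (0 < q')%N by rewrite expn_gt0.
lia.
Qed.

Lemma vge1_exp Q z k : vge Q 1 (z ^+ k) -> vge Q 1 z.
Proof.
have [->|z0] := eqVneq z 0; first by move=> _; exact: vge0.
rewrite !vgeP ?expf_neq0 // ordXz => h; nia.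
Qed.

(* With [q = 2 ^ (a + b)]: the pole order of [h] bounds the number of [Q] with [x ^ q = x] but [y ^ q <> y]
   modulo [Q]. *)
Lemma auxiliary_function : (m.-1 * (q'.-1 * mu + (m * m + r) + C + 1) < r * (q' - g))%N ->
  exists h, [/\ h != 0, Ls (pt P0 *+ (q' * (m * m + r))) h & forall Q, Q != P0 -> (C < degp Q)%N ->
    congQ Q (x ^+ (2 ^ (a + b))) x -> ~ congQ Q (y ^+ (2 ^ (a + b))) y -> vge Q 1 h].
Proof.
move=> big; have [p [[sp hp] p0 eT]] := eliminant_zero big.
have q'0 : (0 < q')%N by rewrite expn_gt0.
pose t e := p`_e * monomial x y m (o e) ^+ q'.
have mono0 e : monomial x y m (o e) != 0 by apply: monomial_neq0.
have mono_ord e : ord P0 (monomial x y m (o e)) = - (o e)%:Z.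
  by apply: monomial_ord => //; rewrite leq_addr.
have regp e : reg P0 p`_e.
  have [er|re] := ltnP e r; first exact: reg_Ls (hp e er).
  by rewrite nth_default ?(leq_trans sp) // => Q _; exact: vge0.
have mono_reg e : reg P0 (monomial x y m (o e)) by apply: monomial_reg.
exists (\sum_(e < r) t e); split.
- apply: (sum_distinct_ord hcurve (a := t)).
    have [i pi0] : exists i, p`_i != 0.
      apply: contrapT => nz; apply: p0; apply/polyP => i; rewrite coef0.
      by apply/eqP; apply: contraT => pi; case: nz; exists i.
    exists i; last by rewrite mulf_neq0 ?expf_neq0.
    by rewrite ltnNge; apply: contraNN pi0 => ri; rewrite nth_default // (leq_trans sp).
  have ordt i : (i < r)%N -> t i != 0 -> exists2 k, (k < q')%N & ord P0 (t i) = - (o i * q' + k)%:Z.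
    move=> ir ti; have pi0 : p`_i != 0 by apply: contraNneq ti => e; rewrite /t e mul0r.
    have /LsP0[_] := hp i ir; rewrite vgeP // => h1.
    have h2 := reg_ord_le0 hcurve pi0 (regp i).
    exists `|ord P0 p`_i|%N; first lia.
    rewrite /t ordM ?expf_neq0 // ordXz mono_ord PoszD PoszM; lia.
  move=> i j ir jr ti tj; have [k kq ->] := ordt i ir ti; have [k' kq' ->] := ordt j jr tj => e.
  have {}e : (o i * q' + k = o j * q' + k')%N by lia.
  have := congr1 (divn^~ q') e; rewrite !divnMDl // !divn_small //; rewrite /o; lia.
- set n := (_ * _)%N; have [s0 sD] := Ls_sub (pt P0 *+ n).
  elim/big_ind: _ => // e _; apply: (@LsP0_mono _ _ (q'.-1 + o e * q')).
    have := ltn_ord e; rewrite /n /o; nia.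
  apply: LsP0_mul; first exact: hp.
  apply: LsP0_X; apply/LsP0; split=> //; right; rewrite mono_ord; lia.
move=> Q QP CQ cx ncy; apply: (@vge1_exp Q _ mu).
have fixx : frob_fixed Q (a + b) x by split=> //; apply: rx.
have h1 : vge Q 1 (monopoly p).[y ^+ (2 ^ (a + b))].
  have hB j : vge Q 0 (monopoly p)`_j by exact: (reg_Ls (coef_monopoly j (conj sp hp)) QP).
  have := congr1 (fun w : {poly F} => w.[y ^+ (2 ^ (a + b))]) eT.
  rewrite /eliminant hornerD hornerN !hornerZ horner0 (oppx char2) => /(addvv_eq0 aff) e.
  apply: (vge_cancel lfs (reg_unit hcurve lfs (hfs _) QP CQ)); rewrite e.
  by apply: vgeM1 => //; apply: fs_conj.
have -> : (\sum_(e < r) t e) ^+ mu = \sum_(e < r) t e ^+ mu.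
  by rewrite (big_morph (fun z => z ^+ mu) (exp2kD char2 a) (_ : 0 ^+ mu = 0)) // expr0n expn_eq0.
have eB : (monopoly p).[y ^+ (2 ^ (a + b))] =
    \sum_(e < r) p`_e ^+ mu * x ^+ xexp m (o e) * y ^+ (yexp m (o e) * 2 ^ (a + b)).
  rewrite /monopoly horner_sum; apply: eq_bigr => e _.
  by rewrite hornerZ hornerXn -exprM mulnC.
rewrite -[X in vge Q 1 X](addKv aff _ (monopoly p).[y ^+ (2 ^ (a + b))]); apply: vgeD => //.
rewrite eB -big_split; apply: vge_sum => e _ /=.
set i := xexp m (o e); set j := yexp m (o e).
have -> : t e ^+ mu + p`_e ^+ mu * x ^+ i * y ^+ (j * 2 ^ (a + b)) =
    p`_e ^+ mu * y ^+ (j * 2 ^ (a + b)) * ((x ^+ i) ^+ (2 ^ (a + b)) + x ^+ i).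
  rewrite /t /monomial -/i -/j exprMn -[(_ ^+ q') ^+ mu]exprM -[(q' * mu)%N]expnD [(b + a)%N]addnC exprMn -!exprM; ring.
apply: vgeM1; last by have [] := frob_fixedX char2 i fixx.
by apply: vgeM0; apply: vgeX0; [exact: regp | exact: ry].
Qed.
End Auxiliary.

(** For $M = m-1$ and $r = M\mu + c$ the terms $M\mu q'$ of both sides agree, and [c] pays for the
    rest, which is of order $q'$. The pole order $q'(m^2+r)$ of the auxiliary function is then
    $(m-1)q + O(\sqrt q)$. *)
Lemma auxiliary_count M g C mm mu q' c : (mu <= q')%N -> (2 * (M + g) + mm + C + 1 <= q')%N ->
  c = (2 * (M * (M + g + 1) + 1))%N ->
  (M * (q'.-1 * mu + (mm + (M * mu + c)) + C + 1) < (M * mu + c) * (q' - g))%N.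
Proof.
move=> h1 h2 e; have [d ed] : exists d, q' = (g + d.+1)%N by exists (q' - g).-1; lia.
have {}ed : q' = (g + d).+1 by rewrite ed addnS.
have -> : (q' - g = d.+1)%N by lia.
have h3 : (M * (M + g) * mu <= M * (M + g) * q')%N by rewrite leq_mul2l h1 orbT.
have h4 : (M * (mm + C + 1) <= M * q')%N by rewrite leq_mul2l; apply/orP; right; lia.
have h5 : (c * (2 * (M + g)) <= c * q')%N by rewrite leq_mul2l; apply/orP; right; lia.
have h6 : (c * q' = 2 * (M * (M + g) * q') + 2 * (M * q') + 2 * q')%N by rewrite e; lia.
rewrite ed /= in h3 h4 h5 h6 *; lia.
Qed.

(** * The lower bound for the number of points *)

Section LowerBound.
Variables (F : fieldType) (g h : nat) (P0 : place F).
Hypothesis hcurve : pointed_curve g P0.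
Let char2 : (2%:R : F) = 0. Proof. by case: hcurve. Qed.
Variable R : 'I_h -> place F -> int.
Hypothesis hR : class_reps R.
Implicit Types (P Q : place F) (z : F).

Lemma sum_subset_le (s t : seq (place F)) (p : pred (place F)) (f : place F -> nat) :
  uniq s -> uniq t -> (forall Q, p Q -> Q \in t) ->
  (\sum_(Q <- s | p Q) f Q <= \sum_(Q <- t | p Q) f Q)%N.
Proof.
move=> us ut st; apply: (uniq_sub_le_big_cond leqnn (fun a b => leq_addr b a)).
- exact: filter_uniq.
- exact: filter_uniq.
- by move=> Q; rewrite !mem_filter => /andP[pQ _]; rewrite pQ st.
Qed.

(** Of the $mq$ zeros of $x^q + x$, the auxiliary function accounts for at most $(m-1)q + O(\sqrt
    q)$ and the places of small degree for $O(1)$; the others contribute to [npts F n]. *)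
Lemma npts_lower_bound : exists C : nat, forall n, (0 < n)%N -> (2 ^ n <= npts F n + C * 2 ^ uphalf n)%N.
Proof.
have [N hN] := exact_pole hcurve; pose m' := N; pose m := m'.*2.+1.
have [x [x0 rx ox]] : exists x, [/\ x != 0, reg P0 x & ord P0 x = - m%:Z] by apply: hN; lia.
have [y [y0 ry oy]] : exists y, [/\ y != 0, reg P0 y & ord P0 y = - m.+1%:Z] by apply: hN; rewrite /m; lia.
have m0 : (0 < m)%N by [].
have [fs [C [sfs lfs hfs fs_conj]]] := conjugate_relation hcurve m0 x0 y0 rx ry ox oy.
(* Above degree [tt] the denominators from [square_decomposition] and [monomial_fraction] and the
   top coefficient of [fs] are units at the place. *)
pose t0 := (m' + 3 * g + 1)%N; pose tt := (t0 + (2 * (m * m) + 2) + C)%N.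
pose c' := (2 * (m.-1 * (m.-1 + g + 1) + 1))%N.
pose Q0 := (2 * (m.-1 + g) + m * m + C + 1)%N.
have [utt htt] := places_leP hcurve hR tt.
pose C1 := (\sum_(Q <- places_le F tt | (degp Q <= tt)%N) (1 + 2 * t0) * degp Q)%N.
(* The summands serve the places of degree at most [tt], the part of the auxiliary pole order
   proportional to $q'$, and the [n] with $q' < Q_0$. *)
exists (C1 + (m * m + c') + Q0)%N => n n0; pose q' := (2 ^ uphalf n)%N; pose mu := (2 ^ n./2)%N.
have nab : (n./2 + uphalf n = n)%N by rewrite uphalf_half; have := odd_double_half n; lia.
have qE : (2 ^ n = mu * q')%N by rewrite -expnD nab.
have muq : (mu <= q')%N by rewrite leq_exp2l // uphalf_half leq_addl.
rewrite -/q'; have [small|big] := ltnP q' Q0.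
  rewrite qE; apply: (@leq_trans (q' * Q0)); last by rewrite mulnC; lia.
  by rewrite mulnC leq_mul2l (leq_trans muq (ltnW small)) orbT.
pose r := (m.-1 * mu + c')%N.
have [w [w0 hw zw]] := auxiliary_function hcurve m0 x0 y0 rx ry ox oy sfs lfs hfs fs_conj
  (auxiliary_count muq big (erefl c') : (m.-1 * (q'.-1 * mu + (m * m + r) + C + 1) < r * (q' - g))%N).
rewrite nab in zw.
pose u := x ^+ (2 ^ n) + x.
have q2 : (2 <= 2 ^ n)%N by rewrite -{1}(expn1 2) leq_exp2l.
have [u0 ou] : u != 0 /\ ord P0 u = - (m * 2 ^ n)%:Z.
  have -> : - (m * 2 ^ n)%:Z = ord P0 (x ^+ (2 ^ n)) by rewrite ordXz ox PoszM; lia.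
  apply: (vge_ordD char2); first exact: expf_neq0.
  right; rewrite ordXz ox; nia.
have ru : reg P0 u by apply: regD => //; apply: regX.
have [s [us Ps hs]] := zeros_list hcurve u0.
have sumu : \sum_(Q <- s) ord Q u * (degp Q)%:Z = (m * 2 ^ n)%:Z.
  by rewrite (reg_zeros_eq hcurve u0 ru us Ps) ?ou ?opprK // => Q QP oQ; apply/hs.
pose f1 Q := if (degp Q <= tt)%N then ((1 + 2 * t0) * degp Q)%N else 0%N.
pose f2 Q := if (degp Q %| n)%N then degp Q else 0%N.
have bound Q : Q \in s -> ord Q u * (degp Q)%:Z <= (f1 Q)%:Z + (f2 Q)%:Z + ord Q w * (degp Q)%:Z.
  move=> /hs[QP oQ].
  have ou1 : 1 <= ord Q u by have := ru Q QP; rewrite vgeP //; lia.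
  have ow0 : 0 <= ord Q w by have := reg_Ls hw QP; rewrite vgeP.
  have [b1 b2] := @unramified F g P0 hcurve x m' x0 rx ox Q n QP n0.
  have d0 := degp_gt0 hcurve Q.
  rewrite /f1 /f2; have [small|large] := leqP (degp Q) tt.
    have : 0 <= ord Q w * (degp Q)%:Z by apply: mulr_ge0.
    have : ord Q u * (degp Q)%:Z <= ((1 + 2 * t0) * degp Q)%:Z.
      by rewrite PoszM ler_wpM2r // PoszD PoszM.
    by case: ifP => _; lia.
  have {}b2 : ord Q u <= 1 by apply: b2; apply: leq_ltn_trans large; rewrite /tt /t0; lia.
  have -> : ord Q u = 1 by apply/eqP; rewrite eq_le b2.
  have [dn|ndn] := boolP (degp Q %| n)%N.
    have : 0 <= ord Q w * (degp Q)%:Z by apply: mulr_ge0.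
    by lia.
  have cx : congQ Q (x ^+ (2 ^ n)) x by rewrite /congQ -/u vgeP.
  have ncy : ~ congQ Q (y ^+ (2 ^ n)) y.
    move=> cy; move/negP: ndn; apply.
    apply: (frobenius_generated hcurve m0 x0 y0 rx ry ox oy QP _ cx cy).
    by apply: leq_ltn_trans large; rewrite /tt; lia.
  have : vge Q 1 w by apply: zw => //; apply: leq_ltn_trans large; rewrite /tt; lia.
  by rewrite vgeP // => ow1; rewrite !add0r ler_wpM2r.
have : (m * 2 ^ n)%:Z <= C1%:Z + (npts F n)%:Z + (q' * (m * m + r))%:Z.
  rewrite -sumu big_seq; apply: le_trans (ler_sum _ bound) _; rewrite -big_seq !big_split /=.
  apply: lerD; first apply: lerD.
  - rewrite -(big_morph Posz PoszD (erefl 0%:Z)) lez_nat -big_mkcond /C1.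
    by apply: sum_subset_le => // Q; move/htt.
  - rewrite -(big_morph Posz PoszD (erefl 0%:Z)) lez_nat -big_mkcond /npts.
    have [un hn] := places_leP hcurve hR n.
    by apply: sum_subset_le => // Q dn; apply/hn/dvdn_leq.
  - have rw := reg_Ls hw; apply: le_trans (reg_zeros hcurve w0 rw us Ps) _.
    by have /LsP0[_] := hw; rewrite vgeP // => ow; lia.
rewrite -!PoszD lez_nat qE /r /m /= => hfin.
nia.
Qed.

End LowerBound.

(** * Conclusion *)

Section CountingDivisors.
Variables (F : fieldType) (g h : nat) (P0 : place F).
Hypothesis hcurve : pointed_curve g P0.
Let char2 : (2%:R : F) = 0. Proof. by case: hcurve. Qed.
Let hg : is_genus F g. Proof. by case: hcurve. Qed.
Variable R : 'I_h -> place F -> int.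
Hypothesis hR : class_reps R.
Local Notation effn := (effn P0 R).

Lemma class_number_gt0 : (0 < h)%N.
Proof.
by case: hR => _ _ _ /(_ 0 (finsupp0 F) (deg0 F))[i _]; apply: leq_trans (ltn_ord i).
Qed.

Lemma eff_deg0 (D : place F -> int) : finsupp D -> eff D -> deg D = 0 -> D = 0.
Proof.
move=> fD eD dD0; apply/funext => Q; rewrite d0.
have h1 : (`|D Q|)%:Z <= D Q by have := eD Q; lia.
have := eff_mult_le fD eD h1; rewrite dD0 => h2.
have := degp_gt0 hcurve Q; have := eD Q; move: h2; set v := D Q; nia.
Qed.

Lemma effn0 : effn 0 = 1%N.
Proof.
have [L [uL <- hL]] := effn_list hcurve hR 0.
suff /perm_size -> : perm_eq L [:: 0] by [].
apply: uniq_perm => // D; rewrite inE; apply/idP/eqP => [/hL[fD eD dD0]|->].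
  exact: eff_deg0.
by apply/hL; split; [exact: finsupp0 | | exact: deg0].
Qed.

Lemma effn_mono n n' : (n <= n')%N -> (effn n <= effn n')%N.
Proof.
move=> nn; rewrite leq_sub2r //; apply: leq_sum => i _; rewrite leq_exp2l //.
case: (hR) => fR _ _ _.
have fE k : finsupp (R i + pt P0 *+ k) by apply/finsuppD/finsuppMn/finsupp_pt.
have [|e [_ -> _]] := ell_ext char2 hg (goodE hcurve (fE n)) (goodE hcurve (fE n')).
  by move=> P; rewrite !dD !ptMnE; case: eqP; lia.
exact: leq_addr.
Qed.

(** If every class of degree [n] had a nonzero section, each term of [Tsum] would be at least 2,
    hence [effn n] at least [h]. *)
Lemma nonspecial_class n : (effn n < h)%N -> exists2 D : place F -> int, finsupp D & deg D = n%:Z /\ ell D = 0%N.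
Proof.
case: (hR) => fR dR _ _ small.
have [i ei] : exists i, ell (R i + pt P0 *+ n) = 0%N.
  apply: contrapT => nex; move: small; rewrite ltnNge => /negP; apply.
  rewrite -(leq_add2r h) effnE //.
  have -> : (h + h = \sum_(i < h) 2)%N by rewrite sum_nat_const card_ord; lia.
  apply: leq_sum => i _; rewrite -{1}(expn1 2) leq_exp2l // lt0n; apply/eqP => e.
  by apply: nex; exists i.
have fP := finsuppMn n (finsupp_pt P0).
exists (R i + pt P0 *+ n); first exact: finsuppD.
by rewrite degD // dR (deg_P0 hcurve) add0r.
Qed.

Lemma effective_count (n : nat) :
  card_is (fun D : divisor F => effective D /\ div_deg D n%:Z) (effn n).
Proof.
have [L [uL sL hL]] := effn_list hcurve hR n.
have [D0 _] := to_divisor (finsupp0 F).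
have /choice[lift hlift] : forall D : place F -> int, exists D' : divisor F, finsupp D -> dv D' = D.
  by move=> D; have [/to_divisor[D' e]|nf] := pselect (finsupp D); [exists D' | exists D0].
have liftE D : D \in L -> dv (lift D) = D by move/hL => [fD _ _]; apply: hlift.
exists (map lift L); split; last by rewrite size_map.
- apply/NoDupP; rewrite map_inj_in_uniq // => D E DL EL e.
  by rewrite -(liftE D DL) e liftE.
- move=> D; rewrite InP; split=> [[eD /(div_degP char2)[_ dD]]|/mapP[E EL ->]].
    have DL : dv D \in L by apply/hL; split=> //; exact: finsupp_dv.
    by apply/mapP; exists (dv D) => //; apply: dv_inj; rewrite liftE.
  have [fE eE dE] : [/\ finsupp E, eff E & deg E = n%:Z] by apply/hL.
  rewrite /effective (div_degP char2) liftE //; split=> //; split=> //; exact: goodE hcurve _ fE.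
Qed.

Lemma effective_count_neg (n : int) : n < 0 ->
  card_is (fun D : divisor F => effective D /\ div_deg D n) 0.
Proof.
move=> n0; exists [::]; split=> //; first exact: List.NoDup_nil.
move=> D; split=> // -[eD /(div_degP char2)[_ dD]].
by have := deg_eff (finsupp_dv D) eD; rewrite dD leNgt n0.
Qed.

End CountingDivisors.

Lemma rational_places (F : fieldType) b :
  card_is (fun P : place F => place_deg P 1) b -> (3 <= b)%N ->
  exists P1 P2 P3 : place F, [/\ P1 != P2, P1 != P3, P2 != P3 &
    [/\ place_deg P1 1, place_deg P2 1 & place_deg P3 1]].
Proof.
move=> [s [/NoDupP us hs <-]] b3; case: s us hs b3 => [|P1 [|P2 [|P3 s]]] // us hs _.
exists P1, P2, P3; split; try by apply: contraTneq us => ->; rewrite !cons_uniq !inE eqxx ?orbT ?andbF.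
by split; apply/hs; rewrite InP !inE eqxx ?orbT.
Qed.

Theorem theorem4p6 (F : fieldType) (g h : nat) :
  is_function_field_F2 F -> is_genus F g -> (3 <= g)%N -> class_number F h ->
  (exists b : nat, card_is (fun P : place F => place_deg P 1) b /\ (3 <= b)%N) ->
  forall k : nat, (2 <= k)%N ->
    (exists c : nat,
        card_is (fun D : divisor F => effective D /\ div_deg D (g%:Z - k%:Z)) c
        /\ (c < h)%N)
    /\ (exists D : divisor F, div_deg D (g%:Z - k%:Z) /\ ldim D 0).
Proof.
move=> [char2 hx fcf] hg g3 hh [b [hb b3]] k k2.
have [P0 [P2 [P3 [n02 n03 n23 [p0 p2 p3]]]]] := rational_places hb b3.
have hcurve : pointed_curve g P0 by [].
have [R hR] := class_reps_exist hcurve hh.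
have h0 := class_number_gt0 hR.
have [C low] := npts_lower_bound hcurve hR.
have [m gm] : exists m, g = m.+3 by exists (g - 3)%N; lia.
(* The degree $m+1 = g-2$ is the case $k = 2$; monotonicity of [effn] covers the other $k \le g$. *)
have main : (effn P0 R m.+1 < h)%N.
  apply: (@class_number_bound rat _ (npts F) m h C h0 (effn0 hcurve hR)) => //.
  - exact: (newton hcurve hR).
  - by move=> j; have := effn_dual hcurve hR j; rewrite gm => /(_ isT).
  - move=> n; apply: (effn_incl_excl hcurve hR n n02 n03 n23); exact/esym/(degp_uniq char2).
have divisor_of (D : place F -> int) n : finsupp D -> deg D = n -> ell D = 0%N ->
    exists D' : divisor F, div_deg D' n /\ ldim D' 0.
  move=> fD dDn eD; have [D' e] := to_divisor fD; exists D'.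
  rewrite (div_degP char2) (ldimP char2) e -eD.
  by split; [split=> //; exact: goodE hcurve _ fD | exact: (ellP char2 hg (goodE hcurve fD))].
have [kg|gk] := leqP k g.
  have -> : g%:Z - k%:Z = (g - k)%N%:Z by lia.
  have small : (effn P0 R (g - k) < h)%N.
    by apply: leq_ltn_trans main; apply: (effn_mono hcurve hR); lia.
  split; first by exists (effn P0 R (g - k)); split=> //; exact: (effective_count hcurve hR).
  by have [D fD [dDn eD]] := nonspecial_class hcurve hR small; apply: divisor_of dDn eD.
(* For $k > g$ the degree is negative: there are no effective divisors, and a negative multiple of
   [P0] has dimension zero. *)
have dneg : g%:Z - k%:Z < 0 by lia.
split; first by exists 0%N; split=> //; exact: (effective_count_neg hcurve dneg).
have fD : finsupp (- (pt P0 *+ (k - g)%N)) by apply/finsuppN/finsuppMn/finsupp_pt.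
have dDn : deg (- (pt P0 *+ (k - g)%N)) = g%:Z - k%:Z.
  rewrite degN ?(deg_P0 hcurve); first by lia.
  exact/finsuppMn/finsupp_pt.
by apply: (divisor_of _ _ fD dDn); apply: (ell_neg hcurve) => //; rewrite dDn.
Qed.
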